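(* Let $c\in\mathbf{R}$, let $M^3(c)$ be the simply connected complete Riemannian $3$-manifold of constant sectional curvature $c$, let $f:U\to M^3(c)$ be a $C^\infty$-map defined on an open subset $U$ of $\mathbf{R}^2$, and let $p\in U$ be a cross cap singular point of $f$. Let $T_1$ (resp. $T_2$) be the reflection of $M^3(c)$ with respect to the principal plane (resp. the normal plane) of $f$ at $p$, and let $T_3$ be the $180^\circ$-rotation with respect to the normal line of $f$ at $p$. Then for each $j=1,2,3$ the following three assertions are equivalent: (i) The image germ of $f$ at $p$ is invariant under the isometry $T_j$ of $M^3(c)$. (ii) There exist a connected open neighborhood $W\subset U$ of $p$ and a $C^\infty$-involution $\varphi:W\to W$ such that $f\circ\varphi=T_j\circ f$ on $W$. (iii) The two characteristic functions $a(u,v)$ and $b(v)$ of $f$ at $p$ satisfy, for all $(u,v)$ sufficiently close to $(0,0)$: if $j=1$, $a(u,-v)=a(u,v)$ and $b(v)=-b(-v)$; if $j=2$, $a(u,v)=a(-u,-v)$ and $b(v)=b(-v)$; if $j=3$, $a(-u,v)=a(u,v)$ and $b(v)=0$.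
   Context: A $C^\infty$-map $f:U\to M^3(c)$ has a cross cap singular point at $p\in U$ if its germ at $p$ is right-left equivalent (by local diffeomorphisms of source and target) to the germ at the origin of $(u,v)\mapsto(u,uv,v^2)\in\mathbf{R}^3$. Fix an orientation of $M^3(c)$ and put $o=f(p)$. For an oriented orthonormal basis $\{e_1,e_2,e_3\}$ of $T_oM^3(c)$, let $(x_1,x_2,x_3)$ be the geodesic normal coordinate system at $o$ induced by the exponential map $\exp_o$. It is known that, for a suitable choice of $\{e_1,e_2,e_3\}$ and of a positively oriented local coordinate system $(u,v)$ of $\mathbf{R}^2$ centered at $p$, the map $f$ is written near $p$ in the coordinates $(x_1,x_2,x_3)$ as $$x_1(u,v)=u,\quad x_2(u,v)=uv+b(v),\quad x_3(u,v)=a(u,v),$$ with $C^\infty$-functions $a,b$ satisfying $b(0)=b'(0)=b''(0)=0$, $a(0,0)=a_u(0,0)=a_v(0,0)=0$, $a_{vv}(0,0)>0$. In any such representation, $a$ and $b$ are called the characteristic functions of $f$ at $p$; they are considered as germs at the origin. Tangent line, principal plane, normal plane and normal line are defined as in the Euclidean case: let $(u,v)$ be local coordinates centered at $p$ with $f_v(0,0)=\mathbf{0}$, and let $f_{vv}(0,0)\in T_oM^3(c)$ be the second derivative (well defined since $f_v(0,0)=\mathbf{0}$; e.g. computed in normal coordinates at $o$). The tangent line is the geodesic through $o$ in the direction $f_u(0,0)$; the principal plane is the totally geodesic surface through $o$ tangent to the span of $f_u(0,0)$ and $f_{vv}(0,0)$; the normal plane is the totally geodesic surface through $o$ orthogonal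 to the tangent line at $o$; the normal line is the geodesic through $o$ tangent to the intersection of the tangent planes at $o$ of the principal plane and the normal plane. The isometries $T_1,T_2,T_3$ fix $o$; in the geodesic normal coordinates $(x_1,x_2,x_3)$ at $o$ induced by $\exp_o$ from an oriented orthonormal basis $\{e_1,e_2,e_3\}$ of $T_oM^3(c)$ for which $f$ is written near $p$ as $x_1(u,v)=u$, $x_2(u,v)=uv+b(v)$, $x_3(u,v)=a(u,v)$ with $a,b$ the characteristic functions, they act as the left-multiplication by the diagonal matrices $\mathrm{diag}(1,-1,1)$, $\mathrm{diag}(-1,1,1)$, $\mathrm{diag}(-1,-1,1)$, respectively. The image germ of $f$ at $p$ is invariant under an isometry $T$ if for every neighborhood $U'\subset U$ of $p$ there is a neighborhood $V\subset U'$ of $p$ such that $T(f(V))\subset f(U')$.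
   Formalization: In (ii) the involution φ is also required to fix p; without this, (ii) does not imply (i), since on a large W φ may exchange p with another point over f(p) whose cross cap is the mirror image of the one at p. *)

(* Defs.v *)
From mathcomp Require Import all_boot all_order all_algebra.
From mathcomp Require Import all_classical all_reals all_analysis.
Import Order.TTheory GRing.Theory Num.Theory.
Import numFieldNormedType.Exports.

Set Implicit Arguments.
Unset Strict Implicit.
Unset Printing Implicit Defensive.

Local Open Scope classical_set_scope.
Local Open Scope ring_scope.

(* Built on MathComp-Analysis. *)

(** ** Smooth maps *)

(* Meant for an open set [A] and finite-dimensional [V]. *)
Fixpoint Ck (R : realType) (V W : normedModType R) (k : nat) (A : set V)
    (h : V -> W) : Prop :=
  if k is k'.+1 then
    (forall x, A x -> differentiable h x) /\ (forall v : V, Ck k' A ('D_v h))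
  else forall x, A x -> {for x, continuous h}.

Definition smooth_on (R : realType) (V W : normedModType R) (A : set V)
  (h : V -> W) : Prop := forall k, Ck k A h.

Definition smooth_near (R : realType) (V W : normedModType R) (x : V)
  (h : V -> W) : Prop := exists A, [/\ open A, A x & smooth_on A h].

(* [h] is a diffeomorphism from the open set [N] of R^m onto a relatively open
   subset of the m-dimensional submanifold [S] of R^n; its inverse is smooth in
   the sense of subsets of R^n, i.e. it extends to a smooth map [k] on an open
   set [O] of R^n. For [S = setT] and [m = n] this is a diffeomorphism between
   open sets. *)
Definition parametrization (R : realType) (m n : nat)
    (N : set 'rV[R]_m.+1) (S : set 'rV[R]_n.+1)
    (h : 'rV[R]_m.+1 -> 'rV[R]_n.+1) : Prop :=
  [/\ open N, smooth_on N h &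
      exists (O : set 'rV[R]_n.+1) (k : 'rV[R]_n.+1 -> 'rV[R]_m.+1),
        [/\ open O, smooth_on O k, h @` N = S `&` O &
            forall z, N z -> k (h z) = z]].

(* A local coordinate system of [S] centered at [x], given by its inverse
   [h : N -> S]. *)
Definition local_coordinates (R : realType) (m n : nat)
    (N : set 'rV[R]_m.+1) (S : set 'rV[R]_n.+1)
    (h : 'rV[R]_m.+1 -> 'rV[R]_n.+1) (x : 'rV[R]_n.+1) : Prop :=
  [/\ N 0, h 0 = x & parametrization N S h].

Definition vec2 (R : realType) (u v : R) : 'rV[R]_2 := \row_i [:: u; v]`_i.
Definition vec3 (R : realType) (x y z : R) : 'rV[R]_3 := \row_i [:: x; y; z]`_i.

Definition partial_u (R : realType) (W : normedModType R)
  (h : 'rV[R]_2 -> W) : 'rV[R]_2 -> W := 'D_(vec2 1 0) h.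
Definition partial_v (R : realType) (W : normedModType R)
  (h : 'rV[R]_2 -> W) : 'rV[R]_2 -> W := 'D_(vec2 0 1) h.

(** ** The space form M^3(c) *)

(* M^3(c) is realized, uniformly in [c], in R^4 = R x R^3 as the hypersurface
   x_0^2 + c |x'|^2 = 1 (the sheet x_0 > 0 if c <= 0), with the Riemannian metric
   induced by dx_0^2 / c + |dx'|^2. Substituting y_0 = x_0 / sqrt |c|, it is the
   round sphere of radius 1 / sqrt c for c > 0 and the hyperboloid
   y_0^2 - |x'|^2 = 1 / |c| in Minkowski space for c < 0. For c = 0 it is the
   hyperplane x_0 = 1, tangent vectors have vanishing 0-th entry, and the term
   dx_0^2 / c (which is 0, as 0^-1 = 0) disappears: this is Euclidean space. *)

Definition dot3 (R : realType) (x y : 'rV[R]_4) : R :=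
  \sum_(i < 3) x 0 (lift ord0 i) * y 0 (lift ord0 i).

Definition space_form (R : realType) (c : R) : set 'rV[R]_4 :=
  [set x : 'rV[R]_4 | x 0 0 ^+ 2 + c * dot3 x x = 1 /\ (c <= 0 -> 0 < x 0 0)].

Definition tangent_space (R : realType) (c : R) (x : 'rV[R]_4) :
  set 'rV[R]_4 := [set w : 'rV[R]_4 | x 0 0 * w 0 0 + c * dot3 x w = 0].

Definition metric (R : realType) (c : R) (w w' : 'rV[R]_4) : R :=
  c^-1 * (w 0 0 * w' 0 0) + dot3 w w'.

Definition mnorm (R : realType) (c : R) (w : 'rV[R]_4) : R :=
  Num.sqrt (metric c w w).

(* The solutions of y'' + c y = 0 with (y, y')(0) = (1, 0) and (0, 1). *)
Definition cs (R : realType) (c r : R) : R :=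
  if 0 < c then cos (Num.sqrt c * r)
  else if c < 0 then
    (expR (Num.sqrt (- c) * r) + expR (- (Num.sqrt (- c) * r))) / 2
  else 1.

Definition sn (R : realType) (c r : R) : R :=
  if 0 < c then sin (Num.sqrt c * r) / Num.sqrt c
  else if c < 0 then
    (expR (Num.sqrt (- c) * r) - expR (- (Num.sqrt (- c) * r)))
      / 2 / Num.sqrt (- c)
  else r.

(* The exponential map of M^3(c) at [o], for [w] tangent at [o]:
   t |-> exp_map c o (t *: w) is the geodesic with initial velocity [w]. *)
Definition exp_map (R : realType) (c : R) (o w : 'rV[R]_4) : 'rV[R]_4 :=
  cs c (mnorm c w) *: o + (sn c (mnorm c w) / mnorm c w) *: w.

(* The Riemannian distance: M^3(c) is complete, so it is the least length of a
   geodesic segment from [x] to [y]. *)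
Definition geodesic_dist (R : realType) (c : R) (x y : 'rV[R]_4) : R :=
  inf [set mnorm c w | w in [set w | tangent_space c x w /\ exp_map c x w = y]].

Definition riemannian_isometry (R : realType) (c : R)
    (T : 'rV[R]_4 -> 'rV[R]_4) : Prop :=
  set_bij (space_form c) (space_form c) T /\
  forall x y, space_form c x -> space_form c y ->
    geodesic_dist c (T x) (T y) = geodesic_dist c x y.

(* The totally geodesic submanifold through [o] with tangent space [P] at [o]. *)
Definition totally_geodesic (R : realType) (c : R) (o : 'rV[R]_4)
  (P : set 'rV[R]_4) : set 'rV[R]_4 := exp_map c o @` P.

(* The isometry that fixes the totally geodesic submanifold tangent to [P] and
   reverses the geodesics through [o] orthogonal to it: the reflection with
   respect to this submanifold if [P] is a plane, the rotation by 180 degrees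
   about it if [P] is a line. This determines [T] on M^3(c). *)
Definition geodesic_symmetry (R : realType) (c : R) (o : 'rV[R]_4)
    (P : set 'rV[R]_4) (T : 'rV[R]_4 -> 'rV[R]_4) : Prop :=
  [/\ riemannian_isometry c T,
      forall x, totally_geodesic c o P x -> T x = x &
      forall n, tangent_space c o n -> (forall w, P w -> metric c n w = 0) ->
        T (exp_map c o n) = exp_map c o (- n)].

(** ** Cross caps *)

Definition standard_cross_cap (R : realType) (z : 'rV[R]_2) : 'rV[R]_3 :=
  vec3 (z 0 0) (z 0 0 * z 0 1) (z 0 1 ^+ 2).

Definition cross_cap (R : realType) (c : R) (f : 'rV[R]_2 -> 'rV[R]_4)
    (p : 'rV[R]_2) : Prop :=
  exists (N : set 'rV[R]_2) (xi : 'rV[R]_2 -> 'rV[R]_2)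
         (N' : set 'rV[R]_3) (Psi : 'rV[R]_3 -> 'rV[R]_4),
    [/\ local_coordinates N setT xi p,
        local_coordinates N' (space_form c) Psi (f p) &
        \forall z \near (0 : 'rV[R]_2),
          f (xi z) = Psi (standard_cross_cap z)].

(* The mirrors of T_1, T_2 and T_3. *)
Inductive mirror := principal_plane | normal_plane | normal_line.

(* Tangent spaces at [o] of the principal plane, normal plane and normal line,
   in terms of fu = f_u(0,0) and fvv = f_vv(0,0), where f_v(0,0) = 0. *)
Definition mirror_tangent (R : realType) (c : R) (o fu fvv : 'rV[R]_4)
    (j : mirror) : set 'rV[R]_4 :=
  let principal := [set s *: fu + t *: fvv | s in [set: R] & t in [set: R]] in
  let normal := tangent_space c o `&` [set w | metric c w fu = 0] in
  match j with
  | principal_plane => principal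
  | normal_plane => normal
  | normal_line => principal `&` normal
  end.

(* [T] is T_j for the cross cap [p] of [f], computed in the local coordinates
   [xi] centered at [p], which are assumed to satisfy f_v(0,0) = 0. The second
   derivative f_vv(0,0) taken in R^4 is then tangent to M^3(c) and coincides
   with the one computed in normal coordinates. *)
Definition cross_cap_symmetry (R : realType) (c : R)
    (f : 'rV[R]_2 -> 'rV[R]_4) (p : 'rV[R]_2) (xi : 'rV[R]_2 -> 'rV[R]_2)
    (j : mirror) (T : 'rV[R]_4 -> 'rV[R]_4) : Prop :=
  geodesic_symmetry c (f p)
    (mirror_tangent c (f p) (partial_u (f \o xi) 0)
       (partial_v (partial_v (f \o xi)) 0) j) T.

(* M^3(c) has two orientations; [eps] selects one. *)
Definition oriented_orthonormal_basis (R : realType) (c : R) (eps : bool)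
    (o e1 e2 e3 : 'rV[R]_4) : Prop :=
  [/\ tangent_space c o e1 /\ tangent_space c o e2 /\ tangent_space c o e3,
      [/\ metric c e1 e1 = 1, metric c e2 e2 = 1 & metric c e3 e3 = 1],
      [/\ metric c e1 e2 = 0, metric c e1 e3 = 0 & metric c e2 e3 = 0] &
      0 < (-1) ^+ eps * \det (\matrix_(i < 4) [:: o; e1; e2; e3]`_i)].

Definition characteristic_functions (R : realType) (c : R) (eps : bool)
    (f : 'rV[R]_2 -> 'rV[R]_4) (p : 'rV[R]_2)
    (a : 'rV[R]_2 -> R) (b : R -> R) : Prop :=
  [/\ smooth_near 0 a, smooth_near 0 b,
      [/\ b 0 = 0, derive1n 1 b 0 = 0 & derive1n 2 b 0 = 0],
      [/\ a 0 = 0, partial_u a 0 = 0, partial_v a 0 = 0 &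
          0 < partial_v (partial_v a) 0] &
      exists (e1 e2 e3 : 'rV[R]_4) (N : set 'rV[R]_2)
             (psi : 'rV[R]_2 -> 'rV[R]_2),
        [/\ oriented_orthonormal_basis c eps (f p) e1 e2 e3,
            local_coordinates N setT psi p,
            forall z, N z -> 0 < \det (jacobian psi z) &
            \forall z \near (0 : 'rV[R]_2),
              f (psi z) = exp_map c (f p)
                (z 0 0 *: e1 + (z 0 0 * z 0 1 + b (z 0 1)) *: e2 + a z *: e3)]].

(** ** The three assertions *)

Definition image_germ_invariant (R : realType) (U : set 'rV[R]_2)
    (f : 'rV[R]_2 -> 'rV[R]_4) (p : 'rV[R]_2)
    (T : 'rV[R]_4 -> 'rV[R]_4) : Prop :=
  forall U' : set 'rV[R]_2, nbhs p U' -> U' `<=` U ->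
    exists V : set 'rV[R]_2,
      [/\ nbhs p V, V `<=` U' & T @` (f @` V) `<=` f @` U'].

(* The involution is one of the pointed neighborhood (W, p): without
   [phi p = p] it could exchange [p] with another preimage of [f p], and would
   then say nothing about the germ of [f] at [p]. *)
Definition lifts_to_involution (R : realType) (U : set 'rV[R]_2)
    (f : 'rV[R]_2 -> 'rV[R]_4) (p : 'rV[R]_2)
    (T : 'rV[R]_4 -> 'rV[R]_4) : Prop :=
  exists (W : set 'rV[R]_2) (phi : 'rV[R]_2 -> 'rV[R]_2),
    [/\ [/\ open W, connected W, W p & W `<=` U],
        smooth_on W phi, phi p = p,
        forall z, W z -> W (phi z) /\ phi (phi z) = z &
        forall z, W z -> f (phi z) = T (f z)].

Definition characteristic_symmetry (R : realType) (j : mirror)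
    (a : 'rV[R]_2 -> R) (b : R -> R) : Prop :=
  \forall z \near (0 : 'rV[R]_2),
    let u := (z : 'rV[R]_2) 0 0 in let v := z 0 1 in
    match j with
    | principal_plane => a (vec2 u (- v)) = a (vec2 u v) /\ b v = - b (- v)
    | normal_plane => a (vec2 u v) = a (vec2 (- u) (- v)) /\ b v = b (- v)
    | normal_line => a (vec2 (- u) v) = a (vec2 u v) /\ b v = 0
    end.

(* Main.v *)
From HB Require Import structures.
Require Import Defs.
From mathcomp Require Import all_boot all_order all_algebra.
From mathcomp Require Import all_classical all_reals all_analysis.
From mathcomp Require Import ring lra.
Import Order.TTheory GRing.Theory Num.Theory.
Import numFieldNormedType.Exports.

(** The isometry [T] is linear in the model of the space form in R^4. Indeed an
    isometry preserves chords, so it is determined by its values at [f p] and on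
    three orthogonal geodesics through [f p] ([isometry_reflection]). In the
    geodesic normal coordinates of a frame that is adapted to the 2-jet of [f], it
    is therefore one of the matrices diag (d1, d2, 1) with [d1] and [d2] equal to 1
    or -1 ([symmetry_reflection]). The 2-jet of [f] does not change under the
    exponential map, so the frame of a pair of characteristic functions is adapted
    ([characteristic_adapted]).

    (i) implies (ii) ([invariant_involution]). In charts in which [f] is
    [(u, v) |-> (u, u v, v^2)], [T] becomes a smooth involution [tau] of R^3 at 0
    that maps the germ of the cross cap [x^2 z = y^2], [z >= 0], into itself. It
    preserves the tangent line, and it maps the double points to the axis
    [x = y = 0]: the pullback of the equation by [tau] vanishes on two transversal
    sheets at a double point, so it is critical there, whereas [x^2 z - y^2] is
    critical on the axis only ([double_points]). Thus the first two coordinates of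
    [tau] on the cross cap vanish for [u = 0], and by [hadamard] they are [u h1] and
    [u h2]. As the tangent line is preserved, [h1 0] is not 0, and the lift
    [(u h1, h2 / h1)] is smooth. It is an involution since the cross cap is
    injective off the axis [u = 0] ([cross_cap_lift]).

    (ii) implies (iii) ([involution_symmetry]). In the chart of the normal form the
    involution is [(d1 u, w)] with [d1 u w + b w = d2 (u v + b v)]. As [b] vanishes
    to second order, an intermediate value argument in [u] gives
    [b (d1 d2 v) = d2 b v], and then differentiation in [u] gives [w = d1 d2 v]
    ([second_coordinate_rigid]). The third coordinate gives the symmetry of [a].

    (iii) implies (ii): the involution is [(d1 u, d1 d2 v)] in the chart of the
    normal form ([symmetry_involution]). (ii) implies (i) by continuity of the
    involution at its fixed point [p] ([involution_invariant]). *)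

Set Implicit Arguments.
Unset Strict Implicit.
Unset Printing Implicit Defensive.

Local Open Scope classical_set_scope.
Local Open Scope ring_scope.

(** * Maps of class C^k *)

Section Germs.
Context {R : realType}.
Implicit Types V W : normedModType R.

Lemma differentiable_eps V W (f : V -> W) (x : V) (L : {linear V -> W}) :
  continuous L ->
  (forall e : R, 0 < e ->
     \forall h \near (0 : V), `|f (h + x) - f x - L h| <= e * `|h|) ->
  differentiable f x /\ 'd f x = L :> (V -> W).
Proof.
move=> cL fL.
have E : f \o shift x = cst (f x) + L +o_ 0 id.
  apply/eqaddoP => e e0; near=> h.
  rewrite /= !fctE/= opprD addrA; near: h; exact: fL.
have dE := diff_unique cL E; split=> //.
by apply/diff_locallyP; rewrite dE.
Unshelve. all: by end_near. Qed.

Lemma diff_eps V W (f : V -> W) (x : V) : differentiable f x ->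
  forall e : R, 0 < e ->
    \forall h \near (0 : V), `|f (h + x) - f x - 'd f x h| <= e * `|h|.
Proof.
move=> /diff_locally/eqaddoP fL e e0; near=> h.
have : `|(f \o shift x - (cst (f x) + 'd f x)) h| <= e * `|h|.
  by near: h; exact: fL.
by rewrite !fctE/= opprD addrA.
Unshelve. all: by end_near. Qed.

Lemma near_differentiable V W (f g : V -> W) (x : V) :
  (\near x, f x = g x) -> differentiable f x -> differentiable g x.
Proof.
move=> fg df; have fgx := nbhs_singleton fg.
have cdf : continuous ('d f x) by exact: diff_continuous df.
suff : differentiable g x /\ 'd g x = 'd f x :> (V -> W) by case.
apply: differentiable_eps => // e e0.
have fgh : \forall h \near (0 : V), f (h + x) = g (h + x).
  by have := fg; rewrite (near_shift 0) subr0.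
near=> h.
rewrite -(near fgh h)// -fgx; near: h.
exact: diff_eps.
Unshelve. all: by end_near. Qed.

Lemma Ck_continuous V W k (A : set V) (h : V -> W) :
  Ck k A h -> forall x, A x -> {for x, continuous h}.
Proof.
case: k => [//|k] /= [dh _] x Ax; exact/differentiable_continuous/dh.
Qed.

Lemma CkW V W k (A : set V) (h : V -> W) : Ck k.+1 A h -> Ck k A h.
Proof.
elim: k h => [|k IH] h; first exact: Ck_continuous.
by move=> [dh Dh]; split=> // v; apply: IH; exact: Dh.
Qed.

Lemma Ck_sub V W k (A B : set V) (h : V -> W) : A `<=` B -> Ck k B h -> Ck k A h.
Proof.
move=> AB; elim: k h => [|k IH] h /=; first by move=> ch x /AB; exact: ch.
by move=> [dh Dh]; split=> [x /AB|v]; [exact: dh|apply: IH].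
Qed.

Lemma near_open V (A : set V) (P : V -> Prop) x :
  open A -> A x -> (forall y, A y -> P y) -> \near x, P x.
Proof.
by move=> oA Ax AP; apply: (@filterS _ _ _ A) => //; exact: open_nbhs_nbhs.
Qed.

Lemma Ck_ext V W k (A : set V) (h g : V -> W) : open A ->
  (forall x, A x -> h x = g x) -> Ck k A h -> Ck k A g.
Proof.
move=> oA; elim: k h g => [|k IH] h g hg /=.
  move=> ch x Ax; have : h y @[y --> x] --> h x := ch x Ax.
  rewrite (hg x Ax) => hx; apply: cvg_trans hx; apply: near_eq_cvg.
  exact: near_open Ax hg.
move=> [dh Dh]; split=> [x Ax|v].
  by apply: near_differentiable (dh _ Ax); exact: near_open Ax hg.
apply: IH (Dh v) => x Ax; apply: near_eq_derive.
exact: near_open Ax hg.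
Qed.

Lemma Ck_cst V W k (A : set V) (a : W) : Ck k A (fun=> a).
Proof.
elim: k a => [|k IH] a /=; first by move=> x _; exact: cvg_cst.
split=> [x _|v]; first exact: differentiable_cst.
suff -> : 'D_v (fun=> a) = (fun=> 0) :> (V -> W) by exact: IH.
by apply/funext => x; exact: derive_cst.
Qed.

Lemma Ck_linear V W k (A : set V) (L : {linear V -> W}) : continuous L ->
  Ck k A L.
Proof.
move=> cL; case: k => [|k] /=; first by move=> x _; exact: cL.
split=> [x _|v]; first exact: linear_differentiable.
suff -> : 'D_v L = (fun=> L v) by exact: Ck_cst.
apply/funext => x; rewrite deriveE ?diff_lin//.
exact: linear_differentiable.
Qed.

Lemma CkD V W k (A : set V) (f g : V -> W) : open A ->
  Ck k A f -> Ck k A g -> Ck k A (fun x => f x + g x).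
Proof.
move=> oA; elim: k f g => [|k IH] f g /=.
  by move=> cf cg x Ax; apply: cvgD; [exact: cf|exact: cg].
move=> [df Df] [dg Dg]; split=> [x Ax|v].
  by apply: differentiableD; [exact: df|exact: dg].
apply: (@Ck_ext _ _ _ _ (fun x => 'D_v f x + 'D_v g x)) => //.
  move=> x Ax; rewrite -deriveD//; apply: diff_derivable; [exact: df|exact: dg].
exact: IH.
Qed.

Lemma Ck_comp_linear V W W' k (A : set V) (L : {linear W -> W'}) (h : V -> W) :
  open A -> continuous L -> Ck k A h -> Ck k A (fun x => L (h x)).
Proof.
move=> oA cL; elim: k h => [|k IH] h /=.
  by move=> ch x Ax; apply: continuous_comp; [exact: ch|exact: cL].
move=> [dh Dh]; split=> [x Ax|v].
  apply: (@differentiable_comp _ _ _ _ h L); first exact: dh.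
  exact: linear_differentiable.
apply: (@Ck_ext _ _ _ _ (fun x => L ('D_v h x))) => //; last exact: IH.
move=> x Ax; rewrite [RHS]deriveE; last first.
  apply: (@differentiable_comp _ _ _ _ h L); first exact: dh.
  exact: linear_differentiable.
rewrite (@diff_comp _ _ _ _ h L) //=; last exact: linear_differentiable.
  by rewrite diff_lin// deriveE//; exact: dh.
exact: dh.
Qed.

Lemma CkN V W k (A : set V) (f : V -> W) : open A ->
  Ck k A f -> Ck k A (fun x => - f x).
Proof.
move=> oA; elim: k f => [|k IH] f /=.
  by move=> cf x Ax; apply: cvgN; exact: cf.
move=> [df Df]; split=> [x Ax|v]; first by apply: differentiableN; exact: df.
apply: (@Ck_ext _ _ _ _ (fun x => - 'D_v f x)) => //; last exact: IH.
by move=> x Ax; rewrite -deriveN//; apply: diff_derivable; exact: df.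
Qed.

Lemma CkM V k (A : set V) (f g : V -> R) : open A ->
  Ck k A f -> Ck k A g -> Ck k A (fun x => f x * g x).
Proof.
move=> oA; elim: k f g => [|k IH] f g.
  by move=> cf cg x Ax; apply: cvgM; [exact: cf|exact: cg].
move=> fk gk; have [df Df] := fk; have [dg Dg] := gk; split=> [x Ax|v].
  by apply: (@differentiableM _ _ f g); [exact: df|exact: dg].
apply: (@Ck_ext _ _ _ _ (fun x => f x * 'D_v g x + g x * 'D_v f x)) => //.
  move=> x Ax; rewrite [RHS](@deriveM _ _ f g)//; apply: diff_derivable; [exact: df|exact: dg].
by apply: CkD => //; apply: IH; [exact: CkW fk|exact: Dg|exact: CkW gk|exact: Df].
Qed.

Lemma Ck_sum V W k (A : set V) n (f : 'I_n -> V -> W) : open A ->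
  (forall i, Ck k A (f i)) -> Ck k A (fun x => \sum_i f i x).
Proof.
move=> oA; elim: n f => [|n IH] f fk.
  by apply: (@Ck_ext _ _ _ _ (fun=> 0)) => // [x _|]; [rewrite big_ord0|exact: Ck_cst].
apply: (@Ck_ext _ _ _ _ (fun x => f ord0 x + \sum_i f (lift ord0 i) x)) => //.
  by move=> x _; rewrite big_ord_recl.
by apply: CkD => //; apply: IH.
Qed.

Lemma CkV V k (A : set V) (f : V -> R) : open A -> (forall x, A x -> f x != 0) ->
  Ck k A f -> Ck k A (fun x => (f x)^-1).
Proof.
move=> oA f0; elim: k => [|k IH].
  by move=> cf x Ax; apply: cvgV; [exact: f0|exact: cf].
move=> fk; have [df Df] := fk; split=> [x Ax|v].
  by apply: (@differentiableV _ _ f); [exact: df|exact: f0].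
apply: (@Ck_ext _ _ _ _ (fun x => - ((f x)^-1 * (f x)^-1 * 'D_v f x))) => //.
  move=> x Ax; rewrite [RHS](@deriveV _ _ f); [|exact: f0|exact/diff_derivable/df].
  by rewrite -exprVn expr2 scaleNr.
have Ik := IH (CkW fk); apply: CkN => //; apply: CkM => //; last exact: Df.
exact: CkM.
Qed.

(** The coordinates are abstract so that the chain rule covers both R and R^n
    as the intermediate space. *)
Lemma derive_comp_coord V V' n (E : 'I_n -> V') (pi : 'I_n -> V' -> R)
    (g : V' -> R) (h : V -> V') (x v : V) :
  (forall y, y = \sum_i pi i y *: E i) ->
  differentiable h x -> differentiable g (h x) ->
  'D_v (fun x => g (h x)) x = \sum_i pi i ('D_v h x) * 'D_(E i) g (h x).
Proof.
move=> piE dh dg; rewrite deriveE; last first.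
  exact: (@differentiable_comp _ _ _ _ h g).
rewrite (@diff_comp _ _ _ _ h g)//= -(deriveE _ dh) [X in 'd _ _ X = _](piE ('D_v h x)) linear_sum.
by apply: eq_bigr => i _; rewrite linearZ/= (deriveE _ dg).
Qed.

Lemma Ck_comp_coord V V' n (E : 'I_n -> V') (pi : 'I_n -> {linear V' -> R})
    k (A : set V) (B : set V') (g : V' -> R) (h : V -> V') :
  (forall y, y = \sum_i pi i y *: E i) -> (forall i, continuous (pi i)) ->
  open A -> (forall x, A x -> B (h x)) ->
  Ck k B g -> Ck k A h -> Ck k A (fun x => g (h x)).
Proof.
move=> piE cpi oA AB; elim: k g => [|k IH] g.
  by move=> cg ch x Ax; apply: continuous_comp; [exact: ch|exact/cg/AB].
move=> [dg Dg] hk; have [dh Dh] := hk; split=> [x Ax|v].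
  by apply: (@differentiable_comp _ _ _ _ h g); [exact: dh|exact/dg/AB].
apply: (@Ck_ext _ _ _ _
  (fun x => \sum_i pi i ('D_v h x) * 'D_(E i) g (h x))) => //.
  move=> x Ax; rewrite (@derive_comp_coord _ _ _ E (fun i => pi i))//.
    exact: dh.
  exact/dg/AB.
apply: Ck_sum => // i; apply: CkM => //.
  exact: (@Ck_comp_linear _ _ _ _ _ (pi i) _ oA (cpi i) (Dh v)).
exact: IH (Dg _) (CkW hk).
Qed.

End Germs.

Section RowGerms.
Context {R : realType}.
Implicit Types V W : normedModType R.

Definition row_coord n (i : 'I_n) (x : 'rV[R]_n) : R := x 0 i.

Lemma row_coord_is_linear n (i : 'I_n) : linear (@row_coord n i).
Proof. by move=> a x y; rewrite /row_coord !mxE. Qed.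

HB.instance Definition _ n (i : 'I_n) :=
  GRing.isLinear.Build R 'rV[R]_n R _ (@row_coord n i) (@row_coord_is_linear n i).

Lemma row_coord_continuous n (i : 'I_n) : continuous (@row_coord n i).
Proof. by move=> x; exact: coord_continuous. Qed.

Definition scaler_at W (w : W) (t : R) : W := t *: w.

Lemma scaler_at_is_linear W (w : W) : linear (@scaler_at W w).
Proof. by move=> a x y; rewrite /scaler_at scalerDl scalerA. Qed.

HB.instance Definition _ W (w : W) :=
  GRing.isLinear.Build R R W _ (@scaler_at W w) (@scaler_at_is_linear W w).

Lemma scaler_at_continuous W (w : W) : continuous (@scaler_at W w).
Proof. by move=> x; apply: cvgZr_tmp; exact: cvg_id. Qed.

Lemma derive_row V n (h : V -> 'rV[R]_n) (x v : V) (i : 'I_n) :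
  differentiable h x -> 'D_v h x 0 i = 'D_v (fun y => h y 0 i) x.
Proof.
by move=> dh; rewrite derive_mx ?mxE//; exact: diff_derivable.
Qed.

(** * Germs of smooth maps *)

(** [Ck k A] is a condition on each point of [A], so it may be checked on a
    different set around each of them. *)
Lemma Ck_local V W k (A : set V) (h : V -> W) :
  (forall x, A x -> exists B : set V, B x /\ Ck k B h) -> Ck k A h.
Proof.
elim: k h => [|k IH] h hk /=.
  by move=> x /hk[B [Bx]]; apply.
split=> [x /hk[B [Bx [dh _]]]|v]; first exact: dh.
by apply: IH => x /hk[B [Bx [_ Dh]]]; exists B; split=> //; exact: Dh.
Qed.

Lemma smooth_on_near V W (A : set V) (h : V -> W) x :
  open A -> A x -> smooth_on A h -> smooth_near x h.
Proof. by move=> oA Ax hA; exists A; split. Qed.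

Lemma near_smooth_on V W (A : set V) (h : V -> W) :
  (forall x, A x -> smooth_near x h) -> smooth_on A h.
Proof.
by move=> hA k; apply: Ck_local => x /hA[B [_ Bx hB]]; exists B; split.
Qed.

Lemma smooth_near_near V W (h : V -> W) x :
  smooth_near x h -> \forall y \near x, smooth_near y h.
Proof.
move=> [A [oA Ax hA]]; apply: (near_open oA Ax) => y Ay.
by exists A; split.
Qed.

Lemma smooth_near_eq V W (h g : V -> W) x :
  h =1 g -> smooth_near x h -> smooth_near x g.
Proof. by move=> /funext ->. Qed.

Lemma smooth_near_differentiable V W (h : V -> W) x :
  smooth_near x h -> differentiable h x.
Proof. by move=> [A [_ Ax /(_ 1%N)[dh _]]]; exact: dh. Qed.

Lemma smooth_near_continuous V W (h : V -> W) x :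
  smooth_near x h -> h y @[y --> x] --> h x.
Proof. by move=> /smooth_near_differentiable/differentiable_continuous. Qed.

Lemma near_image V W (h : V -> W) (x : V) (y : W) (P : W -> Prop) :
  smooth_near x h -> h x = y -> (\forall w \near y, P w) -> \forall z \near x, P (h z).
Proof. by move=> sh <- Py; exact: (smooth_near_continuous sh) _ Py. Qed.

Lemma smooth_near_derive V W (h : V -> W) x v :
  smooth_near x h -> smooth_near x ('D_v h).
Proof. by move=> [A [oA Ax hA]]; exists A; split=> // k; case: (hA k.+1) => _ /(_ v). Qed.

(** On the intersection of two domains, an operation on germs reduces to its C^k
    version. *)
Lemma smooth_near_lift2 V V1 V2 W (h1 : V -> V1) (h2 : V -> V2) (h : V -> W) x :
  (forall k A, open A -> Ck k A h1 -> Ck k A h2 -> Ck k A h) ->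
  smooth_near x h1 -> smooth_near x h2 -> smooth_near x h.
Proof.
move=> H [A [oA Ax hA]] [B [oB Bx hB]]; exists (A `&` B); split => //.
  exact: openI.
move=> k; apply: H; first exact: openI.
  by apply: Ck_sub (hA k) => y [].
by apply: Ck_sub (hB k) => y [].
Qed.

Lemma smooth_near_cst V W (a : W) (x : V) : smooth_near x (fun=> a).
Proof.
by exists setT; split; [exact: openT|by []|move=> k; exact: Ck_cst].
Qed.

Lemma smooth_near_linear V W (L : {linear V -> W}) (x : V) :
  continuous L -> smooth_near x L.
Proof.
by move=> cL; exists setT; split; [exact: openT|by []|move=> k; exact: Ck_linear].
Qed.

Lemma smooth_nearD V W (f g : V -> W) x : smooth_near x f -> smooth_near x g ->
  smooth_near x (fun y => f y + g y).
Proof. by apply: smooth_near_lift2 => k A oA; exact: CkD. Qed.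

Lemma smooth_nearN V W (f : V -> W) x : smooth_near x f ->
  smooth_near x (fun y => - f y).
Proof.
by move=> [A [oA Ax hA]]; exists A; split=> // k; exact: CkN.
Qed.

Lemma smooth_nearB V W (f g : V -> W) x : smooth_near x f -> smooth_near x g ->
  smooth_near x (fun y => f y - g y).
Proof. by move=> fx gx; apply: smooth_nearD => //; exact: smooth_nearN. Qed.

Lemma smooth_nearM V (f g : V -> R) x : smooth_near x f -> smooth_near x g ->
  smooth_near x (fun y => f y * g y).
Proof. by apply: smooth_near_lift2 => k A oA; exact: CkM. Qed.

Lemma smooth_nearX V (f : V -> R) n x : smooth_near x f ->
  smooth_near x (fun y => f y ^+ n).
Proof.
move=> fx; elim: n => [|n IH].
  by apply: smooth_near_eq (smooth_near_cst (1 : R) x) => y; rewrite expr0.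
by apply: smooth_near_eq (smooth_nearM fx IH) => y; rewrite exprS.
Qed.

Lemma smooth_nearV V (f : V -> R) x : f x != 0 -> smooth_near x f ->
  smooth_near x (fun y => (f y)^-1).
Proof.
move=> fx0 fx; have [A [oA Ax fA]] := fx.
have : \forall y \near x, f y != 0.
  exact: (smooth_near_continuous fx) _ (open_nbhs_nbhs (conj (@open_neq _ 0) fx0)).
move=> f0.
exists (A `&` ((fun y => f y != 0)^°)%classic).
have oB : open (A `&` ((fun y => f y != 0)^°)%classic).
  by apply: openI => //; exact: open_interior.
split=> // k; apply: CkV => //; first by move=> y [_ /interior_subset].
by apply: Ck_sub (fA k) => y [].
Qed.

Lemma smooth_near_sum V W n (f : 'I_n -> V -> W) x :
  (forall i, smooth_near x (f i)) -> smooth_near x (fun y => \sum_i f i y).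
Proof.
elim: n f => [|n IH] f fx.
  by apply: smooth_near_eq (smooth_near_cst (0 : W) x) => y; rewrite big_ord0.
by apply: smooth_near_eq (smooth_nearD (fx ord0) (IH _ (fun i => fx (lift ord0 i)))) => y; rewrite big_ord_recl.
Qed.

Lemma smooth_near_comp_linear V W W' (L : {linear W -> W'}) (h : V -> W) x :
  continuous L -> smooth_near x h -> smooth_near x (fun y => L (h y)).
Proof.
by move=> cL [A [oA Ax hA]]; exists A; split=> // k; exact: Ck_comp_linear.
Qed.

Lemma smooth_near_scale V W (f : V -> R) (w : W) x :
  smooth_near x f -> smooth_near x (fun y => f y *: w).
Proof.
exact: (@smooth_near_comp_linear _ _ _ (scaler_at w) f x (@scaler_at_continuous _ w)).
Qed.

Lemma smooth_near_rowP V n (h : V -> 'rV[R]_n) x :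
  smooth_near x h <-> forall i, smooth_near x (fun y => h y 0 i).
Proof.
split=> [hx i|hx].
  exact: (smooth_near_comp_linear (@row_coord_continuous _ i) hx).
apply: (@smooth_near_eq _ _ (fun x => \sum_i h x 0 i *: delta_mx 0 i)).
  by move=> y; rewrite -row_sum_delta.
by apply: smooth_near_sum => i; exact: smooth_near_scale.
Qed.

Lemma smooth_near_coord n (i : 'I_n) (x : 'rV[R]_n) :
  smooth_near x (fun y : 'rV[R]_n => y 0 i).
Proof. exact: (smooth_near_linear x (@row_coord_continuous _ i)). Qed.

Lemma smooth_near_id V (x : V) : smooth_near x id.
Proof. by apply: (@smooth_near_linear _ _ idfun) => y; exact: cvg_id. Qed.

Lemma smooth_near_comp_coord V V' n (E : 'I_n -> V') (pi : 'I_n -> {linear V' -> R})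
    (g : V' -> R) (h : V -> V') x :
  (forall y, y = \sum_i pi i y *: E i) -> (forall i, continuous (pi i)) ->
  smooth_near (h x) g -> smooth_near x h -> smooth_near x (fun y => g (h y)).
Proof.
move=> piE cpi [B [oB Bhx gB]] hx; have [A [oA Ax hA]] := hx.
have : \forall y \near x, B (h y).
  exact: (smooth_near_continuous hx) _ (open_nbhs_nbhs (conj oB Bhx)).
move=> hB.
have oC : open (A `&` ((fun y => B (h y))^°)%classic).
  by apply: openI => //; exact: open_interior.
exists (A `&` ((fun y => B (h y))^°)%classic); split=> // k.
apply: (Ck_comp_coord piE cpi oC _ (gB k)).
  by move=> y [_ /interior_subset].
by apply: Ck_sub (hA k) => y [].
Qed.

Lemma smooth_near_comp V n (g : 'rV[R]_n -> R) (h : V -> 'rV[R]_n) x :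
  smooth_near (h x) g -> smooth_near x h -> smooth_near x (fun y => g (h y)).
Proof.
apply: (@smooth_near_comp_coord _ _ _ (delta_mx 0) (fun i => row_coord i)).
  exact: row_sum_delta.
exact: row_coord_continuous.
Qed.

Lemma smooth_near_comp_row V n m (g : 'rV[R]_n -> 'rV[R]_m) (h : V -> 'rV[R]_n) x :
  smooth_near (h x) g -> smooth_near x h -> smooth_near x (fun y => g (h y)).
Proof.
move=> /smooth_near_rowP gx hx; apply/smooth_near_rowP => i.
exact: (smooth_near_comp (gx i) hx).
Qed.

Lemma smooth_near_compR V (g : R -> R) (h : V -> R) x :
  smooth_near (h x) g -> smooth_near x h -> smooth_near x (fun y => g (h y)).
Proof.
have := @smooth_near_comp_coord V R 1 (fun=> 1) (fun=> idfun) g h x.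
apply.
  by move=> y; rewrite big_ord1 /= [_ *: _]mulr1.
by move=> _ y; exact: cvg_id.
Qed.

Lemma derive_comp_row V n (g : 'rV[R]_n -> R) (h : V -> 'rV[R]_n) (x v : V) :
  differentiable h x -> differentiable g (h x) ->
  'D_v (fun y => g (h y)) x =
    \sum_i 'D_v (fun y => h y 0 i) x * 'D_(delta_mx 0 i) g (h x).
Proof.
move=> dh dg.
rewrite (@derive_comp_coord _ _ _ _ (delta_mx 0) (fun i => row_coord i))//.
  by apply: eq_bigr => i _; rewrite -derive_row.
exact: row_sum_delta.
Qed.

Lemma derive_compR V (g : R -> R) (h : V -> R) (x v : V) :
  differentiable h x -> differentiable g (h x) ->
  'D_v (fun y => g (h y)) x = 'D_v h x * 'D_1 g (h x).
Proof.
move=> dh dg.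
have -> := @derive_comp_coord R V R 1 (fun=> 1) (fun=> idfun) g h x v; rewrite ?big_ord1//.
by move=> y; rewrite big_ord1 /= [_ *: _]mulr1.
Qed.

End RowGerms.

(** * Calculus in the plane *)

Section Plane.
Context {R : realType}.
Implicit Types V W : normedModType R.

Lemma row_norm_le n (x : 'rV[R]_n) (e : R) :
  0 <= e -> (forall i, `|x 0 i| <= e) -> `|x| <= e.
Proof.
move=> e0 xe; rewrite /Num.Def.normr/= mx_normrE; apply: bigmax_le => // -[i j] _.
by rewrite ord1.
Qed.

Lemma row_coord_le n (x : 'rV[R]_n) i : `|x 0 i| <= `|x|.
Proof.
rewrite [leRHS]/Num.Def.normr/= mx_normrE.
exact: (le_bigmax _ (fun ij : 'I_1 * 'I_n => `|x ij.1 ij.2|) (0, i)).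
Qed.

Lemma vec2_u (u v : R) : vec2 u v 0 0 = u. Proof. by rewrite mxE. Qed.
Lemma vec2_v (u v : R) : vec2 u v 0 1 = v. Proof. by rewrite mxE. Qed.
Definition vec2E := (vec2_u, vec2_v).

Lemma forall_ord2 (P : 'I_2 -> Prop) : P 0 -> P 1 -> forall i, P i.
Proof.
move=> P0 P1 [[|[|//]] i2].
  by rewrite (_ : Ordinal i2 = 0)//; apply: val_inj.
by rewrite (_ : Ordinal i2 = 1)//; apply: val_inj.
Qed.

Lemma row2P (x y : 'rV[R]_2) : x 0 0 = y 0 0 -> x 0 1 = y 0 1 -> x = y.
Proof. by move=> h0 h1; apply/rowP; exact: forall_ord2. Qed.

Lemma vec2_eta (z : 'rV[R]_2) : vec2 (z 0 0) (z 0 1) = z.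
Proof. by apply: row2P; rewrite vec2E. Qed.

Lemma vec2_norm_le (u v e : R) : `|u| <= e -> `|v| <= e -> `|vec2 u v| <= e.
Proof.
move=> ue ve; apply: row_norm_le; first exact: le_trans ue.
by apply: forall_ord2; rewrite vec2E.
Qed.

Lemma sum2 (W : zmodType) (f : 'I_2 -> W) : \sum_i f i = f 0 + f 1.
Proof.
rewrite !big_ord_recl big_ord0 addr0; congr (f _ + f _); exact: val_inj.
Qed.

Lemma delta_vec2u : delta_mx 0 0 = vec2 1 0 :> 'rV[R]_2.
Proof. by apply: row2P; rewrite !mxE. Qed.

Lemma delta_vec2v : delta_mx 0 1 = vec2 0 1 :> 'rV[R]_2.
Proof. by apply: row2P; rewrite !mxE. Qed.

Lemma vec2_decomp (k : 'rV[R]_2) : k = k 0 0 *: vec2 1 0 + k 0 1 *: vec2 0 1.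
Proof. by apply: row2P; rewrite !mxE/= ?(mulr0,mulr1,addr0,add0r). Qed.

Lemma derive_linear V W (G : V -> W) (q k l : V) (a b : R) :
  differentiable G q ->
  'D_(a *: k + b *: l) G q = a *: 'D_k G q + b *: 'D_l G q.
Proof. by move=> dG; rewrite !deriveE// linearP linearZ. Qed.

Lemma derive_coord n (i : 'I_n) (x v : 'rV[R]_n) :
  'D_v (fun y : 'rV[R]_n => y 0 i) x = v 0 i.
Proof.
have cL : continuous (@row_coord R n i) by exact: row_coord_continuous.
rewrite -[LHS]/('D_v (row_coord i) x) deriveE ?diff_lin//.
exact: linear_differentiable.
Qed.

Lemma derive_add V W (f g : V -> W) (x v : V) : differentiable f x ->
  differentiable g x -> 'D_v (fun y => f y + g y) x = 'D_v f x + 'D_v g x.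
Proof. by move=> df dg; rewrite -deriveD//; exact: diff_derivable. Qed.

Lemma derive_mul V (f g : V -> R) (x v : V) : differentiable f x ->
  differentiable g x ->
  'D_v (fun y => f y * g y) x = f x * 'D_v g x + g x * 'D_v f x.
Proof.
by move=> df dg; rewrite [LHS](@deriveM _ _ f g)//; exact: diff_derivable.
Qed.

Lemma derive_cstM V (a : R) (g : V -> R) (x v : V) : differentiable g x ->
  'D_v (fun y => a * g y) x = a * 'D_v g x.
Proof.
move=> dg; have da : differentiable (fun=> a : R) x by exact: differentiable_cst.
by rewrite (derive_mul v da dg) (derive_cst a) mulr0 addr0.
Qed.

Lemma deriveR_scale (b : R -> R) (x k : R) : differentiable b x -> 'D_k b x = k * 'D_1 b x.
Proof.
by move=> db; rewrite !deriveE// -[in LHS](mulr1 k) [k * 1]/(k *: 1) linearZ.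
Qed.

Lemma derive_vec2 W (G : 'rV[R]_2 -> W) (q k : 'rV[R]_2) : differentiable G q ->
  'D_k G q = k 0 0 *: partial_u G q + k 0 1 *: partial_v G q.
Proof. by move=> dG; rewrite {1}(vec2_decomp k) derive_linear. Qed.

Lemma segment_norm_le V (w k : V) (m s : R) : `|w| <= m -> `|w + k| <= m ->
  0 <= s <= 1 -> `|w + s *: k| <= m.
Proof.
move=> wm wkm /andP[s0 s1].
have -> : w + s *: k = (1 - s) *: w + s *: (w + k).
  by rewrite scalerBl scale1r scalerDr addrA subrK.
rewrite (le_trans (ler_normD _ _))// !normrZ (ger0_norm s0) ger0_norm ?subr_ge0//.
have -> : m = (1 - s) * m + s * m by rewrite -mulrDl subrK mul1r.
by rewrite lerD// ler_wpM2l// subr_ge0.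
Qed.

Lemma segment_norm_lt V (w k : V) (r s : R) : `|w| < r -> `|w + k| < r ->
  0 <= s <= 1 -> `|w + s *: k| < r.
Proof.
move=> wr wkr s01.
apply: (@le_lt_trans _ _ (Num.max `|w| `|w + k|)); last by rewrite gt_max wr.
by apply: segment_norm_le => //; rewrite le_max lexx ?orbT.
Qed.

Lemma is_derive_line V (G : V -> R) (w k : V) (s : R) :
  differentiable G (w + s *: k) ->
  is_derive s 1 (fun t => G (w + t *: k)) ('D_k G (w + s *: k)).
Proof.
move=> dG.
have dl : is_diff s (fun t : R => w + t *: k) (fun t => t *: k).
  have := @is_diffD R _ _ (cst w) (fun t : R => t *: k) (fun=> 0) (fun t => t *: k) s _ _.
  have -> : (fun=> 0) + (fun t : R => t *: k) = (fun t : R => t *: k).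
    by apply/funext => t; rewrite !fctE add0r.
  exact.
have dc : differentiable (fun t : R => G (w + t *: k)) s.
  by apply: (@differentiable_comp _ _ _ _ (fun t : R => w + t *: k) G).
apply: DeriveDef; first exact: diff_derivable.
rewrite deriveE//.
rewrite (@diff_comp _ _ _ _ (fun t : R => w + t *: k) G)//=.
by rewrite diff_val scale1r deriveE.
Qed.

Lemma MVT_line V (G : V -> R) (w k : V) :
  (forall s : R, 0 <= s <= 1 -> differentiable G (w + s *: k)) ->
  exists2 s : R, 0 <= s <= 1 & G (w + k) - G w = 'D_k G (w + s *: k).
Proof.
move=> dG.
have [| |s s01 E] := @MVT_segment R (fun t => G (w + t *: k))
    (fun t => 'D_k G (w + t *: k)) 0 1 ler01.
- by move=> x; rewrite in_itv/= => /andP[x0 x1]; apply/is_derive_line/dG; rewrite !ltW.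
- apply: continuous_in_subspaceT => x; rewrite inE/= in_itv/= => x01.
  apply: (@differentiable_continuous _ _ _ x).
  by apply/derivable1_diffP; apply: ex_derive; apply/is_derive_line/dG.
- exists s; first by move: s01; rewrite in_itv.
  by rewrite -[RHS]mulr1 -{1}[1]subr0 -E scale1r scale0r addr0.
Qed.

End Plane.

(** * The integral over the unit interval *)

Section UnitIntegral.
Context {R : realType}.
Implicit Types f g : R -> R.

Definition unit_int f : R := \int[lebesgue_measure]_(t in `[0, 1]) f t.

Definition continuous01 f := forall t : R, 0 <= t <= 1 -> {for t, continuous f}.

Lemma continuous01_within f : continuous01 f -> {within `[0, 1], continuous f}.
Proof.
move=> cf; apply: continuous_in_subspaceT => x; rewrite inE/= in_itv/=.
exact: cf.
Qed.

Lemma unit_int_integrable f : continuous01 f ->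
  lebesgue_measure.-integrable `[0, 1] (EFin \o f).
Proof.
move=> /continuous01_within cf.
by apply: continuous_compact_integrable => //; exact: segment_compact.
Qed.

Lemma unit_intD f g : continuous01 f -> continuous01 g ->
  unit_int (fun t => f t + g t) = unit_int f + unit_int g.
Proof. by move=> cf cg; apply: RintegralD => //; exact: unit_int_integrable. Qed.

Lemma unit_intZ f a : continuous01 f ->
  unit_int (fun t => a * f t) = a * unit_int f.
Proof. by move=> cf; apply: RintegralZl => //; exact: unit_int_integrable. Qed.

Lemma unit_int_le f e : continuous01 f ->
  (forall t, 0 <= t <= 1 -> `|f t| <= e) -> `|unit_int f| <= e.
Proof.
move=> cf fe; apply: (le_trans (le_normr_Rintegral _ _)) => //.
  exact: unit_int_integrable.
have -> : e = \int[lebesgue_measure]_(t in `[0, 1 : R]) e.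
  by rewrite Rintegral_cst//= lebesgue_measure_itv/= lte01 oppr0 addr0 mulr1.
apply: le_Rintegral => //.
- apply: unit_int_integrable => t t01.
  by apply: (@continuous_comp _ _ _ f (fun x => `|x|)); [exact: cf|exact: norm_continuous].
- by apply: unit_int_integrable => t _; exact: cvg_cst.
Qed.

Lemma unit_int_FTC f F : continuous01 f ->
  (forall t : R, 0 <= t <= 1 -> is_derive t 1 F (f t)) ->
  unit_int f = F 1 - F 0.
Proof.
move=> cf dF.
have cF t : 0 <= t <= 1 -> {for t, continuous F}.
  move=> /dF Ft; apply: differentiable_continuous; apply/derivable1_diffP.
  exact: ex_derive.
rewrite /unit_int /Rintegral (@continuous_FTC2 _ f F)//.
- exact: continuous01_within.
- split.
  + move=> x; rewrite in_itv/= => /andP[x0 x1].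
    by apply: ex_derive; apply: dF; rewrite !ltW.
  + by apply: cvg_at_right_filter; apply: cF; rewrite lexx ler01.
  + by apply: cvg_at_left_filter; apply: cF; rewrite lexx ler01.
- move=> x; rewrite in_itv/= => /andP[x0 x1].
  by rewrite derive1E; apply: derive_val; apply: dF; rewrite !ltW.
Qed.

Lemma continuous01D f g : continuous01 f -> continuous01 g ->
  continuous01 (fun t => f t + g t).
Proof. by move=> cf cg t t01; apply: cvgD; [exact: cf|exact: cg]. Qed.

Lemma continuous01Z f a : continuous01 f -> continuous01 (fun t => a * f t).
Proof. by move=> cf t t01; apply: cvgM; [exact: cvg_cst|exact: cf]. Qed.

Lemma unit_int_comb f0 f1 f2 f3 a1 a2 a3 :
    continuous01 f0 -> continuous01 f1 -> continuous01 f2 -> continuous01 f3 ->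
  continuous01 (fun t => f0 t + (a1 * f1 t + (a2 * f2 t + a3 * f3 t))) /\
  unit_int (fun t => f0 t + (a1 * f1 t + (a2 * f2 t + a3 * f3 t))) =
  unit_int f0 + (a1 * unit_int f1 + (a2 * unit_int f2 + a3 * unit_int f3)).
Proof.
move=> c0 c1 c2 c3.
have e1 := continuous01Z (a := a1) c1; have e2 := continuous01Z (a := a2) c2.
have e3 := continuous01Z (a := a3) c3; have e23 := continuous01D e2 e3.
have e123 := continuous01D e1 e23; split; first exact: continuous01D c0 e123.
rewrite (unit_intD c0 e123) (unit_intD e1 e23) (unit_intD e2 e3).
by rewrite (unit_intZ _ c1) (unit_intZ _ c2) (unit_intZ _ c3).
Qed.

End UnitIntegral.

(** * Hadamard's lemma *)

Section Hadamard.
Context {R : realType}.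
Implicit Types (G : 'rV[R]_2 -> R) (z q w k : 'rV[R]_2).

Lemma ball0E (V : normedModType R) (r : R) (z : V) : ball 0 r z = (`|z| < r) :> Prop.
Proof. by rewrite -ball_normE /ball_/= sub0r normrN. Qed.

Definition shrink (t : R) z : 'rV[R]_2 := vec2 (t * z 0 0) (z 0 1).

Lemma shrink_norm (t : R) z : 0 <= t <= 1 -> `|shrink t z| <= `|z|.
Proof.
move=> /andP[t0 t1]; apply: vec2_norm_le; last exact: row_coord_le.
rewrite normrM (ger0_norm t0) (le_trans _ (row_coord_le z 0))//.
by rewrite ler_piMl.
Qed.

Lemma shrinkD (t : R) z w : shrink t (z + w) = shrink t z + shrink t w.
Proof. by apply: row2P; rewrite !mxE/= ?mxE// mulrDr. Qed.

Lemma shrink_dist (t s : R) z : `|shrink t z - shrink s z| <= `|t - s| * `|z|.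
Proof.
rewrite (_ : _ - _ = vec2 ((t - s) * z 0 0) 0); last first.
  by apply: row2P; rewrite !mxE/= ?mxE/=; ring.
apply: vec2_norm_le; last by rewrite normr0 mulr_ge0.
by rewrite normrM ler_wpM2l// row_coord_le.
Qed.

Lemma shrink_continuous z (t : R) : shrink s z @[s --> t] --> shrink t z.
Proof.
apply/cvgrPdist_le => e e0.
have d0 : 0 < e / (`|z| + 1) by rewrite divr_gt0// ltr_wpDl.
near=> s; apply: (le_trans (shrink_dist _ _ _)).
have ts : `|t - s| <= e / (`|z| + 1).
  near: s; apply/nbhs_ballP; exists (e / (`|z| + 1)) => //= s /=.
  by rewrite /ball_/= => /ltW.
apply: (@le_trans _ _ (e / (`|z| + 1) * (`|z| + 1))).
  by apply: ler_pM => //; rewrite lerDl.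
by rewrite divfK// gt_eqF// ltr_wpDl.
Unshelve. all: by end_near. Qed.

Lemma two_quarters (e x y z : R) :
  `|x - y| <= e / 4 -> `|x - z| <= e / 4 -> `|y - z| <= e / 2.
Proof. by move=> xy xz; rewrite -(subrKA x) (le_trans (ler_normD _ _))// (distrC y); lra. Qed.

(** The difference quotient is controlled at all points near [q] at once; the
    uniformity over a compact family of points rests on this. *)
Lemma smooth_strict_diff G q (e : R) : smooth_near q G -> 0 < e ->
  exists2 d : R, 0 < d & forall w k, `|w - q| < d -> `|w + k - q| < d ->
    `|G (w + k) - G w - (k 0 0 * partial_u G w + k 0 1 * partial_v G w)|
      <= e * `|k|.
Proof.
move=> Gq e0; have e4 : 0 < e / 4 by rewrite divr_gt0.
have cu : partial_u G y @[y --> q] --> partial_u G q.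
  exact/smooth_near_continuous/smooth_near_derive.
have cv : partial_v G y @[y --> q] --> partial_v G q.
  exact/smooth_near_continuous/smooth_near_derive.
have : \forall y \near q, [/\ smooth_near y G,
    `|partial_u G q - partial_u G y| <= e / 4 &
    `|partial_v G q - partial_v G y| <= e / 4].
  have N2 : \forall y \near q, `|partial_u G q - partial_u G y| <= e / 4.
    exact: (cvgr_dist_le _ _ cu).
  have N3 : \forall y \near q, `|partial_v G q - partial_v G y| <= e / 4.
    exact: (cvgr_dist_le _ _ cv).
  have N1 := smooth_near_near Gq.
  by apply: filterS3 N1 N2 N3 => y y1 y2 y3; split.
move=> /nbhs_ballP[d /= d0 dP]; exists d => // w k wd wkd.
have dP' y : `|y - q| < d -> [/\ smooth_near y G,
    `|partial_u G q - partial_u G y| <= e / 4 &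
    `|partial_v G q - partial_v G y| <= e / 4].
  by move=> yd; apply: dP; rewrite -ball_normE/= distrC.
have seg s : 0 <= s <= 1 -> `|w + s *: k - q| < d.
  by rewrite addrAC; apply: segment_norm_lt => //; rewrite addrAC.
have [s s01 ->] := @MVT_line R _ G w k (fun s s01 =>
  let: And3 sy _ _ := dP' _ (seg s s01) in smooth_near_differentiable sy).
have [sy uy vy] := dP' _ (seg s s01).
have [_ uw vw] := dP' _ wd.
rewrite derive_vec2; last exact: smooth_near_differentiable.
set a := partial_u G (w + s *: k); set b := partial_v G (w + s *: k).
rewrite -/a -/b in uy vy; clearbody a b.
have -> : k 0 0 *: a + k 0 1 *: b - (k 0 0 * partial_u G w + k 0 1 * partial_v G w)
  = k 0 0 * (a - partial_u G w) + k 0 1 * (b - partial_v G w).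
  by rewrite -[k 0 0 *: a]/(k 0 0 * a) -[k 0 1 *: b]/(k 0 1 * b); ring.
apply: (le_trans (ler_normD _ _)); rewrite !normrM.
have K0 := row_coord_le k 0; have K1 := row_coord_le k 1.
have M0 : `|k 0 0| * `|a - partial_u G w| <= `|k| * (e / 2).
  by apply: ler_pM => //; exact: two_quarters uy uw.
have M1 : `|k 0 1| * `|b - partial_v G w| <= `|k| * (e / 2).
  by apply: ler_pM => //; exact: two_quarters vy vw.
by apply: (le_trans (lerD M0 M1)); rewrite -mulrDr -splitr mulrC.
Qed.

(** The weights [t ^ n] make the family stable under differentiation: the partial
    derivatives of [avg n G] are [avg n.+1 (partial_u G)] and
    [avg n (partial_v G)]. So its members are smooth all at once. *)
Definition avg (n : nat) G z : R := unit_int (fun t => t ^+ n * G (shrink t z)).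

Section Avg.
Variable r : R.

Lemma shrink_ball (t : R) z : 0 <= t <= 1 -> ball 0 r z -> ball 0 r (shrink t z).
Proof. by move=> t01; rewrite !ball0E; apply: le_lt_trans; exact: shrink_norm. Qed.

Lemma avg_continuous01 n G z : smooth_on (ball 0 r) G -> ball 0 r z ->
  continuous01 (fun t => t ^+ n * G (shrink t z)).
Proof.
move=> sG zr t t01; apply: cvgM; first exact: exprn_continuous.
apply: (@continuous_comp _ _ _ (fun t => shrink t z) G).
  exact: shrink_continuous.
apply: smooth_near_continuous; apply: (smooth_on_near (A := ball 0 r)) => //.
  exact: ball_open.
exact: shrink_ball.
Qed.

Lemma smooth_on_partial_u G : smooth_on (ball 0 r) G ->
  smooth_on (ball 0 r) (partial_u G).
Proof. by move=> sG k; exact: (proj2 (sG k.+1) (vec2 1 0)). Qed.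

Lemma smooth_on_partial_v G : smooth_on (ball 0 r) G ->
  smooth_on (ball 0 r) (partial_v G).
Proof. by move=> sG k; exact: (proj2 (sG k.+1) (vec2 0 1)). Qed.

Definition pair_form (a b : R) (h : 'rV[R]_2) : R := h 0 0 * a + h 0 1 * b.

Lemma pair_form_is_linear a b : linear (pair_form a b).
Proof. by move=> s x y; rewrite /pair_form !mxE /GRing.scale/=; ring. Qed.

HB.instance Definition _ a b :=
  GRing.isLinear.Build R 'rV[R]_2 R _ (pair_form a b) (pair_form_is_linear a b).

Lemma pair_form_continuous a b : continuous (pair_form a b).
Proof.
move=> x; apply: smooth_near_continuous.
exact: (smooth_nearD (smooth_nearM (smooth_near_coord 0 x) (smooth_near_cst a x))
  (smooth_nearM (smooth_near_coord 1 x) (smooth_near_cst b x))).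
Qed.

Lemma avg_diff n G z : smooth_on (ball 0 r) G -> ball 0 r z ->
  differentiable (avg n G) z /\
  forall v, 'D_v (avg n G) z =
    v 0 0 * avg n.+1 (partial_u G) z + v 0 1 * avg n (partial_v G) z.
Proof.
move=> sG zr.
have sU := smooth_on_partial_u sG; have sV := smooth_on_partial_v sG.
suff [dA dE] : differentiable (avg n G) z /\ 'd (avg n G) z =
    pair_form (avg n.+1 (partial_u G) z) (avg n (partial_v G) z) :> ('rV[R]_2 -> R).
  by split=> // v; rewrite deriveE// dE.
apply: differentiable_eps; first exact: pair_form_continuous.
move=> e e0.
pose P (h : 'rV[R]_2) (t : R) := 0 <= t <= 1 ->
  `|G (shrink t (z + h)) - G (shrink t z) -
    (t * h 0 0 * partial_u G (shrink t z) + h 0 1 * partial_v G (shrink t z))|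
  <= e * `|h|.
have key (h : 'rV[R]_2) : ball 0 r (h + z) -> `[0, 1]%classic `<=` P h ->
    `|avg n G (h + z) - avg n G z -
      pair_form (avg n.+1 (partial_u G) z) (avg n (partial_v G) z) h| <= e * `|h|.
  move=> zhr hP.
  have c0 := @avg_continuous01 n _ _ sG zhr.
  have c1 := @avg_continuous01 n _ _ sG zr.
  have c2 := @avg_continuous01 n.+1 _ _ sU zr.
  have c3 := @avg_continuous01 n _ _ sV zr.
  pose F t := t ^+ n * G (shrink t (h + z)) + (-1 * (t ^+ n * G (shrink t z)) +
    (- h 0 0 * (t ^+ n.+1 * partial_u G (shrink t z)) +
     - h 0 1 * (t ^+ n * partial_v G (shrink t z)))).
  have [cF FE] : continuous01 F /\ unit_int F = avg n G (h + z) + (-1 * avg n G z +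
      (- h 0 0 * avg n.+1 (partial_u G) z + - h 0 1 * avg n (partial_v G) z)).
    exact: (@unit_int_comb R _ _ _ _ (-1) (- h 0 0) (- h 0 1) c0 c1 c2 c3).
  have ringE (a b c d x y : R) : a + (-1 * b + (- x * c + - y * d)) = a - b - (x * c + y * d).
    by ring.
  have ringE' (p t x b c d q w : R) : p * x + (-1 * (p * b) + (- q * (t * p * c) + - w * (p * d)))
      = p * (x - b - (t * q * c + w * d)).
    by ring.
  rewrite ringE in FE; rewrite /pair_form -FE; apply: (unit_int_le cF) => t t01.
  have /(_ t01) : P h t by apply: hP; rewrite /= in_itv.
  rewrite (addrC z) /F exprS ringE'; apply: le_trans.
  rewrite normrM normrX; case/andP: t01 => t0 t1.
  by rewrite ler_piMl// exprn_ile1// ger0_norm.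
(* Compactness of [0, 1] makes the expansion uniform in [t]. *)
have : \forall h \near (0 : 'rV[R]_2), `[0, 1]%classic `<=` P h.
  have nc : near_covering (`[0, 1]%classic : set R).
    by apply/compact_near_coveringP; exact: segment_compact.
  apply: (nc _ (nbhs (0 : 'rV[R]_2)) P).
  move=> t /=; rewrite in_itv/= => t01.
  have [|d d0 dG] := @smooth_strict_diff G (shrink t z) e _ e0.
    apply: (smooth_on_near (A := ball 0 r)) => //; first exact: ball_open.
    exact: shrink_ball.
  exists ([set t' | `|shrink t z - shrink t' z| < d / 2], [set h | `|h| < d / 2]).
    split=> /=.
      by apply: (cvgr_dist_lt _ _ (@shrink_continuous z t)); rewrite divr_gt0.
    apply/nbhs_ballP; exists (d / 2); first by rewrite /= divr_gt0.
    by move=> h; rewrite ball0E.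
  move=> [t' h] /= [td hd] t'01.
  have kh : `|shrink t' h| <= `|h| by exact: shrink_norm.
  rewrite shrinkD; apply: (le_trans _ (ler_wpM2l (ltW e0) kh)).
  have := dG (shrink t' z) (shrink t' h); rewrite vec2E vec2E; apply.
    by rewrite distrC; apply: (lt_trans td); lra.
  rewrite addrAC (le_lt_trans (ler_normD _ _))// distrC.
  by have := le_lt_trans kh hd; lra.
move=> hP; near=> h.
have zhr : ball 0 r (h + z).
  near: h.
  have : \forall y \near z, ball 0 r y.
    by apply: open_nbhs_nbhs; split=> //; exact: ball_open.
  by rewrite (near_shift 0) subr0.
have hPh : `[0, 1]%classic `<=` P h by near: h.
exact: key zhr hPh.
Unshelve. all: by end_near. Qed.

Lemma avg_smooth n G : smooth_on (ball 0 r) G -> smooth_on (ball 0 r) (avg n G).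
Proof.
move=> sG k; elim: k n G sG => [|k IH] n G sG.
  by move=> z zr; apply: differentiable_continuous; case: (avg_diff n sG zr).
split=> [z zr|v]; first by case: (avg_diff n sG zr).
apply: (@Ck_ext _ _ _ _ _ (fun z => v 0 0 * avg n.+1 (partial_u G) z +
                                    v 0 1 * avg n (partial_v G) z)).
- exact: ball_open.
- by move=> z zr; case: (avg_diff n sG zr) => _ ->.
- have oB : open (ball (0 : 'rV[R]_2) r) by exact: ball_open.
  apply: CkD => //; apply: CkM => //; try exact: Ck_cst.
    by apply: IH; exact: smooth_on_partial_u.
  by apply: IH; exact: smooth_on_partial_v.
Qed.

(** [avg 0 (partial_u G)] is the quotient of [G] by the first coordinate, by the
    fundamental theorem of calculus along [t |-> shrink t z]. *)
Lemma avg_quotient G z : smooth_on (ball 0 r) G -> ball 0 r z ->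
  G z - G (vec2 0 (z 0 1)) = z 0 0 * avg 0 (partial_u G) z.
Proof.
move=> sG zr; have sU := smooth_on_partial_u sG.
have c : continuous01 (fun t => partial_u G (shrink t z)).
  have := @avg_continuous01 0 _ _ sU zr.
  set f := (X in continuous01 X -> _); set g := (X in _ -> continuous01 X).
  suff -> : f = g by [].
  by apply/funext => t; rewrite /f expr0 mul1r.
have dG (t : R) : 0 <= t <= 1 -> is_derive t 1 (fun t : R => G (shrink t z))
    (z 0 0 * partial_u G (shrink t z)).
  move=> t01.
  have E s : shrink s z = vec2 0 (z 0 1) + s *: vec2 (z 0 0) 0.
    by apply: row2P; rewrite !mxE/= ?mxE/=; ring.
  have dG : differentiable G (vec2 0 (z 0 1) + t *: vec2 (z 0 0) 0).
    rewrite -E; apply: smooth_near_differentiable.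
    apply: (smooth_on_near (A := ball 0 r)) => //; first exact: ball_open.
    exact: shrink_ball.
  have -> : (fun t => G (shrink t z)) =
      (fun s => G (vec2 0 (z 0 1) + s *: vec2 (z 0 0) 0)).
    by apply/funext => s; rewrite E.
  have := is_derive_line dG.
  by rewrite derive_vec2// !vec2E scale0r addr0 E.
have cZ := continuous01Z (a := z 0 0) c.
have FTC := @unit_int_FTC R _ _ cZ dG.
have -> : avg 0 (partial_u G) z = unit_int (fun t => partial_u G (shrink t z)).
  by rewrite /avg; congr unit_int; apply/funext => t; rewrite expr0 mul1r.
rewrite -(unit_intZ _ c) FTC; congr (G _ - G _); rewrite /shrink ?mul1r ?mul0r//.
by rewrite vec2_eta.
Qed.

End Avg.

(** Hadamard's lemma: a smooth function vanishing on the axis [u = 0] is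
    divisible by [u]. *)
Lemma hadamard G : smooth_near 0 G ->
  (\forall v \near (0 : R), G (vec2 0 v) = 0) ->
  exists h : 'rV[R]_2 -> R, [/\ smooth_near 0 h,
    \forall z \near (0 : 'rV[R]_2), G z = z 0 0 * h z &
    h 0 = partial_u G 0].
Proof.
move=> [A [oA A0 sG]] /nbhs_ballP[r1 /= r10 G0].
have /nbhs_ballP[r2 /= r20 r2A] : nbhs (0 : 'rV[R]_2) A.
  exact: open_nbhs_nbhs.
pose r := Num.min r1 r2.
have r0 : 0 < r by rewrite lt_min r10.
have sGr : smooth_on (ball 0 r) G.
  move=> k; apply: Ck_sub (sG k) => z zr; apply: r2A.
  by move: zr; rewrite !ball0E => /lt_le_trans; apply; rewrite ge_min lexx orbT.
have z0 : ball (0 : 'rV[R]_2) r 0 by exact: ballxx.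
exists (avg 0 (partial_u G)); split.
- apply: (smooth_on_near (A := ball 0 r)) => //; first exact: ball_open.
  exact/avg_smooth/smooth_on_partial_u.
- apply: (near_open (A := ball 0 r)) => //; first exact: ball_open.
  move=> z zr; rewrite -(avg_quotient sGr zr) G0 ?subr0//.
  rewrite /= ball0E; move: zr; rewrite ball0E => /(le_lt_trans (row_coord_le z 1)).
  by move=> /lt_le_trans; apply; rewrite ge_min lexx.
- rewrite /avg (_ : (fun _ => _) = cst (partial_u G 0)); last first.
    apply/funext => t; rewrite expr0 mul1r /shrink !mxE mulr0.
    by congr (partial_u G _); apply: row2P; rewrite !mxE.
  by rewrite /unit_int Rintegral_cst//= lebesgue_measure_itv/= lte01 oppr0 addr0 mulr1.
Qed.

End Hadamard.

(** * The space form and its metric *)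

Section SpaceForm.
Context {R : realType}.
Variable c : R.
Implicit Types x y z w o : 'rV[R]_4.

(** The bilinear form whose unit hypersurface contains the space form; it equals
    [c * metric c] unless [c = 0]. *)
Definition qform x y : R := x 0 0 * y 0 0 + c * dot3 x y.

Lemma dot3E x y : dot3 x y = x 0 (lift ord0 ord0) * y 0 (lift ord0 ord0) +
  (x 0 (lift ord0 (lift ord0 ord0)) * y 0 (lift ord0 (lift ord0 ord0)) +
   x 0 (lift ord0 (lift ord0 (lift ord0 ord0))) * y 0 (lift ord0 (lift ord0 (lift ord0 ord0)))).
Proof. by rewrite /dot3 !big_ord_recl big_ord0 addr0. Qed.

Lemma dot3C x y : dot3 x y = dot3 y x.
Proof. by apply: eq_bigr => i _; rewrite mulrC. Qed.

Lemma dot3_lin a b x y z : dot3 (a *: x + b *: y) z = a * dot3 x z + b * dot3 y z.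
Proof. by rewrite !dot3E !mxE; ring. Qed.

Lemma qform_lin a b x y z : qform (a *: x + b *: y) z = a * qform x z + b * qform y z.
Proof. by rewrite /qform dot3_lin !mxE; ring. Qed.

Lemma qformC x y : qform x y = qform y x.
Proof. by rewrite /qform dot3C mulrC. Qed.

Lemma metric_lin a b x y z :
  metric c (a *: x + b *: y) z = a * metric c x z + b * metric c y z.
Proof. by rewrite /metric dot3_lin !mxE; ring. Qed.

Lemma metricC x y : metric c x y = metric c y x.
Proof. by rewrite /metric dot3C (mulrC (x 0 0)). Qed.

Lemma metricZl a x y : metric c (a *: x) y = a * metric c x y.
Proof. by rewrite -[a *: x]addr0 -(scale0r x) metric_lin mul0r addr0. Qed.

Lemma metricZr a x y : metric c x (a *: y) = a * metric c x y.
Proof. by rewrite metricC metricZl metricC. Qed.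

Lemma metricDl x y z : metric c (x + y) z = metric c x z + metric c y z.
Proof. by rewrite -{1}[x]scale1r -{1}[y]scale1r metric_lin !mul1r. Qed.

Lemma metricDr x y z : metric c z (x + y) = metric c z x + metric c z y.
Proof. by rewrite metricC metricDl !(metricC z). Qed.

Lemma metricNl x y : metric c (- x) y = - metric c x y.
Proof. by rewrite -scaleN1r metricZl mulN1r. Qed.

Lemma metricBl x y z : metric c (x - y) z = metric c x z - metric c y z.
Proof. by rewrite metricDl metricNl. Qed.

Lemma metricBr x y z : metric c z (x - y) = metric c z x - metric c z y.
Proof. by rewrite !(metricC z) metricBl. Qed.

Lemma metric0l x : metric c 0 x = 0.
Proof. by rewrite -(scale0r 0) metricZl mul0r. Qed.

Lemma metric_suml n (F : 'I_n -> 'rV[R]_4) x :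
  metric c (\sum_i F i) x = \sum_i metric c (F i) x.
Proof.
by elim/big_rec2: _ => [|i a b _ <-]; rewrite ?metric0l// metricDl.
Qed.

Lemma qformZl a x y : qform (a *: x) y = a * qform x y.
Proof. by rewrite -[a *: x]addr0 -(scale0r x) qform_lin mul0r addr0. Qed.

Lemma qformDl x y z : qform (x + y) z = qform x z + qform y z.
Proof. by rewrite -{1}[x]scale1r -{1}[y]scale1r qform_lin !mul1r. Qed.

Lemma qformBl x y z : qform (x - y) z = qform x z - qform y z.
Proof. by rewrite -{1}[x]scale1r -scaleN1r qform_lin mul1r mulN1r. Qed.

Lemma qform0l x : qform 0 x = 0.
Proof. by rewrite -(scale0r 0) qformZl mul0r. Qed.

Lemma qform_suml n (F : 'I_n -> 'rV[R]_4) x :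
  qform (\sum_i F i) x = \sum_i qform (F i) x.
Proof.
by elim/big_rec2: _ => [|i a b _ <-]; rewrite ?qform0l// qformDl.
Qed.

Lemma metric_qform x y : c != 0 -> metric c x y = c^-1 * qform x y.
Proof. by move=> c0; rewrite /metric /qform mulrDr mulKf. Qed.

Lemma tangentE o w : tangent_space c o w = (qform o w = 0) :> Prop.
Proof. by []. Qed.

Lemma space_formE x : space_form c x -> qform x x = 1.
Proof. by case; rewrite /qform expr2. Qed.

Lemma space_form_flat x : c = 0 -> space_form c x -> x 0 0 = 1.
Proof.
move=> c0 [+ +]; rewrite c0 mul0r addr0 => /eqP; rewrite sqrf_eq1 => /orP[/eqP//|/eqP ->].
by move=> /(_ (lexx _)); rewrite ltr0N1.
Qed.

Lemma dot3_ge0 x : 0 <= dot3 x x.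
Proof. by apply: sumr_ge0 => i _; rewrite -expr2 sqr_ge0. Qed.

Lemma dot3_eq0 x : dot3 x x = 0 -> x 0 0 = 0 -> x = 0.
Proof.
move=> /eqP; rewrite psumr_eq0 => [/allP x0 x00|i _]; last by rewrite -expr2 sqr_ge0.
apply/rowP => i; rewrite mxE; case: (unliftP ord0 i) => [j ->|-> //].
by have := x0 j; rewrite mem_index_enum => /(_ isT); rewrite -expr2 sqrf_eq0 => /eqP.
Qed.

Lemma dot3_CS x y : dot3 x y ^+ 2 <= dot3 x x * dot3 y y.
Proof.
rewrite !dot3E.
set x1 := x 0 (lift ord0 ord0); set x2 := x 0 (lift ord0 (lift ord0 ord0)).
set x3 := x 0 _; set y1 := y 0 (lift ord0 ord0).
set y2 := y 0 (lift ord0 (lift ord0 ord0)); set y3 := y 0 _.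
rewrite -subr_ge0.
have -> : (x1 * x1 + (x2 * x2 + x3 * x3)) * (y1 * y1 + (y2 * y2 + y3 * y3)) -
  (x1 * y1 + (x2 * y2 + x3 * y3)) ^+ 2 =
  (x1 * y2 - x2 * y1) ^+ 2 + (x1 * y3 - x3 * y1) ^+ 2 + (x2 * y3 - x3 * y2) ^+ 2 by ring.
by rewrite !addr_ge0 ?sqr_ge0.
Qed.

(** For [c < 0] this says that the tangent spaces of the hyperboloid are spacelike;
    it follows from the Cauchy-Schwarz inequality. *)
Lemma metric_tangent_gt0 x w : space_form c x -> tangent_space c x w ->
  w != 0 -> 0 < metric c w w.
Proof.
move=> Mx; rewrite tangentE /qform => xw w0; rewrite /metric.
have [c0|cn|cp] := ltrgt0P c; last first.
- have x1 := space_form_flat cp Mx.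
  rewrite cp invr0 mul0r add0r lt_def dot3_ge0 andbT.
  apply: contra_neq w0 => /dot3_eq0; apply.
  by move: xw; rewrite cp x1 mul1r mul0r addr0.
- have [+ _] := Mx; set X := dot3 x x => HX.
  have CS := dot3_CS x w; rewrite -/X in CS.
  have X0 : 0 <= X by exact: dot3_ge0.
  have W0 := dot3_ge0 w.
  have x00 : 0 < x 0 0 ^+ 2.
    have -> : x 0 0 ^+ 2 = 1 + (- c) * X by rewrite -HX; ring.
    by rewrite ltr_pwDl// mulr_ge0// oppr_ge0 ltW.
  have Wp : 0 < dot3 w w.
    rewrite lt_def W0 andbT; apply: contra_neq w0 => W00.
    apply: dot3_eq0 => //.
    have : dot3 x w = 0.
      apply/eqP; rewrite -sqrf_eq0; apply/eqP/le_anti.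
      by rewrite sqr_ge0 andbT (le_trans CS)// W00 mulr0.
    move=> xw0; move: xw; rewrite xw0 mulr0 addr0 => /eqP.
    rewrite mulf_eq0 => /orP[/eqP x00'|/eqP//].
    by move: x00; rewrite x00' expr0n ltxx.
  suff : 0 < x 0 0 ^+ 2 * (c^-1 * (w 0 0 * w 0 0) + dot3 w w).
    by rewrite pmulr_rgt0.
  have E : x 0 0 * w 0 0 = - (c * dot3 x w).
    by apply/eqP; rewrite -addr_eq0 xw.
  have -> : x 0 0 ^+ 2 * (c^-1 * (w 0 0 * w 0 0) + dot3 w w) =
     c^-1 * (x 0 0 * w 0 0) ^+ 2 + x 0 0 ^+ 2 * dot3 w w by ring.
  rewrite E.
  have -> : c^-1 * (- (c * dot3 x w)) ^+ 2 + x 0 0 ^+ 2 * dot3 w w =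
     dot3 w w + (- c) * (X * dot3 w w - dot3 x w ^+ 2).
    have -> : x 0 0 ^+ 2 = 1 - c * X by rewrite -HX; ring.
    by field; rewrite lt_eqF.
  by rewrite ltr_pwDl// mulr_ge0// ?subr_ge0// oppr_ge0 ltW.
- have h1 : 0 <= c^-1 * (w 0 0 * w 0 0).
    by apply: mulr_ge0; [rewrite invr_ge0 ltW|rewrite -expr2 sqr_ge0].
  rewrite lt_def addr_ge0 ?dot3_ge0// andbT.
  apply: contra_neq w0 => /eqP; rewrite paddr_eq0 ?dot3_ge0//.
  rewrite mulf_eq0 invr_eq0 gt_eqF//= -expr2 sqrf_eq0 => /andP[/eqP w00 /eqP].
  by move=> /dot3_eq0; exact.
Qed.

Lemma metric_tangent_ge0 x w : space_form c x -> tangent_space c x w ->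
  0 <= metric c w w.
Proof.
move=> Mx xw; have [->|w0] := eqVneq w 0; first by rewrite metric0l.
exact/ltW/(metric_tangent_gt0 Mx xw).
Qed.

Lemma mnorm_sqr x w : space_form c x -> tangent_space c x w ->
  mnorm c w ^+ 2 = metric c w w.
Proof. by move=> Mx xw; rewrite sqr_sqrtr// (metric_tangent_ge0 Mx). Qed.

Lemma cs0 : cs c 0 = 1.
Proof.
rewrite /cs; case: ifP => _; first by rewrite mulr0 cos0.
by case: ifP => _ //; rewrite mulr0 oppr0 expR0; field.
Qed.

Lemma sn0 : sn c 0 = 0.
Proof.
rewrite /sn; case: ifP => _; first by rewrite mulr0 sin0 mul0r.
by case: ifP => _ //; rewrite mulr0 oppr0 expR0 subrr !mul0r.
Qed.

Lemma cs_flat r : c = 0 -> cs c r = 1.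
Proof. by move=> ->; rewrite /cs ltxx. Qed.

Lemma sn_flat r : c = 0 -> sn c r = r.
Proof. by move=> ->; rewrite /sn ltxx. Qed.

Lemma cs_continuous : continuous (cs c).
Proof.
move=> r; rewrite /cs; case: (ltrgt0P c) => _.
- apply: (@continuous_comp _ _ _ (fun r => Num.sqrt c * r) cos).
    by apply: cvgM; [exact: cvg_cst|exact: cvg_id].
  exact: continuous_cos.
- have k1 : {for r, continuous (fun r : R => Num.sqrt (- c) * r)}.
    by apply: cvgM; [exact: cvg_cst|exact: cvg_id].
  apply: cvgM; last exact: cvg_cst.
  apply: cvgD.
    by apply: (@continuous_comp _ _ _ (fun r => Num.sqrt (- c) * r) expR) => //; exact: continuous_expR.
  apply: (@continuous_comp _ _ _ (fun r => - (Num.sqrt (- c) * r)) expR).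
    exact: cvgN.
  exact: continuous_expR.
- exact: cvg_cst.
Qed.

Lemma sn_continuous : continuous (sn c).
Proof.
move=> r; rewrite /sn; case: (ltrgt0P c) => _.
- apply: cvgM; last exact: cvg_cst.
  apply: (@continuous_comp _ _ _ (fun r => Num.sqrt c * r) sin).
    by apply: cvgM; [exact: cvg_cst|exact: cvg_id].
  exact: continuous_sin.
- have k1 : {for r, continuous (fun r : R => Num.sqrt (- c) * r)}.
    by apply: cvgM; [exact: cvg_cst|exact: cvg_id].
  apply: cvgM; last exact: cvg_cst.
  apply: cvgM; last exact: cvg_cst.
  apply: cvgB.
    by apply: (@continuous_comp _ _ _ (fun r => Num.sqrt (- c) * r) expR) => //; exact: continuous_expR.
  apply: (@continuous_comp _ _ _ (fun r => - (Num.sqrt (- c) * r)) expR).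
    exact: cvgN.
  exact: continuous_expR.
- exact: cvg_id.
Qed.

End SpaceForm.

(** * Geodesics and isometries *)

Section Isometries.
Context {R : realType}.
Variable c : R.
Implicit Types x y z w o : 'rV[R]_4.

(** The squared length, for [metric c] on R^4, of the chord of a geodesic segment
    of length [r]. *)
Definition chord (r : R) : R := (cs c r - 1) ^+ 2 * c^-1 + sn c r ^+ 2.

Lemma chord_continuous : continuous chord.
Proof.
move=> r; apply: cvgD.
  apply: cvgM; last exact: cvg_cst.
  apply: cvgM; (apply: cvgB; last exact: cvg_cst); exact: cs_continuous.
by apply: cvgM; exact: sn_continuous.
Qed.

(** The metric of R^4 is proportional to [qform c] unless [c = 0], and then the
    first factor vanishes; so the three signs of [c] are treated at once. *)
Lemma cs1_metric x v (r : R) :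
  (cs c r - 1) * metric c x v = (cs c r - 1) * (c^-1 * qform c x v).
Proof.
have [c0|c0] := eqVneq c 0; last by rewrite metric_qform.
by rewrite (cs_flat _ c0) subrr !mul0r.
Qed.

Lemma exp_map_chord x w : space_form c x -> tangent_space c x w ->
  metric c (exp_map c x w - x) (exp_map c x w - x) = chord (mnorm c w).
Proof.
move=> Mx xw; have ws := mnorm_sqr Mx xw; set r := mnorm c w in ws *.
have -> : exp_map c x w - x = (cs c r - 1) *: x + (sn c r / r) *: w.
  by rewrite /exp_map -/r scalerBl scale1r addrAC.
rewrite metric_lin !(metricC _ x) !(metricC _ w) 2!metric_lin (metricC c w x).
have X1 := cs1_metric x x r; rewrite (space_formE Mx) mulr1 in X1.
have X2 := cs1_metric x w r; rewrite (xw : qform c x w = 0) !mulr0 in X2.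
have E : (sn c r / r) ^+ 2 * r ^+ 2 = sn c r ^+ 2.
  have [->|r0] := eqVneq r 0; first by rewrite sn0 invr0 mulr0 expr0n mulr0.
  by rewrite -exprMn divfK.
move: X1 X2 E; rewrite /chord -ws.
set C := cs c r - 1; set m := metric c x x; set n := metric c x w.
set S := sn c r / r => X1 X2 <-.
have -> : C * (C * m + S * n) + S * (C * n + S * r ^+ 2) =
  C * (C * m) + 2 * S * (C * n) + S ^+ 2 * r ^+ 2 by ring.
by rewrite X1 X2; ring.
Qed.

(** Two points on the same sheet of a hyperboloid: the reversed Cauchy-Schwarz
    inequality. *)
Lemma space_form_qform_gt0 x y : c < 0 -> space_form c x -> space_form c y ->
  0 < qform c x y.
Proof.
move=> cn [+ /(_ (ltW cn)) x0] [+ /(_ (ltW cn)) y0].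
rewrite /qform; set X := dot3 x x; set Y := dot3 y y; set D := dot3 x y => HX HY.
have CS : D ^+ 2 <= X * Y := dot3_CS x y.
have X0 : 0 <= X by exact: dot3_ge0.
have Y0 : 0 <= Y by exact: dot3_ge0.
suff : - c * D < x 0 0 * y 0 0 by rewrite mulNr -subr_gt0 opprK.
have P : 0 < x 0 0 * y 0 0 by rewrite mulr_gt0.
have [D0|D0] := ltP D 0.
  by rewrite (lt_trans _ P)// mulNr oppr_lt0 nmulr_rgt0.
rewrite -ltr_sqr ?nnegrE ?(ltW P) ?mulr_ge0 ?oppr_ge0 ?(ltW cn)//.
rewrite !exprMn.
have -> : x 0 0 ^+ 2 = 1 + - c * X by rewrite -HX; ring.
have -> : y 0 0 ^+ 2 = 1 + - c * Y by rewrite -HY; ring.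
have k0 : 0 <= - c by rewrite oppr_ge0 ltW.
apply: (@le_lt_trans _ _ ((- c) ^+ 2 * (X * Y))); first by rewrite ler_wpM2l ?sqr_ge0.
rewrite -subr_gt0.
have -> : (1 + - c * X) * (1 + - c * Y) - (- c) ^+ 2 * (X * Y) = 1 + (- c * X + - c * Y) by ring.
by rewrite ltr_pwDl// addr_ge0// mulr_ge0.
Qed.

(** [cs] and [sn] parametrize an arc of the conic, by the arc cosine or by a
    logarithm. *)
Lemma conic_param (al s : R) : 0 <= s -> al ^+ 2 + c * s ^+ 2 = 1 ->
  (c <= 0 -> 0 < al) ->
  c != 0 -> exists2 r, 0 <= r & cs c r = al /\ sn c r = s.
Proof.
move=> s0 E alp; rewrite neq_lt => /orP[cn|cp].
- have k0 : 0 < Num.sqrt (- c) by rewrite sqrtr_gt0 oppr_gt0.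
  set k := Num.sqrt (- c) in k0.
  have k2 : k ^+ 2 = - c by rewrite sqr_sqrtr// oppr_ge0 ltW.
  have al0 := alp (ltW cn).
  have ks0 : 0 <= k * s by rewrite mulr_ge0// ltW.
  have A0 : 0 < al + k * s by rewrite ltr_pwDl.
  have AI : (al + k * s)^-1 = al - k * s.
    apply: (mulfI (lt0r_neq0 A0)); rewrite mulfV ?gt_eqF//.
    by rewrite mulrC -subr_sqr exprMn k2 -E; ring.
  have A1 : 1 <= al + k * s.
    have al1 : 1 <= al.
      rewrite -(@ler_sqr _ 1 al) ?nnegrE ?(ltW al0)// expr1n.
      have -> : al ^+ 2 = 1 + - c * s ^+ 2 by rewrite -E; ring.
      by rewrite lerDl mulr_ge0 ?sqr_ge0// oppr_ge0 ltW.
    by rewrite (le_trans al1)// lerDl.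
  exists (ln (al + k * s) / k); first by rewrite divr_ge0 ?ln_ge0// ltW.
  rewrite /cs /sn (lt_gtF cn) cn -/k.
  have -> : k * (ln (al + k * s) / k) = ln (al + k * s) by field; rewrite gt_eqF.
  rewrite expRN lnK// AI; split; first by field.
  by field; rewrite gt_eqF.
- have k0 : 0 < Num.sqrt c by rewrite sqrtr_gt0.
  set k := Num.sqrt c in k0.
  have k2 : k ^+ 2 = c by rewrite sqr_sqrtr// ltW.
  have al1 : -1 <= al <= 1.
    have al2 : al ^+ 2 <= 1.
      have -> : al ^+ 2 = 1 - c * s ^+ 2 by rewrite -E addrK.
      by rewrite gerBl mulr_ge0 ?sqr_ge0// ltW.
    by rewrite -ler_norml -(@ler_sqr _ `|al| 1) ?nnegrE// expr1n real_normK ?num_real.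
  exists (acos al / k); first by rewrite divr_ge0 ?acos_ge0// ltW.
  rewrite /cs /sn cp -/k.
  have -> : k * (acos al / k) = acos al by field; rewrite gt_eqF.
  rewrite acosK// sin_acos//; split=> //.
  have -> : 1 - al ^+ 2 = (k * s) ^+ 2 by rewrite exprMn k2 -E; ring.
  rewrite sqrtr_sqr ger0_norm ?mulr_ge0// ?(ltW k0)//.
  by field; rewrite gt_eqF.
Qed.

Lemma normalize_tangent o w : space_form c o -> tangent_space c o w -> w != 0 ->
  exists2 r : R, r != 0 & tangent_space c o (r *: w) /\ metric c (r *: w) (r *: w) = 1.
Proof.
move=> Mo ow w0; have w1 := metric_tangent_gt0 Mo ow w0.
exists (Num.sqrt (metric c w w))^-1; first by rewrite invr_eq0 gt_eqF// sqrtr_gt0.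
split; first by rewrite tangentE qformC qformZl qformC (ow : qform c o w = 0) mulr0.
rewrite metricZl metricZr mulrA -invrM ?unitfE ?gt_eqF ?sqrtr_gt0//.
by rewrite -expr2 sqr_sqrtr ?ltW// mulVf ?gt_eqF.
Qed.

(** Antipodal points of the sphere are joined by a geodesic in any direction, so a
    direction is needed. *)
Lemma unit_tangent_exists x : 0 < c -> space_form c x ->
  exists2 w, tangent_space c x w & metric c w w = 1.
Proof.
move=> cp Mx.
suff [w xw w0] : exists2 w, tangent_space c x w & w != 0.
  by have [r _ [xr r1]] := normalize_tangent Mx xw w0; exists (r *: w).
pose i1 : 'I_4 := lift ord0 ord0.
have [x00|x00] := eqVneq (x 0 0) 0; have [x01|x01] := eqVneq (x 0 i1) 0.
- exists (delta_mx 0 0); last first.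
    by apply/eqP => /rowP /(_ 0)/eqP; rewrite !mxE/= oner_eq0.
  by rewrite tangentE /qform dot3E !mxE/= x00; ring.
- exists (delta_mx 0 0); last first.
    by apply/eqP => /rowP /(_ 0)/eqP; rewrite !mxE/= oner_eq0.
  by rewrite tangentE /qform dot3E !mxE/= x00; ring.
- exists (delta_mx 0 i1); last first.
    by apply/eqP => /rowP /(_ i1)/eqP; rewrite !mxE/= oner_eq0.
  by rewrite tangentE /qform dot3E !mxE/= (x01 : x 0 (lift ord0 ord0) = 0); ring.
- exists ((- (c * x 0 i1)) *: delta_mx 0 0 + x 0 0 *: delta_mx 0 i1); last first.
    apply/eqP => /rowP /(_ i1)/eqP; rewrite !mxE/= mulr0 add0r mulr1.
    by rewrite (negbTE x00).
  rewrite tangentE /qform dot3E !mxE/= /i1; ring.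
Qed.

Lemma mnorm_scale (a : R) w : 0 <= a -> mnorm c (a *: w) = a * mnorm c w.
Proof.
move=> a0; rewrite /mnorm metricZl metricZr mulrA -expr2 sqrtrM ?sqr_ge0//.
by rewrite sqrtr_sqr ger0_norm.
Qed.

Lemma exp_map0 x : exp_map c x 0 = x.
Proof.
by rewrite /exp_map scaler0 addr0 /mnorm metric0l sqrtr0 cs0 scale1r.
Qed.

(** Any two points of the space form are joined by a geodesic; this keeps the
    infimum in [geodesic_dist] from being the default value of an empty set. *)
Lemma exp_map_surj x y : space_form c x -> space_form c y ->
  exists2 w, tangent_space c x w & exp_map c x w = y.
Proof.
move=> Mx My; have [c0|c0] := eqVneq c 0.
  have xy : tangent_space c x (y - x).
    rewrite tangentE /qform !mxE (space_form_flat c0 Mx) (space_form_flat c0 My).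
    by rewrite c0 subrr mulr0 mul0r addr0.
  exists (y - x) => //; have [->|yx] := eqVneq y x; first by rewrite subrr exp_map0.
  have r0 : mnorm c (y - x) != 0.
    rewrite gt_eqF// sqrtr_gt0; apply: (metric_tangent_gt0 Mx xy).
    by rewrite subr_eq0.
  rewrite /exp_map (cs_flat _ c0) (sn_flat _ c0) scale1r divff// scale1r.
  by rewrite addrC subrK.
pose al := qform c y x; pose v := y - al *: x.
have xv : tangent_space c x v.
  rewrite tangentE qformC /v qformBl qformZl (space_formE Mx) mulr1.
  by rewrite -/al subrr.
have yE : y = al *: x + v by rewrite addrC subrK.
pose s := mnorm c v; have s0 : 0 <= s by exact: sqrtr_ge0.
have E : al ^+ 2 + c * s ^+ 2 = 1.
  rewrite /s (mnorm_sqr Mx xv) metric_qform// mulVKf//.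
  rewrite {1}/v qformBl qformZl (xv : qform c x v = 0) mulr0 subr0 qformC /v qformBl.
  by rewrite (space_formE My) qformZl (qformC c x) -/al expr2 addrC subrK.
have alp : c <= 0 -> 0 < al.
  by rewrite le_eqVlt (negbTE c0)/= => cn; exact: space_form_qform_gt0.
have [r r0 [csr snr]] := conic_param s0 E alp c0.
have [sz|sn0] := eqVneq s 0; last first.
  have rn0 : r != 0 by apply: contra_neq sn0 => rz; rewrite -snr rz sn0.
  have nw : mnorm c ((r / s) *: v) = r.
    by rewrite mnorm_scale ?divr_ge0// -/s divfK.
  exists ((r / s) *: v); first by rewrite tangentE qformC qformZl qformC (xv : qform c x v = 0) mulr0.
  rewrite /exp_map nw csr snr scalerA [RHS]yE; congr (_ + _).
  by rewrite (_ : s / r * (r / s) = 1) ?scale1r//; field; rewrite rn0 sn0.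
have v0 : v = 0.
  apply/eqP; apply: contraTT isT => v0.
  have := metric_tangent_gt0 Mx xv v0.
  by rewrite -(mnorm_sqr Mx xv) -/s sz expr0n ltxx.
have [cp|cn] := ltP 0 c; last first.
  have al1 : al = 1.
    move: E; rewrite sz expr0n mulr0 addr0 => /eqP; rewrite sqrf_eq1 => /orP[/eqP//|/eqP alN].
    by have := alp cn; rewrite alN ltr0N1.
  exists 0; first by rewrite tangentE qformC qform0l.
  by rewrite exp_map0 yE v0 al1 scale1r addr0.
have [u xu u1] := unit_tangent_exists cp Mx.
have nu : mnorm c (r *: u) = r by rewrite mnorm_scale// /mnorm u1 sqrtr1 mulr1.
exists (r *: u); first by rewrite tangentE qformC qformZl qformC (xu : qform c x u = 0) mulr0.
by rewrite /exp_map nu csr snr sz mul0r scale0r [RHS]yE v0.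
Qed.

(** All geodesics from [x] to [y] have the same chord, and the infimum of their
    lengths is a limit of such lengths. *)
Lemma geodesic_dist_chord x y : space_form c x -> space_form c y ->
  chord (geodesic_dist c x y) = metric c (y - x) (y - x).
Proof.
move=> Mx My; rewrite /geodesic_dist.
set A := [set w | _]; set D := [set mnorm c w | w in A].
have DA r : D r -> 0 <= r /\ chord r = metric c (y - x) (y - x).
  move=> [w [xw <-] <-]; split; first exact: sqrtr_ge0.
  by rewrite exp_map_chord.
have hD : has_inf D.
  split; last by exists 0 => r /DA[].
  by have [w xw wy] := exp_map_surj Mx My; exists (mnorm c w), w.
apply/eqP; apply: contraT => ne.
have : \forall r \near inf D, chord r != metric c (y - x) (y - x).
  apply: (@chord_continuous (inf D) [set t | t != metric c (y - x) (y - x)]).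
  by apply: open_nbhs_nbhs; split=> //; exact: open_neq.
move=> /nbhs_ballP[d /= d0 dD].
have [r Dr rd] := inf_adherent d0 hD.
have := dD r; rewrite (DA _ Dr).2 eqxx => H.
suff : false by []; apply: H.
rewrite -ball_normE /ball_/= distrC ger0_norm ?subr_ge0 ?ltrBlDl//.
exact: (ge_inf hD.2).
Qed.

Lemma isometry_metric T x y : riemannian_isometry c T ->
  space_form c x -> space_form c y ->
  metric c (T y - T x) (T y - T x) = metric c (y - x) (y - x).
Proof.
move=> [[Tf _ _] Td] Mx My.
by rewrite -geodesic_dist_chord ?Td ?geodesic_dist_chord//; exact: Tf.
Qed.

End Isometries.

(** * Orthonormal frames *)

Section Frames.
Context {R : realType}.
Variables (c : R) (o : 'rV[R]_4).
Implicit Types (x y z w : 'rV[R]_4) (e : 'I_3 -> 'rV[R]_4) (d : 'I_3 -> R).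

Definition orthoframe e := (forall i, qform c o (e i) = 0) /\
  (forall i j, metric c (e i) (e j) = (i == j)%:R).

(** The component along [o] is removed first: for [c = 0] the metric of R^4 does
    not make [o] orthogonal to the tangent vectors. *)
Definition frame_coord e i z : R := metric c (z - qform c o z *: o) (e i).

(** The linear map that fixes [o] and multiplies the vectors of the frame by [d].
    For [c = 0] it restricts to an affine map of the hyperplane [x_0 = 1]. *)
Definition frame_reflection e d z : 'rV[R]_4 :=
  qform c o z *: o + \sum_i (d i * frame_coord e i z) *: e i.

Hypothesis Mo : space_form c o.

Section Frame.
Variable e : 'I_3 -> 'rV[R]_4.
Hypothesis oe : orthoframe e.

Lemma qform_frame (b : R) (g : 'I_3 -> R) :
  qform c o (b *: o + \sum_i g i *: e i) = b.
Proof.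
rewrite qformC qformDl qformZl (space_formE Mo) mulr1 qform_suml big1 ?addr0// => i _.
by rewrite qformZl qformC oe.1 mulr0.
Qed.

Lemma frame_coord_comb (b : R) (g : 'I_3 -> R) i :
  frame_coord e i (b *: o + \sum_j g j *: e j) = g i.
Proof.
rewrite /frame_coord qform_frame addrAC subrr add0r metric_suml (bigD1 i)//=.
rewrite metricZl oe.2 eqxx mulr1 big1 ?addr0// => j ji.
by rewrite metricZl oe.2 (negbTE ji) mulr0.
Qed.

Lemma frame_span z : exists (b : R) (g : 'I_3 -> R), z = b *: o + \sum_i g i *: e i.
Proof.
pose A : 'M[R]_(1 + 3, 4) := col_mx o (\matrix_i e i).
have uA (b : 'rV[R]_1) (g : 'rV[R]_3) :
    row_mx b g *m A = b 0 0 *: o + \sum_i g 0 i *: e i.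
  rewrite mul_row_col; congr (_ + _).
    by rewrite {1}[b]mx11_scalar mul_scalar_mx.
  by rewrite mulmx_sum_row; apply: eq_bigr => i _; rewrite rowK.
have fA : row_free A.
  have A0 (b : 'rV[R]_1) (g : 'rV[R]_3) : row_mx b g *m A = 0 -> b = 0 /\ g = 0.
    rewrite uA => v0; have b0 := qform_frame (b 0 0) (g 0).
    have g0 i := frame_coord_comb (b 0 0) (g 0) i.
    rewrite v0 qformC qform0l in b0; split.
      by apply/rowP => i; rewrite ord1 -b0 mxE.
    apply/rowP => i; rewrite -g0 v0 /frame_coord qformC qform0l scale0r subrr.
    by rewrite metric0l mxE.
  have A00 (v : 'rV[R]_(1 + 3)) : v *m A = 0 -> v = 0.
    by rewrite -[v]hsubmxK => /A0[-> ->]; rewrite row_mx0.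
  exact: inj_row_free A00.
have uAi : A \in unitmx by rewrite -row_free_unit.
pose v : 'rV[R]_(1 + 3) := z *m invmx A.
exists (lsubmx v 0 0), (rsubmx v 0).
by rewrite -uA hsubmxK /v mulmxKV.
Qed.

Lemma frame_decomp z :
  z = qform c o z *: o + \sum_i frame_coord e i z *: e i.
Proof.
have [b [g zE]] := frame_span z.
rewrite [in qform _ _ _]zE qform_frame {1}zE; congr (_ + _).
by apply: eq_bigr => i _; rewrite zE frame_coord_comb.
Qed.

Lemma frame_eq x y : qform c o x = qform c o y ->
  (forall i, frame_coord e i x = frame_coord e i y) -> x = y.
Proof.
move=> q l; rewrite (frame_decomp x) (frame_decomp y) q; congr (_ + _).
by apply: eq_bigr => i _; rewrite l.
Qed.

Lemma qform_reflection d z : qform c o (frame_reflection e d z) = qform c o z.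
Proof. exact: qform_frame. Qed.

Lemma frame_coord_reflection d i z :
  frame_coord e i (frame_reflection e d z) = d i * frame_coord e i z.
Proof. by rewrite /frame_reflection (frame_coord_comb _ (fun i => d i * frame_coord e i z)). Qed.

Lemma frame_reflectionK d : (forall i, d i * d i = 1) ->
  involutive (frame_reflection e d).
Proof.
move=> d1 z; apply: frame_eq; first by rewrite !qform_reflection.
by move=> i; rewrite !frame_coord_reflection mulrA d1 mul1r.
Qed.

Lemma metric_frame (g h : 'I_3 -> R) :
  metric c (\sum_i g i *: e i) (\sum_i h i *: e i) = \sum_i g i * h i.
Proof.
rewrite metric_suml; apply: eq_bigr => i _; rewrite metricZl metricC metric_suml.
congr (_ * _); rewrite (bigD1 i)//= metricZl oe.2 eqxx mulr1 big1 ?addr0// => j ji.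
by rewrite metricZl oe.2 (negbTE ji) mulr0.
Qed.

Lemma mnorm_frame (g : 'I_3 -> R) :
  mnorm c (\sum_i g i *: e i) = Num.sqrt (\sum_i g i ^+ 2).
Proof. by rewrite /mnorm metric_frame; under eq_bigr do rewrite -expr2. Qed.

Lemma exp_map_frame (g : 'I_3 -> R) (r := mnorm c (\sum_i g i *: e i)) :
  exp_map c o (\sum_i g i *: e i) = cs c r *: o + \sum_i (sn c r / r * g i) *: e i.
Proof.
rewrite /exp_map scaler_sumr; congr (_ + _).
by apply: eq_bigr => i _; rewrite scalerA.
Qed.

Lemma frame_coord_exp (g : 'I_3 -> R) i (r := mnorm c (\sum_i g i *: e i)) :
  frame_coord e i (exp_map c o (\sum_i g i *: e i)) = sn c r / r * g i.
Proof. by rewrite exp_map_frame (frame_coord_comb _ (fun i => sn c r / r * g i)). Qed.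

Lemma qform_exp (g : 'I_3 -> R) :
  qform c o (exp_map c o (\sum_i g i *: e i)) = cs c (mnorm c (\sum_i g i *: e i)).
Proof. by rewrite exp_map_frame (qform_frame _ (fun i => _ * g i)). Qed.

Lemma reflection_exp d (g : 'I_3 -> R) : (forall i, d i * d i = 1) ->
  frame_reflection e d (exp_map c o (\sum_i g i *: e i)) =
  exp_map c o (\sum_i (d i * g i) *: e i).
Proof.
move=> d1.
have E : mnorm c (\sum_i (d i * g i) *: e i) = mnorm c (\sum_i g i *: e i).
  rewrite !mnorm_frame; congr Num.sqrt; apply: eq_bigr => i _.
  by rewrite exprMn expr2 d1 mul1r.
apply: frame_eq; first by rewrite qform_reflection !qform_exp E.
by move=> i; rewrite frame_coord_reflection !frame_coord_exp E mulrCA.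
Qed.

Lemma cs1_o v (r : R) : tangent_space c o v -> (cs c r - 1) * metric c o v = 0.
Proof. by move=> ov; rewrite cs1_metric (ov : qform c o v = 0) !mulr0. Qed.

Lemma qform_chord x : c != 0 -> space_form c x ->
  qform c o x = 1 - c / 2 * metric c (x - o) (x - o).
Proof.
move=> c0 Mx; rewrite metric_qform// qformBl !(qformC c _ (x - o)) !qformBl.
by rewrite (space_formE Mo) (space_formE Mx) (qformC c x o); field.
Qed.

Lemma frame_coordE i x : space_form c x -> frame_coord e i x = metric c (x - o) (e i).
Proof.
move=> Mx; rewrite /frame_coord !metricBl metricZl; congr (_ - _).
have [c0|c0] := eqVneq c 0; last by rewrite metric_qform// oe.1 !mulr0.
rewrite /qform c0 mul0r addr0 (space_form_flat c0 Mo) (space_form_flat c0 Mx).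
by rewrite !mul1r.
Qed.

Lemma sn_neq0 : exists2 t : R, 0 < t & sn c t != 0.
Proof.
have [c0|cn|cp] := ltrgt0P c; last first.
- by exists 1 => //; rewrite sn_flat ?oner_eq0.
- exists (Num.sqrt (- c))^-1; first by rewrite invr_gt0 sqrtr_gt0 oppr_gt0.
  have k0 : Num.sqrt (- c) != 0 by rewrite gt_eqF// sqrtr_gt0 oppr_gt0.
  rewrite /sn (lt_gtF cn) cn divff//.
  have e0 : expR 1 - expR (- 1) != 0 :> R.
    by rewrite subr_eq0 gt_eqF// ltr_expR (lt_trans (ltrN10 _))// ltr01.
  by rewrite !mulf_neq0 ?invr_eq0// pnatr_eq0.
- exists (Num.sqrt c)^-1; first by rewrite invr_gt0 sqrtr_gt0.
  have k0 : Num.sqrt c != 0 by rewrite gt_eqF// sqrtr_gt0.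
  rewrite /sn c0 divff// mulf_neq0 ?invr_eq0// gt_eqF// sin_gt0_pi// ltr01/=.
  by rewrite (lt_le_trans _ (pi_ge2 R))// ltr1n.
Qed.

Lemma cs_sn_conic (r : R) : cs c r ^+ 2 + c * sn c r ^+ 2 = 1.
Proof.
rewrite /cs /sn; have [c0|cn|cp] := ltrgt0P c; last first.
- by rewrite cp; ring.
- have k0 : Num.sqrt (- c) != 0 by rewrite gt_eqF// sqrtr_gt0 oppr_gt0.
  have k2 : c = - Num.sqrt (- c) ^+ 2 by rewrite sqr_sqrtr ?opprK// oppr_ge0 ltW.
  rewrite [X in _ + X * _]k2 expRN; set E := expR _.
  by have E0 : E != 0 by [rewrite gt_eqF// expR_gt0]; field; rewrite E0 k0.
- have k0 : Num.sqrt c != 0 by rewrite gt_eqF// sqrtr_gt0.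
  have k2 : c = Num.sqrt c ^+ 2 by rewrite sqr_sqrtr// ltW.
  rewrite [X in _ + X * _]k2 -[RHS](cos2Dsin2 (Num.sqrt c * r)).
  by field.
Qed.

Lemma cs_gt0 (r : R) : c <= 0 -> 0 < cs c r.
Proof.
move=> c0; rewrite /cs (le_gtF c0); case: ifP => // _.
by rewrite divr_gt0// addr_gt0// expR_gt0.
Qed.

(** If [exp_map c o w] were on the other sheet of the hyperboloid, then its
    antipode would be on the sheet of [o] and have a positive product with it. *)
Lemma exp_map_space_form w : tangent_space c o w -> space_form c (exp_map c o w).
Proof.
move=> ow; set x := exp_map c o w.
have rs := mnorm_sqr Mo ow; set r := mnorm c w in rs.
have xo : qform c o x = cs c r.
  rewrite qformC /x /exp_map qformDl !qformZl (space_formE Mo) mulr1.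
  by rewrite (qformC c w) (ow : qform c o w = 0) mulr0 addr0.
have xx : qform c x x = 1.
  have E : x = cs c r *: o + (sn c r / r) *: w by [].
  rewrite [in X in qform _ X _]E qformDl !qformZl xo qformC E qformDl !qformZl.
  rewrite (ow : qform c o w = 0) mulr0 add0r -(cs_sn_conic r) expr2; congr (_ + _).
  have [c0|c0] := eqVneq c 0.
    have w0 : w 0 0 = 0.
      by move: (ow : qform c o w = 0); rewrite /qform c0 mul0r addr0 (space_form_flat c0 Mo) mul1r.
    by rewrite /qform w0 c0 !mul0r addr0 !mulr0.
  have -> : qform c w w = c * r ^+ 2 by rewrite rs metric_qform// mulVKf.
  have [->|r0] := eqVneq r 0; first by rewrite sn0 invr0 expr0n !mulr0.
  by field.
split=> [|c0]; first by move: xx; rewrite /qform -expr2.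
rewrite ltNge; apply/negP => x0.
have x01 : x 0 0 != 0.
  apply/eqP => x00; move: xx; rewrite /qform x00 mul0r add0r => xx.
  have : c * dot3 x x <= 0 by rewrite mulr_le0_ge0// dot3_ge0.
  by rewrite xx ler10.
have [cz|cz] := eqVneq c 0.
  have w0 : w 0 0 = 0.
    by move: (ow : qform c o w = 0); rewrite /qform cz mul0r addr0 (space_form_flat cz Mo) mul1r.
  move: x0; rewrite /x /exp_map !mxE w0 mulr0 addr0 (cs_flat _ cz) mul1r.
  by rewrite (space_form_flat cz Mo) ler10.
have cn : c < 0 by rewrite lt_neqAle cz.
have MNx : space_form c (- x).
  split; last by move=> _; rewrite mxE oppr_gt0 lt_neqAle x01.
  move: xx; rewrite /qform -expr2 => <-; rewrite !dot3E !mxE; ring.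
have := space_form_qform_gt0 cn Mo MNx.
rewrite qformC -scaleN1r qformZl qformC xo mulN1r oppr_gt0.
by rewrite ltNge ltW// cs_gt0.
Qed.

(** An isometry preserves the chords [metric c (y - x) (y - x)], hence the inner
    products of [x - o] with the four vectors [o] and [exp_o (t e_i)] spanning
    R^4, so its values at these points determine it. *)
Lemma isometry_reflection T d : riemannian_isometry c T -> T o = o ->
  (forall i, d i * d i = 1) ->
  (forall i (t : R), T (exp_map c o (t *: e i)) = exp_map c o ((t * d i) *: e i)) ->
  forall x, space_form c x -> T x = frame_reflection e d x.
Proof.
move=> iT To d1 Te x Mx.
have MT y : space_form c y -> space_form c (T y) by case: iT => -[Tf _ _] _; exact: Tf.
have q0 := isometry_metric iT Mo Mx; rewrite To in q0.
apply: frame_eq.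
  rewrite qform_reflection; have [c0|c0] := eqVneq c 0.
    rewrite /qform c0 !mul0r !addr0 (space_form_flat c0 Mx).
    by rewrite (space_form_flat c0 (MT _ Mx)).
  by rewrite !qform_chord ?q0//; exact: MT.
move=> i; rewrite frame_coord_reflection !frame_coordE//; last exact: MT.
have [t t0 snt] := sn_neq0.
have oei : tangent_space c o (e i) := oe.1 i.
have oti (s : R) : tangent_space c o (s *: e i).
  by rewrite tangentE qformC qformZl qformC oe.1 mulr0.
have e11 : metric c (e i) (e i) = 1 by rewrite oe.2 eqxx.
have ex (s : R) : s * s = 1 -> exp_map c o ((t * s) *: e i) - o =
    (cs c t - 1) *: o + (sn c t * s) *: e i.
  move=> s1; have nt : mnorm c ((t * s) *: e i) = t.
    rewrite /mnorm metricZl metricZr e11 mulr1 mulrACA s1 mulr1 -expr2 sqrtr_sqr.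
    by rewrite ger0_norm// ltW.
  rewrite /exp_map nt scalerA scalerBl scale1r addrAC; congr (_ + _ *: _).
  by rewrite mulrA divfK// gt_eqF.
have chord0 (s : R) (X : 'rV[R]_4) : s * s = 1 ->
    metric c (X - (exp_map c o ((t * s) *: e i) - o)) (X - (exp_map c o ((t * s) *: e i) - o))
    = metric c X X - 2 * ((cs c t - 1) * metric c o X) - 2 * sn c t * (s * metric c X (e i))
      + ((cs c t - 1) ^+ 2 * metric c o o + sn c t ^+ 2).
  move=> s1; rewrite ex//; set Y := _ *: o + _.
  have oe0 := cs1_o t oei.
  rewrite metricBl !metricBr (metricC c Y X) /Y !metricDr !metricDl !metricZl !metricZr e11.
  rewrite (metricC c X o) (metricC c (e i) o) mulr1.
  set C := cs c t - 1 in oe0 *; set m := metric c o (e i) in oe0 *.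
  have -> : C * (sn c t * s * m) = sn c t * s * (C * m) by ring.
  have -> : sn c t * s * (C * m) = 0 by rewrite oe0 mulr0.
  have -> : sn c t * s * (sn c t * s) = sn c t ^+ 2 by rewrite mulrACA s1 mulr1 expr2.
  by ring.
have co : (cs c t - 1) * metric c o (T x - o) = (cs c t - 1) * metric c o (x - o).
  rewrite !cs1_metric; congr (_ * (_ * _)).
  rewrite !(qformC c o) !qformBl !(qformC c _ o); congr (_ - _).
  have [c0|c0] := eqVneq c 0.
    rewrite /qform c0 !mul0r !addr0 (space_form_flat c0 Mx).
    by rewrite (space_form_flat c0 (MT _ Mx)).
  by rewrite !qform_chord ?q0//; exact: MT.
have Mi : space_form c (exp_map c o (t *: e i)) by exact: exp_map_space_form.
have := isometry_metric iT Mi Mx; rewrite Te.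
have base (a b : 'rV[R]_4) : a - b = (a - o) - (b - o) by rewrite opprB addrA subrK.
rewrite (base (T x)) (base x).
rewrite chord0// -[in X in _ = X](mulr1 t) chord0 ?mulr1// q0 co mul1r.
move=> /addIr/addrI/oppr_inj.
have s0 : 2 * sn c t != 0 by rewrite mulf_neq0 ?pnatr_eq0.
by move=> /(mulfI s0) <-; rewrite mulrA d1 mul1r.
Qed.

End Frame.
End Frames.

(** * The exponential map near the origin *)

Section Injectivity.
Context {R : realType}.
Variable c : R.

Lemma differentiable_expR (x : R) : differentiable (expR : R -> R) x.
Proof. exact/derivable1_diffP. Qed.

Lemma differentiable_sin (x : R) : differentiable (sin : R -> R) x.
Proof. exact/derivable1_diffP. Qed.

Lemma differentiable_mull (k x : R) : differentiable (fun r : R => k * r) x.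
Proof. by apply: differentiableM; [exact: differentiable_cst|]. Qed.

Lemma derive_mull (k x : R) : 'D_1 (fun r : R => k * r) x = k.
Proof. by rewrite derive_cstM// derive_id mulr1. Qed.

Lemma sn_derive0 : differentiable (sn c) 0 /\ 'D_1 (sn c) 0 = 1.
Proof.
have [c0|cn|cp] := ltrgt0P c; last first.
- have -> : sn c = id by apply/funext => r; rewrite sn_flat.
  by split=> //; rewrite derive_id.
- set k := Num.sqrt (- c).
  have k0 : k != 0 by rewrite gt_eqF// sqrtr_gt0 oppr_gt0.
  have -> : sn c = (fun r => (2 * k)^-1 * (expR (k * r) + -1 * expR (- k * r))).
    by apply/funext => r; rewrite /sn (lt_gtF cn) cn -/k !mulNr; field.
  have dk (l : R) : differentiable (fun r : R => expR (l * r)) 0.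
    exact: (differentiable_comp (differentiable_mull l 0) (differentiable_expR _)).
  have Dk (l : R) : 'D_1 (fun r : R => expR (l * r)) 0 = l.
    rewrite (derive_compR _ (differentiable_mull l 0) (differentiable_expR _)).
    by rewrite derive_mull mulr0 derive_val expR0 mulr1.
  have dk' : differentiable (fun r : R => -1 * expR (- k * r)) 0.
    exact: (differentiableM (differentiable_cst _ _) (dk (- k))).
  split; first exact: (differentiableM (differentiable_cst _ _) (differentiableD (dk k) dk')).
  rewrite (derive_cstM _ _ (differentiableD (dk k) dk')) (derive_add _ (dk k) dk').
  by rewrite (derive_cstM _ _ (dk (- k))) !Dk; field.
- set k := Num.sqrt c.
  have k0 : k != 0 by rewrite gt_eqF// sqrtr_gt0.
  have -> : sn c = (fun r => k^-1 * sin (k * r)).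
    by apply/funext => r; rewrite /sn c0 -/k mulrC.
  have dk : differentiable (fun r : R => sin (k * r)) 0.
    exact: (differentiable_comp (differentiable_mull k 0) (differentiable_sin _)).
  split; first exact: (differentiableM (differentiable_cst _ _) dk).
  rewrite (derive_cstM _ _ dk).
  rewrite (derive_compR _ (differentiable_mull k 0) (differentiable_sin _)).
  by rewrite derive_mull mulr0 derive_val cos0 mulr1 mulVf.
Qed.

Lemma sn_near0 (e : R) : 0 < e ->
  exists2 d : R, 0 < d & forall r, `|r| < d -> `|sn c r - r| <= e * `|r|.
Proof.
move=> e0; have [ds Ds] := sn_derive0.
have /nbhs_ballP[d /= d0 dP] := diff_eps ds e0.
exists d => // r rd; have := dP r; rewrite ball0E => /(_ rd).
rewrite addr0 sn0 subr0 -(deriveE _ ds) deriveR_scale// Ds mulr1.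
by [].
Qed.

Lemma sn_lt_near0 : exists2 d : R, 0 < d &
  forall r s, 0 <= r -> r < s -> s < d -> sn c r < sn c s.
Proof.
have [c0|cn|cp] := ltrgt0P c; last first.
- by exists 1 => // r s _ rs _; rewrite !sn_flat.
- exists 1 => // r s _ rs _.
  have k0 : 0 < Num.sqrt (- c) by rewrite sqrtr_gt0 oppr_gt0.
  rewrite /sn (lt_gtF cn) cn !ltr_pM2r ?invr_gt0//.
  by rewrite ltrB// ltr_expR ?ltrN2 ltr_pM2l.
- have k0 : 0 < Num.sqrt c by rewrite sqrtr_gt0.
  set k := Num.sqrt c in k0 *.
  exists (pi / 2 / k); first by rewrite !divr_gt0// pi_gt0.
  move=> r s r0 rs sd; rewrite /sn c0 -/k ltr_pM2r ?invr_gt0// ltr_sin.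
  + by rewrite ltr_pM2l.
  + have s0 := le_lt_trans r0 rs.
    have kr : k * r <= pi / 2.
      by rewrite mulrC -ler_pdivlMr// ltW// (lt_trans rs).
    by rewrite in_itv/= kr (le_trans _ (mulr_ge0 (ltW k0) r0))// oppr_le0 divr_ge0// ltW ?pi_gt0.
  + have s0 := le_lt_trans r0 rs.
    have kr : k * s <= pi / 2 by rewrite mulrC -ler_pdivlMr// ltW.
    by rewrite in_itv/= kr (le_trans _ (mulr_ge0 (ltW k0) (ltW s0)))// oppr_le0 divr_ge0// ltW ?pi_gt0.
Qed.

Variables (o : 'rV[R]_4) (e : 'I_3 -> 'rV[R]_4).
Hypotheses (Mo : space_form c o) (oe : orthoframe c o e).
Implicit Types g h : 'I_3 -> R.

Let len g : R := mnorm c (\sum_i g i *: e i).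

Lemma frame_coord_norm g i : `|g i| <= len g.
Proof.
rewrite /len (mnorm_frame oe) -sqrtr_sqr ler_wsqrtr// (bigD1 i)//= lerDl.
by apply: sumr_ge0 => j _; exact: sqr_ge0.
Qed.

(** The squares of the coordinates add up to [sn c r ^ 2], which determines the
    length [r] of the vector, as [sn c] increases near 0. *)
Lemma exp_map_frame_inj : exists2 d : R, 0 < d & forall g h,
  len g < d -> len h < d ->
  exp_map c o (\sum_i g i *: e i) = exp_map c o (\sum_i h i *: e i) ->
  forall i, g i = h i.
Proof.
have [d d0 mono] := sn_lt_near0; exists d => // g h gd hd E.
have g0 : 0 <= len g by exact: sqrtr_ge0.
have h0 : 0 <= len h by exact: sqrtr_ge0.
have Ei i : sn c (len g) / len g * g i = sn c (len h) / len h * h i.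
  by rewrite -!(frame_coord_exp Mo oe) E.
have sq (f : 'I_3 -> R) : \sum_i (sn c (len f) / len f * f i) ^+ 2 = sn c (len f) ^+ 2.
  under eq_bigr do rewrite exprMn.
  have -> : \sum_i (sn c (len f) / len f) ^+ 2 * f i ^+ 2 =
     (sn c (len f) / len f) ^+ 2 * (len f) ^+ 2.
    rewrite -mulr_sumr /len (mnorm_frame oe) sqr_sqrtr//.
    by apply: sumr_ge0 => i _; exact: sqr_ge0.
  have [->|l0] := eqVneq (len f) 0; first by rewrite sn0 invr0 mulr0 expr0n mulr0.
  by rewrite -exprMn divfK.
have sn_ge0 r : 0 <= r -> r < d -> 0 <= sn c r.
  rewrite le_eqVlt => /predU1P[<- _|r0 rd]; first by rewrite sn0.
  by rewrite -(sn0 c) ltW// mono.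
have snE : sn c (len g) = sn c (len h).
  apply/eqP; rewrite -(@eqrXn2 _ 2) ?sn_ge0// -!sq.
  by apply/eqP; apply: eq_bigr => i _; rewrite Ei.
have lE : len g = len h.
  apply/eqP; case: ltgtP => // lt; exfalso.
    by have := mono _ _ g0 lt hd; rewrite snE ltxx.
  by have := mono _ _ h0 lt gd; rewrite snE ltxx.
move=> i; have [lz|ln] := eqVneq (len g) 0.
  have z (f : 'I_3 -> R) : len f = 0 -> f i = 0.
    by move=> f0; apply/eqP; rewrite -normr_le0 -f0 frame_coord_norm.
  by rewrite !z// -lE.
have := Ei i; rewrite -lE; apply: mulfI; rewrite mulf_neq0 ?invr_eq0//.
by rewrite gt_eqF// -(sn0 c) mono// lt_neqAle eq_sym ln.
Qed.

End Injectivity.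

(** * Rigidity of the second coordinate *)

Section Rigidity.
Context {R : realType}.
Implicit Types (w : 'rV[R]_2 -> R) (b : R -> R).

Lemma mean_value b (r x s : R) :
  (forall t, `|t| < r -> differentiable b t) -> `|x| < r -> `|x + s| < r ->
  exists2 t, 0 <= t <= 1 & b (x + s) - b x = s * 'D_1 b (x + t * s).
Proof.
move=> db xr xsr.
have dt t : 0 <= t <= 1 -> differentiable b (x + t *: s).
  by move=> t01; apply: db; exact: segment_norm_lt.
have [t t01 E] := @MVT_line R R b x s dt.
by exists t => //; rewrite E (deriveR_scale _ (dt t t01)).
Qed.

Lemma mean_value_lipschitz b (r l x y : R) :
  (forall t, `|t| < r -> differentiable b t /\ `|'D_1 b t| <= l) ->
  `|x| < r -> `|y| < r -> `|b x - b y| <= l * `|x - y|.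
Proof.
move=> bl xr yr.
have [|t t01] := @mean_value b r y (x - y) (fun t tr => (bl t tr).1) yr.
  by rewrite addrC subrK.
have -> : y + (x - y) = x by rewrite addrC subrK.
move=> ->; rewrite normrM mulrC ler_wpM2r//.
apply: (bl _ _).2; apply: (@segment_norm_lt R R) => //.
by rewrite addrC subrK.
Qed.

(** The quantitative form of [b' 0 = b'' 0 = 0]: [eta] is small if [rho] is. *)
Definition second_order_flat b (rho eta : R) :=
  [/\ (forall t, `|t| < rho -> differentiable b t), 'D_1 b 0 = 0 &
      forall x y, `|x| < rho -> `|y| < rho ->
        `|'D_1 b x - 'D_1 b y| <= eta * `|x - y|].

Lemma second_order_flat_exists b (eta : R) : smooth_near 0 b -> 'D_1 b 0 = 0 ->
  'D_1 ('D_1 b) 0 = 0 -> 0 < eta ->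
  exists2 rho, 0 < rho & second_order_flat b rho eta.
Proof.
move=> sb b1 b2 eta0.
have c2 : 'D_1 ('D_1 b) t @[t --> (0 : R)] --> 'D_1 ('D_1 b) 0.
  exact/smooth_near_continuous/smooth_near_derive/smooth_near_derive.
have N1 := smooth_near_near sb.
have N2 : \forall t \near (0 : R), `|'D_1 ('D_1 b) 0 - 'D_1 ('D_1 b) t| <= eta.
  exact: (cvgr_dist_le _ _ c2).
have : \forall t \near (0 : R), smooth_near t b /\ `|'D_1 ('D_1 b) t| <= eta.
  apply: filterS2 N1 N2 => t t1; rewrite b2 sub0r normrN; by split.
move=> /nbhs_ballP[rho /= rho0 H]; exists rho => //.
have {}H t : `|t| < rho -> smooth_near t b /\ `|'D_1 ('D_1 b) t| <= eta.
  by move=> tr; apply: H; rewrite ball0E.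
split=> // [t /H[st _]|x y]; first exact: smooth_near_differentiable.
apply: (@mean_value_lipschitz ('D_1 b) rho) => t /H[st lt]; split=> //.
exact/smooth_near_differentiable/smooth_near_derive.
Qed.

Lemma flat_increment b (rho eta m x s : R) : second_order_flat b rho eta ->
  0 <= eta -> 0 < rho -> `|x| <= m -> `|x + s| <= m -> m < rho ->
  exists D : R, [/\ b (x + s) - b x = s * D, `|D| <= eta * m &
    `|'D_1 b (x + s) - D| <= eta * `|s|].
Proof.
move=> [db b1 bl] eta0 rho0 xm xsm mr.
have xr := le_lt_trans xm mr; have xsr := le_lt_trans xsm mr.
have [t t01 E] := @mean_value b rho x s db xr xsr.
have tm : `|x + t * s| <= m by exact: segment_norm_le.
exists ('D_1 b (x + t * s)); split=> //.
  rewrite -[X in `|X|]subr0 -b1; apply: (le_trans (bl _ _ _ _)).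
  - exact: le_lt_trans mr.
  - by rewrite normr0.
  - by rewrite subr0 ler_wpM2l.
apply: (le_trans (bl _ _ xsr (le_lt_trans tm mr))).
rewrite opprD addrACA subrr add0r -[X in X - _]mul1r -mulrBl normrM ler_wpM2l//.
case/andP: t01 => t0 t1.
by rewrite ger0_norm ?subr_ge0// ler_piMl// gerBl.
Qed.

Lemma sign_norm (d : R) : d * d = 1 -> `|d| = 1.
Proof.
by move=> /eqP; rewrite -expr2 sqrf_eq1 => /orP[] /eqP ->; rewrite ?normrN normr1.
Qed.

(** If [p] and [q] had the same strict sign, then so would [E] and [- E]. *)
Lemma opposite_signs (E e p q : R) : 0 < e ->
  `|E - e * p| <= e / 2 * `|p| -> `|E + e * q| <= e / 2 * `|q| ->
  Num.min q p <= 0 <= Num.max q p.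
Proof.
move=> e0 Hp Hq; rewrite ge_min le_max.
have [p0|p0|p0] := ltrgt0P p; have [q0|q0|q0] := ltrgt0P q => //=.
  exfalso; move: Hp Hq; rewrite (gtr0_norm p0) (gtr0_norm q0) !ler_norml.
  move=> /andP[H1 _] /andP[_ H2].
  have := mulr_gt0 e0 p0; have := mulr_gt0 e0 q0; lra.
exfalso; move: Hp Hq; rewrite (ltr0_norm p0) (ltr0_norm q0) !ler_norml.
move=> /andP[_ H1] /andP[H2 _].
have := pmulr_rlt0 p e0; have := pmulr_rlt0 q e0; rewrite p0 q0 => ? ?; lra.
Qed.

(** Let [d1 = 1] or [-1], [d2 = 1] or [-1]. The excess [s = w - d1 d2 v] satisfies
    [d1 u s + b (d1 d2 v + s) - b (d1 d2 v) = E] with [E = d2 b v - b (d1 d2 v)]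
    independent of [u]. Since [b] is flat, the left hand side is close to [d1 u s],
    so [s] takes both signs, or vanishes, as [u] crosses 0 at a scale where [u]
    dominates [b']; where [s] vanishes, [E] does. Once [E = 0], differentiating
    in [u] gives [|s| <= |s| / 2]. *)
Lemma second_coordinate_rigid w b (d1 d2 : R) :
  d1 * d1 = 1 -> d2 * d2 = 1 -> smooth_near 0 w -> w 0 = 0 ->
  smooth_near 0 b -> 'D_1 b 0 = 0 -> 'D_1 ('D_1 b) 0 = 0 ->
  (\forall z \near (0 : 'rV[R]_2),
     d1 * (z : 'rV[R]_2) 0 0 * w z + b (w z) = d2 * (z 0 0 * z 0 1 + b (z 0 1))) ->
  \forall z \near (0 : 'rV[R]_2),
    w z = d1 * d2 * (z : 'rV[R]_2) 0 1 /\ b (d1 * d2 * z 0 1) = d2 * b (z 0 1).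
Proof.
move=> d11 d22 sw w0 sb b1 b2 eqn.
(* [L] bounds [w z / |z|] and the derivative of [w] in [u]. With [eta = 1 / (2 L)],
   the derivative of [b] at points of size [L * eps] is at most [eps / 2]. *)
pose L := 1 + `|partial_u w 0| + `|partial_v w 0|.
have L0 : 0 < L by rewrite ltr_pwDl// addr_ge0.
have L1 : 1 <= L by rewrite /L -addrA lerDl addr_ge0.
pose eta := (2 * L)^-1.
have eta0 : 0 < eta by rewrite invr_gt0 mulr_gt0.
have etaL : eta * L = 2^-1 by rewrite /eta; field; rewrite gt_eqF.
have [rho rho0 flat] := second_order_flat_exists sb b1 b2 eta0.
have [r1 r10 strict] := smooth_strict_diff sw (@ltr01 R).
have cu := smooth_near_continuous (smooth_near_derive (vec2 1 0) sw).
have N1 : \forall z \near (0 : 'rV[R]_2), `|partial_u w 0 - partial_u w z| <= 1.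
  exact: (cvgr_dist_le _ _ cu).
have N2 := smooth_near_near sw.
have /nbhs_ballP[r2 /= r20 H2] : \forall z \near (0 : 'rV[R]_2),
   [/\ `|partial_u w 0 - partial_u w z| <= 1, smooth_near z w &
     d1 * (z : 'rV[R]_2) 0 0 * w z + b (w z) = d2 * (z 0 0 * z 0 1 + b (z 0 1))].
  by apply: filterS3 N1 N2 eqn => z z1 z2 z3; split.
pose r := Num.min r1 (Num.min r2 (rho / L)).
have r0 : 0 < r by rewrite !lt_min r10 r20 divr_gt0.
pose eps := r / 2.
have eps0 : 0 < eps by rewrite divr_gt0.
have epsr : eps < r by rewrite /eps ltr_pdivrMr// ltr_pMr// ltr1n.
have rr1 : r <= r1 by rewrite ge_min lexx.
have rr2 : r <= r2 by rewrite !ge_min lexx orbT.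
have rr3 : r * L <= rho by rewrite -ler_pdivlMr// !ge_min lexx !orbT.
have Hz (z : 'rV[R]_2) : `|z| < r -> [/\ `|w z| <= L * `|z|,
    `|partial_u w z| <= L, smooth_near z w &
    d1 * z 0 0 * w z + b (w z) = d2 * (z 0 0 * z 0 1 + b (z 0 1))].
  move=> zr; have [|z1 z2 z3] := H2 z.
    by rewrite ball0E (lt_le_trans zr).
  have := strict 0 z; rewrite !subr0 !add0r normr0 w0 !subr0 => /(_ r10 (lt_le_trans zr rr1)).
  rewrite mul1r => S; split=> //.
    have -> : w z = (w z - (z 0 0 * partial_u w 0 + z 0 1 * partial_v w 0))
      + (z 0 0 * partial_u w 0 + z 0 1 * partial_v w 0) by rewrite subrK.
    rewrite (le_trans (ler_normD _ _))// /L -addrA mulrDl mul1r lerD//.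
    rewrite (le_trans (ler_normD _ _))// !normrM mulrDl.
    by rewrite lerD// mulrC ler_wpM2l// row_coord_le.
  have -> : partial_u w z = partial_u w 0 - (partial_u w 0 - partial_u w z).
    by rewrite opprB addrC subrK.
  rewrite (le_trans (ler_normB _ _))// (le_trans (lerD (lexx _) z1))//.
  by rewrite /L (addrC 1) lerDl.
pose k := d1 * d2.
have kk : k * k = 1 by rewrite /k mulrACA d11 d22 mulr1.
have k1 := sign_norm kk; have dn1 := sign_norm d11.
pose m := L * eps.
have m0 : 0 <= m by rewrite mulr_ge0 ?ltW.
have mrho : m < rho by rewrite (lt_le_trans _ rr3)// /m mulrC ltr_pM2r.
have etam : eta * m = eps / 2 by rewrite /m mulrA etaL mulrC.
pose S z := w z - k * z 0 1.
pose E v := d2 * b v - b (k * v).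
have eqS (z : 'rV[R]_2) : `|z| <= eps ->
    d1 * z 0 0 * S z + (b (w z) - b (k * z 0 1)) = E (z 0 1).
  move=> ze; have [_ _ _ H] := Hz z (le_lt_trans ze epsr).
  rewrite /S /E.
  have -> : d2 * b (z 0 1) = d1 * z 0 0 * w z + b (w z) - d2 * (z 0 0 * z 0 1).
    by rewrite H; ring.
  have -> : d2 * (z 0 0 * z 0 1) = d1 * z 0 0 * (k * z 0 1).
    by rewrite /k -[in LHS](mul1r d2) -d11; ring.
  by ring.
have incr (z : 'rV[R]_2) : `|z| <= eps -> exists D : R,
    [/\ b (w z) - b (k * z 0 1) = S z * D, `|D| <= eps / 2 &
      `|'D_1 b (w z) - D| <= eta * `|S z|].
  move=> ze; have [wz _ _ _] := Hz z (le_lt_trans ze epsr).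
  have SE : k * z 0 1 + S z = w z by rewrite addrC subrK.
  have [||D] := @flat_increment b rho eta m (k * z 0 1) (S z) flat (ltW eta0) rho0 _ _ mrho.
  - rewrite normrM k1 mul1r (le_trans (row_coord_le z 1))// (le_trans ze)//.
    by rewrite ler_peMl// ltW.
  - by rewrite SE (le_trans wz)// ler_wpM2l// ltW.
  - by rewrite SE etam => -[D1 D2 D3]; exists D.
(* [S] vanishes for some [u] between [- eps] and [eps]. *)
have E0 v : `|v| <= eps -> E v = 0.
  move=> ve; have nz u : `|u| <= eps -> `|vec2 u v| <= eps by move=> ?; exact: vec2_norm_le.
  have bound u : `|u| <= eps -> `|E v - u * (d1 * S (vec2 u v))| <= eps / 2 * `|d1 * S (vec2 u v)|.
    move=> ue; have [D [D1 D2 _]] := incr _ (nz u ue); have := eqS _ (nz u ue).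
    rewrite D1 vec2_u vec2_v => <-.
    have -> : d1 * u * S (vec2 u v) + S (vec2 u v) * D - u * (d1 * S (vec2 u v)) = S (vec2 u v) * D.
      by ring.
    by rewrite !normrM dn1 mul1r mulrC ler_wpM2r.
  have ne : `|eps| <= eps by rewrite gtr0_norm.
  have nNe : `|- eps| <= eps by rewrite normrN gtr0_norm.
  have b2' := bound _ nNe; rewrite mulNr opprK in b2'.
  have sgn := opposite_signs eps0 (bound _ ne) b2'.
  have cS : {within `[- eps, eps], continuous (fun u => d1 * S (vec2 u v))}.
    apply: continuous_in_subspaceT => u; rewrite inE/= in_itv/= => /andP[u1 u2].
    have ue : `|u| <= eps by rewrite ler_norml u1.
    have [_ _ sz _] := Hz _ (le_lt_trans (nz u ue) epsr).
    have sv : smooth_near u (fun u => vec2 u v).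
      apply/smooth_near_rowP; apply: forall_ord2.
        by apply: smooth_near_eq (smooth_near_id u) => t; rewrite vec2_u.
      by apply: smooth_near_eq (smooth_near_cst v u) => t; rewrite vec2_v.
    apply: smooth_near_continuous; apply: smooth_nearM; first exact: smooth_near_cst.
    apply: smooth_nearB; first exact: (@smooth_near_comp _ _ _ w (fun u => vec2 u v) u sz sv).
    apply: smooth_nearM; first exact: smooth_near_cst.
    by move/smooth_near_rowP: sv.
  have [|u] := @IVT R (fun u => d1 * S (vec2 u v)) (- eps) eps 0 _ cS sgn.
    by rewrite ge0_cp// ltW.
  rewrite in_itv/= => /andP[u1 u2] /eqP; rewrite mulf_eq0.
  have -> /= : (d1 == 0) = false.
    by apply/negbTE; rewrite -normr_eq0 dn1 oner_eq0.
  move=> /eqP S0.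
  have ue : `|u| <= eps by rewrite ler_norml u1.
  have := eqS _ (nz u ue); have [D [-> _ _]] := incr _ (nz u ue).
  by rewrite S0 mulr0 mul0r addr0 vec2_v.
apply/nbhs_ballP; exists eps => // z; rewrite ball0E => ze.
have ze' := ltW ze.
have z1e := E0 _ (le_trans (row_coord_le z 1) ze').
split; last by apply/esym/eqP; rewrite -subr_eq0 -/k; apply/eqP.
apply/eqP; rewrite -subr_eq0 -/k -/(S z); apply: contraT => S0.
have [_ wu sz _] := Hz _ (lt_trans ze epsr).
have [D [D1 _ D3]] := incr _ ze'.
have D0 : d1 * z 0 0 + D = 0.
  by apply: (mulfI S0); rewrite mulr0 -z1e -(eqS _ ze') D1; ring.
have wzr : `|w z| < rho.
  have [wz _ _ _] := Hz z (lt_trans ze epsr).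
  by rewrite (le_lt_trans wz)// (le_lt_trans _ mrho)// ler_wpM2l// ltW.
have dw := smooth_near_differentiable sz.
have db : differentiable b (w z) by case: flat => + _ _; apply.
have z1r : `|z 0 1| < rho.
  rewrite (le_lt_trans (row_coord_le z 1))// (le_lt_trans ze')// (le_lt_trans _ mrho)//.
  by rewrite ler_peMl// ltW.
have db1 : differentiable b (z 0 1) by case: flat => + _ _; apply.
have dc i : differentiable (fun y : 'rV[R]_2 => y 0 i) z by exact: differentiable_coord.
have near_eqn : \near z, d1 * ((z : 'rV[R]_2) 0 0 * w z) + b (w z) = d2 * (z 0 0 * z 0 1 + b (z 0 1)).
  have : \forall y \near z, ball 0 eps y.
    by apply: open_nbhs_nbhs; split; [exact: ball_open|rewrite ball0E].
  apply: filterS => y; rewrite ball0E => ye.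
  by have [_ _ _] := Hz _ (lt_trans ye epsr); rewrite mulrA.
(* Differentiating the equation in [u] and subtracting [D0], times the derivative
   of [w], leaves [d1 * S z = - ('D_1 b (w z) - D) * partial_u w z]. *)
have := near_eq_derive (vec2 1 0) near_eqn.
have dbw : differentiable (fun y => b (w y)) z by exact: (differentiable_comp dw db).
have dbc : differentiable (fun y : 'rV[R]_2 => b (y 0 1)) z by exact: (differentiable_comp (dc 1) db1).
have dzw : differentiable (fun y : 'rV[R]_2 => y 0 0 * w y) z by exact: (differentiableM (dc 0) dw).
have dzz : differentiable (fun y : 'rV[R]_2 => y 0 0 * y 0 1) z by exact: (differentiableM (dc 0) (dc 1)).
have da : differentiable (fun y : 'rV[R]_2 => d1 * (y 0 0 * w y)) z.
  exact: (differentiableM (differentiable_cst _ _) dzw).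
rewrite (derive_add _ da dbw) (derive_cstM _ _ dzw) (derive_mul _ (dc 0) dw).
rewrite (derive_compR _ dw db) (derive_cstM _ _ (differentiableD dzz dbc)).
rewrite (derive_add _ dzz dbc) (derive_mul _ (dc 0) (dc 1)) (derive_compR _ (dc 1) db1).
rewrite !derive_coord vec2_u vec2_v.
rewrite -/(partial_u w z) mulr0 mul0r addr0 add0r !mulr1.
set wu' := partial_u w z in wu *; set B := 'D_1 b (w z) in D3 *.
move=> DE.
have : d1 * S z = - (B - D) * wu'.
  have -> : d1 * S z = d1 * (z 0 0 * wu' + w z) - d1 * z 0 0 * wu' - d1 * k * z 0 1.
    by rewrite /S; ring.
  have -> : d1 * (z 0 0 * wu' + w z) = d2 * z 0 1 - wu' * B by rewrite -DE; ring.
  have -> : d1 * z 0 0 = - D by apply/eqP; rewrite -addr_eq0 D0.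
  by rewrite /k mulrA d11; ring.
move=> /(congr1 (fun x : R => `|x|)); rewrite !normrM dn1 mul1r normrN => SE.
have : `|S z| <= eta * `|S z| * L by rewrite {1}SE ler_pM.
rewrite mulrAC etaL; have : 0 < `|S z| by rewrite normr_gt0.
set X := `|S z| => X0 X1; exfalso; move: X0 X1; lra.
Qed.

End Rigidity.

(** * Mirrors of a cross cap *)

Section Mirrors.
Context {R : realType}.
Variables (c : R) (o : 'rV[R]_4).
Hypothesis Mo : space_form c o.

Definition i0 : 'I_3 := inord 0.
Definition i1 : 'I_3 := inord 1.
Definition i2 : 'I_3 := inord 2.

Lemma forall_ord3 (P : 'I_3 -> Prop) : P i0 -> P i1 -> P i2 -> forall i, P i.
Proof.
move=> P0 P1 P2 [[|[|[|//]]] i3].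
- by rewrite (_ : Ordinal i3 = i0)//; apply: val_inj; rewrite /= inordK.
- by rewrite (_ : Ordinal i3 = i1)//; apply: val_inj; rewrite /= inordK.
- by rewrite (_ : Ordinal i3 = i2)//; apply: val_inj; rewrite /= inordK.
Qed.

Lemma sum3 (V : zmodType) (F : 'I_3 -> V) : \sum_i F i = F i0 + F i1 + F i2.
Proof.
rewrite !big_ord_recr big_ord0/= add0r; congr (F _ + F _ + F _);
  by apply: val_inj; rewrite /= inordK.
Qed.

Definition triple (T : Type) (x y z : T) (i : 'I_3) : T := nth z [:: x; y] i.

Lemma triple0 T (x y z : T) : triple x y z i0 = x.
Proof. by rewrite /triple inordK. Qed.
Lemma triple1 T (x y z : T) : triple x y z i1 = y.
Proof. by rewrite /triple inordK. Qed.
Lemma triple2 T (x y z : T) : triple x y z i2 = z.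
Proof. by rewrite /triple inordK. Qed.
Definition tripleE := (triple0, triple1, triple2).

(** The diagonal matrices by which the three isometries act on an adapted frame. *)
Definition mirror_sign (j : mirror) : 'I_3 -> R :=
  match j with
  | principal_plane => triple 1 (-1) 1
  | normal_plane => triple (-1) 1 1
  | normal_line => triple (-1) (-1) 1
  end.

Lemma mirror_signM j i : mirror_sign j i * mirror_sign j i = 1.
Proof.
by case: j; move: i; apply: forall_ord3; rewrite /= tripleE ?mulr1 ?mulrNN ?mulr1.
Qed.

Lemma mirror_sign2 j : mirror_sign j i2 = 1.
Proof. by case: j; rewrite /= tripleE. Qed.

Variable e : 'I_3 -> 'rV[R]_4.
Hypothesis oe : orthoframe c o e.

(** [e] is adapted to the 2-jet [(fu, fvv)]: the tangent line is spanned by the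
    first vector, the principal plane by the first and the third. *)
Definition adapted (fu fvv : 'rV[R]_4) := exists al be ga : R,
  [/\ al != 0, ga != 0, fu = al *: e i0 & fvv = be *: e i0 + ga *: e i2].

Lemma frame_tangent1 (t : R) i : tangent_space c o (t *: e i).
Proof. by rewrite tangentE qformC qformZl qformC oe.1 mulr0. Qed.

Lemma metric_frame1 (s t : R) i j :
  metric c (s *: e i) (t *: e j) = s * t * (i == j)%:R.
Proof. by rewrite metricZl metricZr oe.2 mulrA. Qed.

Lemma i01 : (i0 == i1) = false. Proof. by rewrite -val_eqE/= !inordK. Qed.
Lemma i02 : (i0 == i2) = false. Proof. by rewrite -val_eqE/= !inordK. Qed.
Lemma i12 : (i1 == i2) = false. Proof. by rewrite -val_eqE/= !inordK. Qed.
Lemma i10 : (i1 == i0) = false. Proof. by rewrite eq_sym i01. Qed.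
Lemma i20 : (i2 == i0) = false. Proof. by rewrite eq_sym i02. Qed.
Lemma i21 : (i2 == i1) = false. Proof. by rewrite eq_sym i12. Qed.
Definition i3E := (i01, i02, i12, i10, i20, i21, eqxx).

Lemma mirror_tangent_fixed fu fvv j i (t : R) : adapted fu fvv ->
  mirror_sign j i = 1 -> mirror_tangent c o fu fvv j (t *: e i).
Proof.
move=> [al [be [ga [al0 ga0 -> ->]]]].
have N1 : -1 <> 1 :> R.
  by move=> /eqP; rewrite eq_sym -subr_eq0 opprK (_ : 1 + 1 = 2%:R)// pnatr_eq0.
have P0 : [set s *: (al *: e i0) + t *: (be *: e i0 + ga *: e i2) | s in [set: R] & t in [set: R]] (t *: e i0).
  exists (t / al) => //; exists 0 => //.
  by rewrite scale0r addr0 scalerA divfK.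
have P2 : [set s *: (al *: e i0) + t *: (be *: e i0 + ga *: e i2) | s in [set: R] & t in [set: R]] (t *: e i2).
  exists (- (t / ga * be) / al) => //; exists (t / ga) => //.
  rewrite scalerA divfK// scalerDr !scalerA addrA -scalerDl addNr scale0r add0r.
  by rewrite divfK.
have N k : k != i0 -> (tangent_space c o `&` [set w | metric c w (al *: e i0) = 0]) (t *: e k).
  by move=> ii; split; [exact: frame_tangent1|rewrite /= metric_frame1 (negbTE ii) mulr0].
case: j; move: i; apply: forall_ord3; rewrite /= tripleE => // _.
- by apply: N; rewrite i10.
- by apply: N; rewrite i20.
- by split=> //; apply: N; rewrite i20.
Qed.

Lemma mirror_tangent_orth fu fvv j i (t : R) w : adapted fu fvv ->
  mirror_sign j i = -1 -> mirror_tangent c o fu fvv j w -> metric c (t *: e i) w = 0.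
Proof.
move=> [al [be [ga [al0 ga0 -> ->]]]].
have N1 : 1 <> -1 :> R.
  by move=> /eqP; rewrite -subr_eq0 opprK (_ : 1 + 1 = 2%:R)// pnatr_eq0.
have P1 : [set s *: (al *: e i0) + t *: (be *: e i0 + ga *: e i2) | s in [set: R] & t in [set: R]] w ->
    metric c (t *: e i1) w = 0.
  move=> [r _ [s _ <-]].
  by rewrite !(metricDr, metricZr, metricZl) !oe.2 !i3E /= !mulr0n; ring.
have P0 : (tangent_space c o `&` [set w | metric c w (al *: e i0) = 0]) w ->
    metric c (t *: e i0) w = 0.
  move=> [_ /= /eqP]; rewrite metricZr mulf_eq0 (negbTE al0)/= => /eqP w0.
  by rewrite metricZl metricC w0 mulr0.
case: j; move: i; apply: forall_ord3; rewrite /= tripleE => // _ //.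
- by case=> _ /P0.
- by case=> /P1.
Qed.

(** The vectors of the frame with sign 1 span the mirror, and those with sign -1
    are orthogonal to it. *)
Lemma symmetry_reflection fu fvv j T : adapted fu fvv ->
  geodesic_symmetry c o (mirror_tangent c o fu fvv j) T ->
  forall x, space_form c x -> T x = frame_reflection c o e (mirror_sign j) x.
Proof.
move=> ad [iT fixT revT].
have fixe i (t : R) : mirror_sign j i = 1 -> T (exp_map c o (t *: e i)) = exp_map c o (t *: e i).
  by move=> ji; apply: fixT; exists (t *: e i) => //; exact: mirror_tangent_fixed.
apply: isometry_reflection => //.
- by have := fixe _ 0 (mirror_sign2 j); rewrite scale0r exp_map0.
- exact: mirror_signM.
- move=> i t; have /eqP := mirror_signM j i; rewrite -expr2 sqrf_eq1.
  move=> /orP[] /eqP ji; first by rewrite ji mulr1 fixe.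
  rewrite ji mulrN1 scaleNr; apply: revT; first exact: frame_tangent1.
  by move=> w; exact: mirror_tangent_orth.
Qed.

End Mirrors.

(** * Second order jets *)

Section Jets.
Context {R : realType}.
Implicit Types V W : normedModType R.

Lemma derive_bigsum V n (F : 'I_n -> V -> R) (x v : V) :
  (forall i, differentiable (F i) x) ->
  differentiable (fun y => \sum_i F i y) x /\
  'D_v (fun y => \sum_i F i y) x = \sum_i 'D_v (F i) x.
Proof.
elim: n F => [|n IH] F dF.
  have -> : (fun y => \sum_(i < 0) F i y) = (fun=> 0).
    by apply/funext => y; rewrite big_ord0.
  by rewrite big_ord0 (derive_cst (0 : R)); split=> //; exact: differentiable_cst.
have [d D] := IH (fun i => F (lift ord0 i)) (fun i => dF (lift ord0 i)).
have -> : (fun y => \sum_i F i y) = (fun y => F ord0 y + \sum_i F (lift ord0 i) y).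
  by apply/funext => y; rewrite big_ord_recl.
split; first exact: (differentiableD (dF ord0) d).
by rewrite (derive_add _ (dF ord0) d) D big_ord_recl.
Qed.

Lemma derive_row_sum n (H : 'rV[R]_n -> R) (q w : 'rV[R]_n) : differentiable H q ->
  'D_w H q = \sum_i w 0 i * 'D_(delta_mx 0 i) H q.
Proof.
move=> dH; rewrite deriveE// [w in LHS]row_sum_delta linear_sum.
by apply: eq_bigr => i _; rewrite linearZ/= deriveE.
Qed.

Lemma derive_comp_at V n (H : 'rV[R]_n -> R) (F : V -> 'rV[R]_n) (x v : V) :
  differentiable F x -> differentiable H (F x) ->
  'D_v (fun y => H (F y)) x = 'D_('D_v F x) H (F x).
Proof.
move=> dF dH; rewrite (derive_comp_row _ dF dH) (derive_row_sum _ dH).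
by apply: eq_bigr => i _; rewrite derive_row.
Qed.

Lemma derive2_comp V n (H : 'rV[R]_n -> R) (F : V -> 'rV[R]_n) (x v : V) :
  smooth_near x F -> smooth_near (F x) H ->
  'D_v ('D_v (fun y => H (F y))) x =
  \sum_i ('D_v (fun y => F y 0 i) x * 'D_v (fun y => 'D_(delta_mx 0 i) H (F y)) x +
          'D_(delta_mx 0 i) H (F x) * 'D_v ('D_v (fun y => F y 0 i)) x).
Proof.
move=> sF sH.
have sFi i : smooth_near x (fun y => F y 0 i) by move/smooth_near_rowP: sF.
have nH : \forall y \near x, smooth_near (F y) H.
  exact: (smooth_near_continuous sF) _ (smooth_near_near sH).
have E : \near x, 'D_v (fun y => H (F y)) x =
    \sum_i 'D_v (fun y => F y 0 i) x * 'D_(delta_mx 0 i) H (F x).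
  apply: filterS2 (smooth_near_near sF) nH => y sFy sHy.
  by rewrite derive_comp_row//; exact: smooth_near_differentiable.
rewrite (near_eq_derive v E).
have sA i : smooth_near x ('D_v (fun y => F y 0 i)) by exact: smooth_near_derive.
have sB i : smooth_near x (fun y => 'D_(delta_mx 0 i) H (F y)).
  exact: (smooth_near_comp (smooth_near_derive _ sH) sF).
have [|_ ->] := @derive_bigsum V n
   (fun i y => 'D_v (fun y => F y 0 i) y * 'D_(delta_mx 0 i) H (F y)) x v.
  by move=> i; apply: smooth_near_differentiable; exact: smooth_nearM.
by apply: eq_bigr => i _; rewrite derive_mul//; exact: smooth_near_differentiable.
Qed.

(** Where [F] is critical in the direction [v], the second derivatives of [H] do
    not contribute: the second derivative of a singular map in the singular
    direction is a vector. *)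
Lemma derive2_comp_critical V n (H : 'rV[R]_n -> R) (F : V -> 'rV[R]_n) (x v : V) :
  smooth_near x F -> smooth_near (F x) H -> 'D_v F x = 0 ->
  'D_v ('D_v (fun y => H (F y))) x = 'D_('D_v ('D_v F) x) H (F x).
Proof.
move=> sF sH F0; rewrite derive2_comp// derive_row_sum; last exact: smooth_near_differentiable.
apply: eq_bigr => i _; have dF := smooth_near_differentiable sF.
rewrite -(derive_row v i dF) F0 mxE mul0r add0r mulrC; congr (_ * _).
have dDF := smooth_near_differentiable (smooth_near_derive v sF).
rewrite (derive_row v i dDF); apply: near_eq_derive.
apply: filterS (smooth_near_near sF) => y sFy.
by rewrite derive_row//; exact: smooth_near_differentiable.
Qed.

Lemma derive2_mul V (f g : V -> R) (x v : V) : smooth_near x f -> smooth_near x g ->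
  'D_v ('D_v (fun y => f y * g y)) x =
  f x * 'D_v ('D_v g) x + 2 * ('D_v f x * 'D_v g x) + g x * 'D_v ('D_v f) x.
Proof.
move=> sf sg.
have E : \near x, 'D_v (fun y => f y * g y) x = f x * 'D_v g x + g x * 'D_v f x.
  apply: filterS2 (smooth_near_near sf) (smooth_near_near sg) => y sfy sgy.
  by rewrite derive_mul//; exact: smooth_near_differentiable.
rewrite (near_eq_derive v E).
have d (h : V -> R) : smooth_near x h -> differentiable h x by exact: smooth_near_differentiable.
have sDf := smooth_near_derive v sf; have sDg := smooth_near_derive v sg.
rewrite (derive_add _ (d _ (smooth_nearM sf sDg)) (d _ (smooth_nearM sg sDf))).
rewrite (derive_mul _ (d _ sf) (d _ sDg)) (derive_mul _ (d _ sg) (d _ sDf)).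
have ringE (A B C D P Q : R) : A * B + C * D + (P * Q + D * C) = A * B + 2 * (D * C) + P * Q.
  by ring.
exact: ringE.
Qed.

Lemma derive2_add V (f g : V -> R) (x v : V) : smooth_near x f -> smooth_near x g ->
  'D_v ('D_v (fun y => f y + g y)) x = 'D_v ('D_v f) x + 'D_v ('D_v g) x.
Proof.
move=> sf sg.
have E : \near x, 'D_v (fun y => f y + g y) x = 'D_v f x + 'D_v g x.
  apply: filterS2 (smooth_near_near sf) (smooth_near_near sg) => y sfy sgy.
  by rewrite derive_add//; exact: smooth_near_differentiable.
rewrite (near_eq_derive v E) derive_add//; apply: smooth_near_differentiable;
  exact: smooth_near_derive.
Qed.

Lemma derive2_compR V (b : R -> R) (g : V -> R) (x v : V) :
  smooth_near x g -> smooth_near (g x) b ->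
  'D_v ('D_v (fun y => b (g y))) x =
  'D_v g x * ('D_v g x * 'D_1 ('D_1 b) (g x)) + 'D_1 b (g x) * 'D_v ('D_v g) x.
Proof.
move=> sg sb.
have nb : \forall y \near x, smooth_near (g y) b.
  exact: (smooth_near_continuous sg) _ (smooth_near_near sb).
have E : \near x, 'D_v (fun y => b (g y)) x = 'D_v g x * 'D_1 b (g x).
  apply: filterS2 (smooth_near_near sg) nb => y sgy sby.
  by rewrite derive_compR//; exact: smooth_near_differentiable.
have sDg := smooth_near_derive v sg; have sDb := smooth_near_derive (1 : R) sb.
have sbg : smooth_near x (fun y => 'D_1 b (g y)) by exact: (@smooth_near_compR _ _ ('D_1 b) g x sDb sg).
rewrite (near_eq_derive v E) derive_mul; [|exact: smooth_near_differentiable..].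
by rewrite (@derive_compR _ _ ('D_1 b) g x v)//; exact: smooth_near_differentiable.
Qed.

(** * Functions that agree up to a factor tending to 1 *)

Lemma line_eps V (h : V -> R) (k : V) (e : R) : differentiable h 0 -> h 0 = 0 -> 0 < e ->
  exists2 d : R, 0 < d &
    forall t : R, 0 < t -> t < d -> `|h (t *: k) - t * 'D_k h 0| <= e * t.
Proof.
move=> dh h0 e0; have k1 : 0 < `|k| + 1 by rewrite ltr_wpDl.
have f0 : 0 < e / (`|k| + 1) by rewrite divr_gt0.
have /nbhs_ballP[d /= d0 dP] := diff_eps dh f0.
exists (d / (`|k| + 1)) => [|t t0 td]; first by rewrite divr_gt0.
have tk1 : t * (`|k| + 1) < d by rewrite -ltr_pdivlMr.
have tkk : t * `|k| <= t * (`|k| + 1) by rewrite ler_wpM2l ?lerDl// ltW.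
have := dP (t *: k); rewrite ball0E normrZ gtr0_norm// => /(_ (le_lt_trans tkk tk1)).
rewrite addr0 h0 subr0 linearZ/= -deriveE// => H; apply: (le_trans H).
rewrite -mulrA ler_wpM2l ?(ltW e0)// mulrCA ler_piMr ?(ltW t0)//.
by rewrite mulrC ler_pdivrMr// mul1r lerDl.
Qed.

Lemma line_bound V (h : V -> R) (k : V) : differentiable h 0 -> h 0 = 0 ->
  exists2 d : R, 0 < d &
    forall t : R, 0 < t -> t < d -> `|h (t *: k)| <= (`|'D_k h 0| + 1) * t.
Proof.
move=> dh h0; have [d d0 dP] := line_eps k dh h0 (@ltr01 R).
exists d => // t t0 td; have := dP t t0 td; rewrite mul1r => H.
have -> : h (t *: k) = (h (t *: k) - t * 'D_k h 0) + t * 'D_k h 0 by rewrite subrK.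
rewrite (le_trans (ler_normD _ _))// normrM (gtr0_norm t0) mulrDl mul1r addrC.
by rewrite lerD// mulrC.
Qed.

Definition small_on_line V (D : V -> R) (k : V) n := forall e : R, 0 < e ->
  exists2 d : R, 0 < d & forall t : R, 0 < t -> t < d -> `|D (t *: k)| <= e * t ^+ n.

Lemma derive_small V (D : V -> R) (k : V) : differentiable D 0 -> D 0 = 0 ->
  small_on_line D k 1 -> 'D_k D 0 = 0.
Proof.
move=> dD D0 small; apply/eqP; apply: contraT => m0.
have m1 : 0 < `|'D_k D 0| by rewrite normr_gt0.
have e0 : 0 < `|'D_k D 0| / 4 by rewrite divr_gt0.
have [d1 d10 H1] := small _ e0; have [d2 d20 H2] := line_eps k dD D0 e0.
pose t := Num.min d1 d2 / 2.
have t0 : 0 < t by rewrite divr_gt0// lt_min d10.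
have tm : t < Num.min d1 d2 by rewrite ltr_pdivrMr// ltr_pMr ?ltr1n// lt_min d10.
have := H1 t t0 (lt_le_trans tm _); rewrite ge_min lexx => /(_ isT).
have := H2 t t0 (lt_le_trans tm _); rewrite ge_min lexx orbT => /(_ isT).
rewrite expr1; move: m1; set m := 'D_k D 0 => m1 {}H2 {}H1.
have : `|t * m| <= `|m| / 4 * t + `|m| / 4 * t.
  have -> : t * m = D (t *: k) - (D (t *: k) - t * m) by rewrite opprB addrC subrK.
  by rewrite (le_trans (ler_normB _ _))// lerD.
rewrite normrM gtr0_norm// => H.
have := mulr_gt0 t0 m1; move: H; set X := `|m|; lra.
Qed.

(** The increment of [D] from [t / 2 *: k] to [t *: k] is [t / 2] times its
    derivative at an intermediate point, hence about [t ^ 2 / 4] times the second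
    derivative at least. *)
Lemma derive2_small V (D : V -> R) (k : V) : smooth_near 0 D -> D 0 = 0 ->
  'D_k D 0 = 0 -> small_on_line D k 2 -> 'D_k ('D_k D) 0 = 0.
Proof.
move=> sD D0 DD0 small; apply/eqP; apply: contraT => m0.
have m1 : 0 < `|'D_k ('D_k D) 0| by rewrite normr_gt0.
have e0 : 0 < `|'D_k ('D_k D) 0| / 32 by rewrite divr_gt0.
have f0 : 0 < `|'D_k ('D_k D) 0| / 8 by rewrite divr_gt0.
have sDD := smooth_near_derive k sD.
(* [1 / 32 + 1 / 32 + 1 / 16 < 1 / 4]. *)
have [d1 d10 H1] := small _ e0.
have [d2 d20 H2] := line_eps k (smooth_near_differentiable sDD) DD0 f0.
have /nbhs_ballP[d3 /= d30 H3] := smooth_near_near sD.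
have k1 : 0 < `|k| + 1 by rewrite ltr_wpDl.
pose d := Num.min d1 (Num.min d2 (d3 / (`|k| + 1))).
have d0 : 0 < d by rewrite !lt_min d10 d20 divr_gt0.
pose t := d / 2.
have t0 : 0 < t by rewrite divr_gt0.
have h0 : 0 < t / 2 by rewrite divr_gt0.
have td : t < d by rewrite ltr_pdivrMr// ltr_pMr ?ltr1n.
have ht : t / 2 < t by rewrite ltr_pdivrMr// ltr_pMr ?ltr1n.
have dd1 : d <= d1 by rewrite ge_min lexx.
have dd2 : d <= d2 by rewrite !ge_min lexx orbT.
have dd3 : d <= d3 / (`|k| + 1) by rewrite !ge_min lexx !orbT.
have sDs s : 0 <= s -> s <= t -> smooth_near (s *: k) D.
  move=> s0 st; apply: H3; rewrite ball0E normrZ ger0_norm//.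
  rewrite (@le_lt_trans _ _ (s * (`|k| + 1))) ?ler_wpM2l ?lerDl// -ltr_pdivlMr//.
  by rewrite (le_lt_trans st)// (lt_le_trans td).
have pt th : t / 2 *: k + th *: (t / 2 *: k) = (t / 2 * (1 + th)) *: k.
  by rewrite scalerA -scalerDl; congr (_ *: _); ring.
have bd th : 0 <= th <= 1 -> 0 < t / 2 * (1 + th) <= t.
  move=> /andP[th0 th1]; rewrite mulr_gt0 ?ltr_pwDl//=.
  have t2 : t = t / 2 * 2 by rewrite divfK.
  by rewrite {2}t2 ler_pM2l// (_ : 2 = 1 + 1)// lerD2l.
have dseg th : 0 <= th <= 1 -> differentiable D (t / 2 *: k + th *: (t / 2 *: k)).
  move=> /bd /andP[s0 st]; rewrite pt; apply: smooth_near_differentiable.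
  by apply: sDs => //; exact: ltW.
have [th th01] := MVT_line dseg.
have [s0 st] := andP (bd _ th01).
rewrite pt; set s := t / 2 * (1 + th) in s0 st *.
have hs : t / 2 <= s by rewrite ler_peMr ?(ltW h0)// lerDl; case/andP: th01.
have -> : t / 2 *: k + t / 2 *: k = t *: k by rewrite -scalerDl -splitr.
have -> : 'D_(t / 2 *: k) D (s *: k) = t / 2 * 'D_k D (s *: k).
  have dDs := smooth_near_differentiable (sDs s (ltW s0) st).
  by rewrite !deriveE// linearZ.
have A1 := H1 t t0 (lt_le_trans td dd1).
have A2 := H1 (t / 2) h0 (lt_le_trans (lt_trans ht td) dd1).
have A3 := H2 s s0 (le_lt_trans st (lt_le_trans td dd2)).
move: A3 A1 A2 m1; set m := 'D_k ('D_k D) 0; set P := 'D_k D (s *: k).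
set Q := D (t *: k); set Q' := D (t / 2 *: k) => A3 A1 A2 m1 E.
have B1 : `|t / 2 * (s * m)| <= `|Q| + `|Q'| + t / 2 * (`|m| / 8 * s).
  have -> : t / 2 * (s * m) = (Q - Q') - t / 2 * (P - s * m) by rewrite E; ring.
  rewrite (le_trans (ler_normB _ _))// lerD ?ler_normB//.
  by rewrite normrM gtr0_norm// ler_wpM2l// ltW.
have N1 : `|t / 2 * (s * m)| = t / 2 * (s * `|m|).
  by rewrite (normrM (t / 2)) (normrM s) (gtr0_norm h0) (gtr0_norm s0).
rewrite N1 in B1.
have A2' : (t / 2) ^+ 2 <= t ^+ 2 by rewrite ler_sqr ?nnegrE ltW.
move: B1 A1 A2 m1 hs st; set X := `|m| => B1 A1 A2 m1 hs st.
have C1 : X / 32 * (t / 2) ^+ 2 <= X / 32 * t ^+ 2 by rewrite ler_wpM2l// ltW// divr_gt0.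
have C2 : t / 2 * (X / 8 * s) <= t / 2 * (X / 8 * t).
  by rewrite ler_wpM2l ?(ltW h0)// ler_wpM2l// ltW// divr_gt0.
have C3 : t / 2 * (t / 2 * X) <= t / 2 * (s * X) by rewrite ler_wpM2l ?(ltW h0)// ler_wpM2r// ltW.
have C4 : 0 < t ^+ 2 * X by rewrite mulr_gt0// exprn_gt0.
have F1 : t / 2 * (t / 2 * X) = t ^+ 2 * X / 4 by field.
have F2 : X / 32 * t ^+ 2 = t ^+ 2 * X / 32 by field.
have F3 : t / 2 * (X / 8 * t) = t ^+ 2 * X / 16 by field.
have G1 : t ^+ 2 * X / 4 <= t ^+ 2 * X / 32 + t ^+ 2 * X / 32 + t ^+ 2 * X / 16.
  rewrite -{1}F1 (le_trans C3)// (le_trans B1)// -F2 -F3 lerD//.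
  by rewrite lerD// (le_trans A2).
move: C4 G1; set Y := t ^+ 2 * X; lra.
Qed.

Lemma near_line V (k : V) (P : V -> Prop) : (\forall z \near (0 : V), P z) ->
  exists2 d : R, 0 < d & forall t, 0 < t -> t < d -> P (t *: k).
Proof.
move=> /nbhs_ballP[d /= d0 dP]; have k1 : 0 < `|k| + 1 by rewrite ltr_wpDl.
exists (d / (`|k| + 1)) => [|t t0 td]; first by rewrite divr_gt0.
apply: dP; rewrite ball0E normrZ gtr0_norm//.
by rewrite (@le_lt_trans _ _ (t * (`|k| + 1))) ?ler_wpM2l ?lerDl ?(ltW t0)// -ltr_pdivlMr.
Qed.

Lemma small_difference V (p q : V -> R) (k : V) n (K : R) :
  (forall e : R, 0 < e -> \forall z \near (0 : V), `|p z - q z| <= e * `|q z|) ->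
  0 < K ->
  (exists2 d : R, 0 < d & forall t : R, 0 < t -> t < d -> `|q (t *: k)| <= K * t ^+ n) ->
  small_on_line (fun z => p z - q z) k n.
Proof.
move=> pq K0 [d d0 dP] e e0; have eK : 0 < e / K by rewrite divr_gt0.
have [d' d'0 d'P] := near_line k (pq _ eK).
exists (Num.min d d') => [|t t0]; first by rewrite lt_min d0.
rewrite lt_min => /andP[td td']; apply: (le_trans (d'P t t0 td')).
apply: (@le_trans _ _ (e / K * (K * t ^+ n))).
  by rewrite ler_wpM2l ?dP// ltW.
by rewrite mulrA divfK// gt_eqF.
Qed.

Lemma derive_sub V (p q : V -> R) (k : V) x : smooth_near x p -> smooth_near x q ->
  'D_k (fun z => p z - q z) x = 'D_k p x - 'D_k q x.
Proof.
move=> sp sq; rewrite -[LHS]/('D_k (p - q) x) deriveB//; apply: diff_derivable;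
  exact: smooth_near_differentiable.
Qed.

Lemma same_derive V (p q : V -> R) (k : V) : smooth_near 0 p -> smooth_near 0 q ->
  p 0 = 0 -> q 0 = 0 ->
  (forall e : R, 0 < e -> \forall z \near (0 : V), `|p z - q z| <= e * `|q z|) ->
  'D_k p 0 = 'D_k q 0.
Proof.
move=> sp sq p0 q0 pq; apply/eqP; rewrite -subr_eq0 -derive_sub//; apply/eqP.
have sD := smooth_nearB sp sq.
apply: derive_small; first exact: smooth_near_differentiable.
  by rewrite p0 q0 subrr.
apply: (@small_difference _ _ _ _ _ (`|'D_k q 0| + 1)) => //.
exact: (line_bound k (smooth_near_differentiable sq) q0).
Qed.

Lemma same_derive2 V (p q : V -> R) (k : V) : smooth_near 0 p -> smooth_near 0 q ->
  p 0 = 0 -> q 0 = 0 ->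
  (forall e : R, 0 < e -> \forall z \near (0 : V), `|p z - q z| <= e * `|q z|) ->
  'D_k q 0 = 0 -> 'D_k ('D_k p) 0 = 'D_k ('D_k q) 0.
Proof.
move=> sp sq p0 q0 pq Dq0; apply/eqP; rewrite -subr_eq0.
have Dp0 : 'D_k p 0 = 0 by rewrite (same_derive k sp sq).
rewrite -derive_sub; [|exact: smooth_near_derive..].
have E : \forall y \near (0 : V), 'D_k p y - 'D_k q y = 'D_k (fun z => p z - q z) y.
  apply: filterS2 (smooth_near_near sp) (smooth_near_near sq) => y spy sqy.
  by rewrite derive_sub.
rewrite (near_eq_derive k E); apply/eqP.
have sD := smooth_nearB sp sq; apply: derive2_small => //.
- by rewrite p0 q0 subrr.
- by rewrite derive_sub// Dp0 Dq0 subrr.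
apply: (@small_difference _ _ _ _ _ (`|'D_k ('D_k q) 0| + 1)) => //.
have sDq := smooth_near_derive k sq.
have [d d0 dP] := line_bound k (smooth_near_differentiable sDq) Dq0.
have [d' d'0 d'P] := near_line k (smooth_near_near sq).
exists (Num.min d d') => [|t t0]; first by rewrite lt_min d0.
rewrite lt_min => /andP[td td'].
have dseg s : 0 <= s <= 1 -> differentiable q (0 + s *: (t *: k)).
  move=> /andP[s0 s1]; rewrite add0r scalerA.
  have [->|sn0] := eqVneq s 0; first by rewrite mul0r scale0r; exact: smooth_near_differentiable.
  apply: smooth_near_differentiable; apply: d'P.
    by rewrite mulr_gt0// lt_neqAle eq_sym sn0.
  by rewrite (le_lt_trans _ td')// ler_piMl// ltW.
have [s s01 E'] := MVT_line dseg.
have ds := dseg s s01.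
move: E'; rewrite add0r q0 subr0 => ->.
rewrite deriveE// linearZ/= -deriveE// add0r scalerA normrM (gtr0_norm t0).
rewrite expr2 mulrCA ler_wpM2l ?(ltW t0)//.
have [s0 s1] := andP s01.
have [->|sn0] := eqVneq s 0.
  by rewrite mul0r scale0r Dq0 normr0 mulr_ge0 ?(ltW t0)// addr_ge0.
have sp0 : 0 < s by rewrite lt_neqAle eq_sym sn0.
have st : s * t <= t by rewrite ler_piMl// ltW.
apply: (le_trans (dP _ (mulr_gt0 sp0 t0) (le_lt_trans st td))).
by rewrite ler_wpM2l// addr_ge0.
Qed.

End Jets.

(** * Charts, and the 2-jet of a cross cap *)

Section Charts.
Context {R : realType}.

Definition chart m n (S : set 'rV[R]_n.+1) (h : 'rV[R]_m.+1 -> 'rV[R]_n.+1)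
    (k : 'rV[R]_n.+1 -> 'rV[R]_m.+1) (x : 'rV[R]_n.+1) :=
  [/\ smooth_near 0 h /\ h 0 = x, smooth_near x k /\ k x = 0,
      \forall z \near (0 : 'rV[R]_m.+1), S (h z) /\ k (h z) = z &
      \forall q \near x, S q -> h (k q) = q].

Lemma local_coordinates_chart m n N (S : set 'rV[R]_n.+1)
    (h : 'rV[R]_m.+1 -> 'rV[R]_n.+1) x :
  local_coordinates N S h x -> exists k, chart S h k x.
Proof.
move=> [N0 h0 [oN sN [Q [k [oO sO hNO kh] ] ] ] ]; exists k.
have Ox : Q x.
  have : (h @` N) x by exists 0.
  by rewrite hNO; case.
split.
- by split=> //; exact: smooth_on_near oN N0 sN.
- by split; [exact: smooth_on_near oO Ox sO|rewrite -h0 kh].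
- apply: (near_open oN N0) => z Nz; split; last exact: kh.
  have : (h @` N) (h z) by exists z.
  by rewrite hNO; case.
- apply: (near_open oO Ox) => q Oq Sq.
  have : (h @` N) q by rewrite hNO.
  by move=> [z Nz <-]; rewrite kh.
Qed.

Lemma chart_image_near m n (S : set 'rV[R]_n.+1) h k x
    (P : 'rV[R]_n.+1 -> Prop) : @chart m n S h k x ->
  (\forall q \near x, P q) -> \forall z \near (0 : 'rV[R]_m.+1), P (h z).
Proof. by move=> [[sh hx] _ _ _]; exact: near_image. Qed.

Definition plane_chart (h k : 'rV[R]_2 -> 'rV[R]_2) p := @chart 1 1 setT h k p.

Lemma plane_chart_near h k p : plane_chart h k p ->
  (\forall z \near (0 : 'rV[R]_2), k (h z) = z) /\ (\forall q \near p, h (k q) = q).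
Proof.
move=> [_ _ kh hk]; split; first by apply: filterS kh => z [].
by apply: filterS hk => q; exact.
Qed.

Lemma change_of_charts xi k1 psi k2 p : plane_chart xi k1 p -> plane_chart psi k2 p ->
  [/\ smooth_near 0 (fun z => k2 (xi z)), k2 (xi 0) = 0,
      \forall z \near (0 : 'rV[R]_2), psi (k2 (xi z)) = xi z &
      exists g', smooth_near 0 g' /\
        \forall z \near (0 : 'rV[R]_2), g' (k2 (xi z)) = z].
Proof.
move=> c1 c2; have [[sxi xi0] [sk1 k10] _ _] := c1; have [[spsi psi0] [sk2 k20] _ _] := c2.
have [kxi xik] := plane_chart_near c1; have [kpsi psik] := plane_chart_near c2.
have E := chart_image_near c1 psik.
split=> //.
- by apply: smooth_near_comp_row => //; rewrite xi0.
- by rewrite xi0.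
- exists (fun z => k1 (psi z)); split.
    by apply: smooth_near_comp_row => //; rewrite psi0.
  by apply: filterS2 E kxi => z ->.
Qed.

Lemma left_inverse_derive n m (g : 'rV[R]_n -> 'rV[R]_m) (g' : 'rV[R]_m -> 'rV[R]_n)
    x (k : 'rV[R]_n) :
  smooth_near x g -> smooth_near (g x) g' -> (\forall z \near x, g' (g z) = z) ->
  'D_k g x = 0 -> k = 0.
Proof.
move=> sg sg' gg' Dk0; apply/rowP => i; rewrite mxE.
have dg := smooth_near_differentiable sg.
have sgi : smooth_near (g x) (fun y => g' y 0 i) by move/smooth_near_rowP: sg'.
have E : \near x, g' (g x) 0 i = x 0 i by apply: filterS gg' => z ->.
have := near_eq_derive k E.
rewrite derive_coord (@derive_comp_at _ _ _ (fun y => g' y 0 i))//.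
  by rewrite Dk0 derive0 => <-.
exact: smooth_near_differentiable.
Qed.

Lemma vec2_v_neq0 : vec2 0 1 != 0 :> 'rV[R]_2.
Proof. by apply/eqP => /rowP /(_ 1)/eqP; rewrite vec2_v mxE oner_eq0. Qed.

(** A local diffeomorphism of the plane whose first coordinate is critical in
    the direction [v] is triangular to first order. *)
Lemma triangular_diffeo (g g' : 'rV[R]_2 -> 'rV[R]_2) :
  smooth_near 0 g -> g 0 = 0 -> smooth_near 0 g' ->
  (\forall z \near (0 : 'rV[R]_2), g' (g z) = z) ->
  partial_v (fun z => g z 0 0) 0 = 0 ->
  partial_u (fun z => g z 0 0) 0 != 0 /\ partial_v (fun z => g z 0 1) 0 != 0.
Proof.
move=> sg g0 sg' gg' gv0.
have dg := smooth_near_differentiable sg.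
have inj (k : 'rV[R]_2) : 'D_k g 0 = 0 -> k = 0.
  by apply: (@left_inverse_derive _ _ g g') => //; rewrite g0.
have Dv : 'D_(vec2 0 1) g 0 = vec2 0 (partial_v (fun z => g z 0 1) 0).
  by apply: row2P; rewrite (derive_row _ _ dg) vec2E.
have Du : 'D_(vec2 1 0) g 0 =
    vec2 (partial_u (fun z => g z 0 0) 0) (partial_u (fun z => g z 0 1) 0).
  by apply: row2P; rewrite (derive_row _ _ dg) vec2E.
set be := partial_v (fun z => g z 0 1) 0 in Dv *.
set al := partial_u (fun z => g z 0 0) 0 in Du *.
set ga := partial_u _ 0 in Du.
clearbody be al ga.
have be0 : be != 0.
  apply/eqP => b0; have /eqP := vec2_v_neq0; apply; apply: inj.
  by rewrite Dv b0; apply: row2P; rewrite vec2E mxE.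
split=> //; apply/eqP => a0.
have := inj (be *: vec2 1 0 + (- ga) *: vec2 0 1).
rewrite derive_linear// Du Dv a0 => H.
have /rowP /(_ 0) : be *: vec2 1 0 + - ga *: vec2 0 1 = 0 :> 'rV[R]_2.
  by apply: H; apply: row2P; rewrite !mxE/=; ring.
by rewrite !mxE/= mulr1 mulr0 addr0 => /eqP; apply/negP.
Qed.

End Charts.

Section TangentJets.
Context {R : realType}.
Variable c : R.
Implicit Types F : 'rV[R]_2 -> 'rV[R]_4.

Lemma qform_derive F G (z v : 'rV[R]_2) : smooth_near z F -> smooth_near z G ->
  smooth_near z (fun z => qform c (F z) (G z)) /\
  'D_v (fun z => qform c (F z) (G z)) z = qform c (F z) ('D_v G z) + qform c ('D_v F z) (G z).
Proof.
move=> sF sG.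
have sFi i : smooth_near z (fun y => F y 0 i) by move/smooth_near_rowP: sF.
have sGi i : smooth_near z (fun y => G y 0 i) by move/smooth_near_rowP: sG.
have dF := smooth_near_differentiable sF; have dG := smooth_near_differentiable sG.
have d (h : 'rV[R]_2 -> R) : smooth_near z h -> differentiable h z.
  exact: smooth_near_differentiable.
have sFG i := smooth_nearM (sFi i) (sGi i).
have D i : 'D_v (fun y => F y 0 i * G y 0 i) z = F z 0 i * 'D_v G z 0 i + 'D_v F z 0 i * G z 0 i.
  rewrite (derive_mul v (d _ (sFi i)) (d _ (sGi i))) -(derive_row v i dF) -(derive_row v i dG).
  by congr (_ + _); rewrite mulrC.
have sS : smooth_near z (fun z => \sum_(i < 3) F z 0 (lift ord0 i) * G z 0 (lift ord0 i)).
  by apply: smooth_near_sum => i; exact: sFG.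
have scS : smooth_near z (fun z => c * dot3 (F z) (G z)).
  by apply: smooth_nearM => //; exact: smooth_near_cst.
split; first exact: (smooth_nearD (sFG 0) scS).
rewrite /qform (derive_add _ (d _ (sFG 0)) (d _ scS)) (derive_cstM _ _ (d _ sS)) D.
have [|_ ->] := @derive_bigsum _ _ _ (fun (i : 'I_3) z => F z 0 (lift ord0 i) * G z 0 (lift ord0 i)) z v.
  by move=> i; exact: d.
under eq_bigr do rewrite D.
by rewrite big_split/= /dot3; ring.
Qed.

(** The equation [qform c (F z) (F z) = 1] is differentiated, twice in the
    direction [v]. *)
Lemma jets_tangent F (u v : 'rV[R]_2) : smooth_near 0 F ->
  (\forall z \near (0 : 'rV[R]_2), space_form c (F z)) -> 'D_v F 0 = 0 ->
  tangent_space c (F 0) ('D_u F 0) /\ tangent_space c (F 0) ('D_v ('D_v F) 0).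
Proof.
move=> sF MF Fv0.
have E : \forall z \near (0 : 'rV[R]_2), qform c (F z) (F z) = 1.
  by apply: filterS MF => z; exact: space_formE.
have two (x : R) : x + x = 0 -> x = 0.
  by move=> /eqP; rewrite -mulr2n -mulr_natr mulf_eq0 pnatr_eq0 orbF => /eqP.
have D (w z : 'rV[R]_2) : smooth_near z F ->
    (\forall z \near z, qform c (F z) (F z) = 1) -> qform c (F z) ('D_w F z) = 0.
  move=> sFz Ez; apply: two; rewrite {2}qformC -(qform_derive w sFz sFz).2.
  by rewrite (near_eq_derive w Ez) (derive_cst (1 : R)).
split; first exact: D.
have Ev : \forall z \near (0 : 'rV[R]_2), qform c (F z) ('D_v F z) = 0.
  apply: filterS2 (smooth_near_near sF) (near_join E) => z; exact: D.
have sFv := smooth_near_derive v sF.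
have := (qform_derive v sF sFv).2; rewrite (near_eq_derive v Ev) (derive_cst (0 : R)).
by rewrite Fv0 qform0l addr0 => H; exact: esym H.
Qed.

(** The derivative of [K] maps the two vectors to [(al, 0, 0)] and
    [(_, 0, 2 be ^ 2)], where [al] and [be] are the nonzero diagonal entries of the
    derivative of [g]. *)
Lemma cross_cap_jets F (g g' : 'rV[R]_2 -> 'rV[R]_2) (K : 'rV[R]_4 -> 'rV[R]_3) :
  smooth_near 0 F -> smooth_near (F 0) K ->
  smooth_near 0 g -> g 0 = 0 -> smooth_near 0 g' ->
  (\forall z \near (0 : 'rV[R]_2), g' (g z) = z) ->
  (\forall z \near (0 : 'rV[R]_2), K (F z) = standard_cross_cap (g z)) ->
  partial_v F 0 = 0 ->
  forall s t : R, s *: partial_u F 0 + t *: partial_v (partial_v F) 0 = 0 ->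
  s = 0 /\ t = 0.
Proof.
move=> sF sK sg g0 sg' gg' KF Fv0.
have sgi i : smooth_near 0 (fun z => g z 0 i) by move/smooth_near_rowP: sg.
have dF := smooth_near_differentiable sF.
pose i2 : 'I_3 := lift ord0 (lift ord0 ord0).
have sKi i : smooth_near (F 0) (fun y => K y 0 i) by move/smooth_near_rowP: sK.
have dKi i := smooth_near_differentiable (sKi i).
have E0 : \forall z \near (0 : 'rV[R]_2), K (F z) 0 0 = g z 0 0.
  by apply: filterS KF => z ->; rewrite /standard_cross_cap mxE.
have E2 : \forall z \near (0 : 'rV[R]_2), K (F z) 0 i2 = g z 0 1 * g z 0 1.
  by apply: filterS KF => z ->; rewrite /standard_cross_cap mxE/= expr2.
have D0 (w : 'rV[R]_2) : 'D_('D_w F 0) (fun y => K y 0 0) (F 0) = 'D_w (fun z => g z 0 0) 0.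
  by rewrite -(@derive_comp_at _ _ _ (fun y => K y 0 0))// (near_eq_derive w E0).
have gv0 : partial_v (fun z => g z 0 0) 0 = 0.
  by rewrite -[LHS]D0 (Fv0 : 'D_(vec2 0 1) F 0 = 0) derive0.
have [al0 be0] := triangular_diffeo sg g0 sg' gg' gv0.
have z1 : g 0 0 1 = 0 by rewrite g0 mxE.
have d1 := smooth_near_differentiable (sgi 1).
have U2 : 'D_(partial_u F 0) (fun y => K y 0 i2) (F 0) = 0.
  rewrite -(@derive_comp_at _ _ _ (fun y => K y 0 i2))//.
  rewrite (near_eq_derive _ E2) (derive_mul _ d1 d1) z1 !mul0r addr0//.
have V2 : 'D_(partial_v (partial_v F) 0) (fun y => K y 0 i2) (F 0) =
    2 * (partial_v (fun z => g z 0 1) 0 * partial_v (fun z => g z 0 1) 0).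
  rewrite -(@derive2_comp_critical _ _ _ (fun y => K y 0 i2))//.
  have E2' : \forall z \near (0 : 'rV[R]_2),
     'D_(vec2 0 1) (fun z => K (F z) 0 i2) z = 'D_(vec2 0 1) (fun z => g z 0 1 * g z 0 1) z.
    by apply: filterS (near_join E2) => z Ez; exact: near_eq_derive.
  rewrite (near_eq_derive _ E2') (derive2_mul _ (sgi 1) (sgi 1)) z1 !mul0r add0r addr0.
  by [].
move=> s t st0.
have lin i : s * 'D_(partial_u F 0) (fun y => K y 0 i) (F 0) +
    t * 'D_(partial_v (partial_v F) 0) (fun y => K y 0 i) (F 0) = 0.
  by rewrite -[LHS](derive_linear _ _ s t (dKi i)) st0 derive0.
have t0 : t = 0.
  have /eqP := lin i2; rewrite U2 V2 mulr0 add0r !mulf_eq0 (negbTE be0) pnatr_eq0/= orbF.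
  by move=> /eqP.
split=> //; have /eqP := lin 0; rewrite t0 mul0r addr0 D0 mulf_eq0.
by rewrite (negbTE (al0 : 'D_(vec2 1 0) (fun z => g z 0 0) 0 != 0)) orbF => /eqP.
Qed.

End TangentJets.

(** * Adapted frames *)

Section FrameCoordLinear.
Context {R : realType}.

Lemma frame_coord_is_linear (c : R) o e i : linear (@frame_coord R c o e i).
Proof.
move=> a x y; rewrite /frame_coord.
have -> : a *: x + y - qform c o (a *: x + y) *: o =
    a *: (x - qform c o x *: o) + 1 *: (y - qform c o y *: o).
  rewrite qformC -[y in qform _ (_ + y) _]scale1r qform_lin !(qformC c o).
  by rewrite scale1r scalerBr scalerDl mul1r scalerA opprD addrACA.
by rewrite metric_lin mul1r.
Qed.

HB.instance Definition _ (c : R) o e i := GRing.isLinear.Build R 'rV[R]_4 R _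
  (@frame_coord R c o e i) (@frame_coord_is_linear c o e i).

Lemma linear_row_smooth n (L : {linear 'rV[R]_n -> R}) (x : 'rV[R]_n) :
  smooth_near x L /\ forall w, 'D_w L x = L w.
Proof.
have sL (y : 'rV[R]_n) : smooth_near y L.
  apply: (@smooth_near_eq R 'rV[R]_n R (fun z => \sum_i z 0 i * L (delta_mx 0 i)) L).
    move=> z; rewrite [in RHS](row_sum_delta z) linear_sum.
    by apply: eq_bigr => i _; rewrite linearZ.
  apply: smooth_near_sum => i; apply: smooth_nearM; first exact: smooth_near_coord.
  exact: smooth_near_cst.
have cL : continuous L by move=> y; exact: smooth_near_continuous.
split=> // w; rewrite deriveE ?diff_lin//; exact: linear_differentiable.
Qed.

End FrameCoordLinear.

Section CharacteristicFrame.
Context {R : realType}.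
Variables (c : R) (o : 'rV[R]_4) (e : 'I_3 -> 'rV[R]_4).
Hypotheses (Mo : space_form c o) (oe : orthoframe c o e).

Lemma mnorm_frame_le (g : 'I_3 -> R) (d : R) : (forall i, `|g i| <= d) ->
  mnorm c (\sum_i g i *: e i) <= 2 * d.
Proof.
move=> gd; have d0 : 0 <= d by exact: le_trans (gd i0).
rewrite (mnorm_frame oe) -[leRHS]ger0_norm ?mulr_ge0// -sqrtr_sqr ler_wsqrtr//.
have g2 i : g i ^+ 2 <= d ^+ 2.
  by rewrite -[g i ^+ 2]real_normK ?num_real// ler_sqr ?nnegrE.
rewrite sum3; have := g2 i0; have := g2 i1; have := g2 i2; have := sqr_ge0 d.
rewrite exprMn; set A := g i0 ^+ 2; set B := g i1 ^+ 2; set C := g i2 ^+ 2.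
set D := d ^+ 2; lra.
Qed.

Lemma mnorm_frame_small (X : 'rV[R]_2 -> 'I_3 -> R) (d : R) :
  (forall i, smooth_near 0 (fun z => X z i)) -> (forall i, X 0 i = 0) -> 0 < d ->
  \forall z \near (0 : 'rV[R]_2), mnorm c (\sum_i X z i *: e i) < d.
Proof.
move=> sX X0 d0; have d4 : 0 < d / 4 by rewrite divr_gt0.
have N i : \forall z \near (0 : 'rV[R]_2), `|X z i| <= d / 4.
  have : \forall z \near (0 : 'rV[R]_2), `|X 0 i - X z i| <= d / 4.
    exact: (cvgr_dist_le _ _ (smooth_near_continuous (sX i))).
  by apply: filterS => z; rewrite X0 sub0r normrN.
apply: filterS3 (N i0) (N i1) (N i2) => z z0 z1 z2.
apply: (@le_lt_trans _ _ (2 * (d / 4))); first by apply: mnorm_frame_le; exact: forall_ord3.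
lra.
Qed.

(** The exponential map is the identity to first order, and it preserves the
    directions, so the 2-jets of a singular map may be computed in the tangent
    space. *)
Lemma exp_map_same_size (X : 'rV[R]_2 -> 'I_3 -> R) i (d : R) :
  (forall i, smooth_near 0 (fun z => X z i)) -> (forall i, X 0 i = 0) -> 0 < d ->
  \forall z \near (0 : 'rV[R]_2),
    `|frame_coord c o e i (exp_map c o (\sum_i X z i *: e i)) - X z i| <= d * `|X z i|.
Proof.
move=> sX X0 d0; have [r r0 rP] := sn_near0 c d0.
apply: filterS (mnorm_frame_small sX X0 r0) => z zr.
rewrite (frame_coord_exp Mo oe); set l := mnorm _ _ in zr *.
have l0 : 0 <= l by exact: sqrtr_ge0.
have [lz|ln] := eqVneq l 0.
  have -> : X z i = 0.
    by apply/eqP; rewrite -normr_le0 -lz; exact: (frame_coord_norm oe).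
  by rewrite mulr0 subr0 normr0 mulr0.
have -> : sn c l / l * X z i - X z i = (sn c l - l) / l * X z i by field.
rewrite !normrM ler_wpM2r// normfV (ger0_norm l0) ler_pdivrMr ?lt_def ?ln//.
have := rP l; rewrite (ger0_norm l0); exact.
Qed.

End CharacteristicFrame.


Section AdaptedFrames.
Context {R : realType}.
Variables (c : R) (o : 'rV[R]_4) (e : 'I_3 -> 'rV[R]_4).
Hypotheses (Mo : space_form c o) (oe : orthoframe c o e).

(** The normal form of a cross cap in geodesic normal coordinates. *)
Definition normal_form (a : 'rV[R]_2 -> R) (b : R -> R) (z : 'rV[R]_2) : 'I_3 -> R :=
  triple (z 0 0) (z 0 0 * z 0 1 + b (z 0 1)) (a z).

Lemma normal_form_smooth a b (g : 'rV[R]_2 -> 'rV[R]_2) i :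
  smooth_near 0 a -> smooth_near 0 b -> smooth_near 0 g -> g 0 = 0 ->
  smooth_near 0 (fun z => normal_form a b (g z) i).
Proof.
move=> sa sb sg g0.
have sgi i' : smooth_near 0 (fun z => g z 0 i') by move/smooth_near_rowP: sg.
move: i; apply: forall_ord3; rewrite /normal_form.
- by under eq_fun do rewrite tripleE; exact: sgi.
- under eq_fun do rewrite tripleE.
  apply: smooth_nearD; first exact: smooth_nearM.
  by apply: (@smooth_near_compR _ _ b (fun z => g z 0 1)) => //; rewrite g0 mxE.
- under eq_fun do rewrite tripleE.
  by apply: (@smooth_near_comp _ _ _ a g) => //; rewrite g0.
Qed.

(** By [exp_map_same_size] the derivatives of [F] are those of the normal form
    composed with [g]. As [F] is critical in the direction [v], so is the first
    coordinate of [g], and ['D_v ('D_v (a \o g))] is a positive multiple of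
    [partial_v (partial_v a)]. *)
Lemma characteristic_adapted (a : 'rV[R]_2 -> R) (b : R -> R) (g g' : 'rV[R]_2 -> 'rV[R]_2) (F : 'rV[R]_2 -> 'rV[R]_4) :
  smooth_near 0 a -> smooth_near 0 b ->
  b 0 = 0 -> 'D_1 b 0 = 0 -> 'D_1 ('D_1 b) 0 = 0 ->
  a 0 = 0 -> partial_u a 0 = 0 -> partial_v a 0 = 0 -> 0 < partial_v (partial_v a) 0 ->
  smooth_near 0 g -> g 0 = 0 -> smooth_near 0 g' ->
  (\forall z \near (0 : 'rV[R]_2), g' (g z) = z) ->
  smooth_near 0 F -> (\forall z \near (0 : 'rV[R]_2), space_form c (F z)) ->
  (\forall z \near (0 : 'rV[R]_2),
     F z = exp_map c o (\sum_i normal_form a b (g z) i *: e i)) ->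
  partial_v F 0 = 0 ->
  adapted e (partial_u F 0) (partial_v (partial_v F) 0).
Proof.
move=> sa sb b0 b1 b2 a0 au av avv sg g0 sg' gg' sF MF FE Fv0.
pose X z i := normal_form a b (g z) i.
have sX i : smooth_near 0 (fun z => X z i) by exact: normal_form_smooth.
have X0 i : X 0 i = 0.
  rewrite /X g0; move: i; apply: forall_ord3; rewrite /normal_form tripleE ?mxE//.
  by rewrite mul0r add0r.
have F0 : F 0 = o.
  rewrite (nbhs_singleton FE); rewrite -[RHS](exp_map0 c); congr exp_map.
  by apply: big1 => i _; rewrite -/(X 0 i) X0 scale0r.
pose y i z := frame_coord c o e i (F z).
have sL i x := linear_row_smooth (frame_coord c o e i) x.
have sy i : smooth_near 0 (y i).
  exact: (@smooth_near_comp _ _ _ (frame_coord c o e i) F 0 (sL i _).1 sF).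
have y0 i : y i 0 = 0.
  rewrite /y F0 /frame_coord (space_formE Mo) scale1r subrr; exact: metric0l.
have close i d : 0 < d -> \forall z \near (0 : 'rV[R]_2), `|y i z - X z i| <= d * `|X z i|.
  move=> d0; have H := exp_map_same_size Mo oe i sX X0 d0.
  by apply: filterS2 FE H => z zE; rewrite /y zE.
have Dy i k : 'D_k (y i) 0 = frame_coord c o e i ('D_k F 0).
  rewrite /y (@derive_comp_at _ _ _ (frame_coord c o e i)) ?(sL i _).2//.
    exact: smooth_near_differentiable.
  by apply: smooth_near_differentiable; exact: (sL i _).1.
have DX i k : frame_coord c o e i ('D_k F 0) = 'D_k (fun z => X z i) 0.
  rewrite -Dy; exact: (same_derive _ (sy i) (sX i) (y0 i) (X0 i) (close i)).
have DvX i : 'D_(vec2 0 1) (fun z => X z i) 0 = 0.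
  by rewrite -DX (Fv0 : 'D_(vec2 0 1) F 0 = 0) linear0.
have DDX i : frame_coord c o e i (partial_v (partial_v F) 0) =
    'D_(vec2 0 1) ('D_(vec2 0 1) (fun z => X z i)) 0.
  rewrite -(same_derive2 (sy i) (sX i) (y0 i) (X0 i) (close i) (DvX i)).
  rewrite (@derive2_comp_critical _ _ _ (frame_coord c o e i)) ?(sL i _).2//.
  exact: (sL i _).1.
have sgi i' : smooth_near 0 (fun z => g z 0 i') by move/smooth_near_rowP: sg.
have dgi i' := smooth_near_differentiable (sgi i').
have gi0 i' : g 0 0 i' = 0 by rewrite g0 mxE.
have XE0 : (fun z => X z i0) = (fun z => g z 0 0).
  by apply/funext => z; rewrite /X /normal_form tripleE.
have XE1 : (fun z => X z i1) = (fun z => g z 0 0 * g z 0 1 + b (g z 0 1)).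
  by apply/funext => z; rewrite /X /normal_form tripleE.
have XE2 : (fun z => X z i2) = (fun z => a (g z)).
  by apply/funext => z; rewrite /X /normal_form tripleE.
have gv0 : partial_v (fun z => g z 0 0) 0 = 0 by have := DvX i0; rewrite XE0.
have [al0 be0] := triangular_diffeo sg g0 sg' gg' gv0.
set al := partial_u (fun z => g z 0 0) 0 in al0.
set be := partial_v (fun z => g z 0 1) 0 in be0.
have sb0 : smooth_near (g 0 0 1) b by rewrite gi0.
have sbg : smooth_near 0 (fun z => b (g z 0 1)).
  exact: (@smooth_near_compR _ _ b (fun z => g z 0 1)).
have db : differentiable b (g 0 0 1) by exact: smooth_near_differentiable.
have sgg := smooth_nearM (sgi 0) (sgi 1).
have U1 : 'D_(vec2 1 0) (fun z => X z i1) 0 = 0.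
  rewrite XE1 derive_add; [|exact: smooth_near_differentiable..].
  rewrite derive_mul// !gi0 !mul0r !add0r (derive_compR _ (dgi 1) db) gi0 b1.
  by rewrite mulr0.
have sa0 : smooth_near (g 0) a by rewrite g0.
have da0 := smooth_near_differentiable sa0.
have dg := smooth_near_differentiable sg.
have U2 : 'D_(vec2 1 0) (fun z => X z i2) 0 = 0.
  rewrite XE2 (@derive_comp_at _ _ _ a)// derive_vec2// g0 au av.
  by rewrite !scaler0 addr0.
have V1 : 'D_(vec2 0 1) ('D_(vec2 0 1) (fun z => X z i1)) 0 = 0.
  rewrite XE1 (derive2_add _ sgg sbg) (derive2_mul _ (sgi 0) (sgi 1)).
  have E (p q r s t : R) : 0 * p + 2 * (0 * q) + 0 * r + (s * (s * 0) + 0 * t) = 0 by ring.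
  rewrite (derive2_compR _ (sgi 1) sb0) (gi0 0) (gi0 1) b1 b2.
  by rewrite (gv0 : 'D_(vec2 0 1) (fun z => g z 0 0) 0 = 0) E.
have V2 : 'D_(vec2 0 1) ('D_(vec2 0 1) (fun z => X z i2)) 0 != 0.
  have savg := smooth_near_derive (vec2 0 1) sa0.
  have davg := smooth_near_differentiable savg.
  have -> : 'D_(vec2 0 1) ('D_(vec2 0 1) (fun z => X z i2)) 0 =
      be * (be * partial_v (partial_v a) 0).
    rewrite XE2 (derive2_comp _ sg sa0) sum2 !delta_vec2u !delta_vec2v g0.
    rewrite (gv0 : 'D_(vec2 0 1) (fun z => g z 0 0) 0 = 0).
    rewrite (au : 'D_(vec2 1 0) a 0 = 0) (av : 'D_(vec2 0 1) a 0 = 0).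
    have E (p q r s : R) : 0 * p + 0 * q + (be * r + 0 * s) = be * r by ring.
    rewrite E; congr (_ * _).
    rewrite (@derive_comp_at _ _ _ ('D_(vec2 0 1) a) g 0 (vec2 0 1) dg davg).
    rewrite (derive_vec2 _ davg) !(derive_row _ _ dg) g0.
    by rewrite (gv0 : 'D_(vec2 0 1) (fun z => g z 0 0) 0 = 0) scale0r add0r.
  by rewrite !mulf_neq0// gt_eqF.
exists al, (frame_coord c o e i0 (partial_v (partial_v F) 0)),
  (frame_coord c o e i2 (partial_v (partial_v F) 0)).
have [tu tv] := jets_tangent (vec2 1 0) sF MF (Fv0 : 'D_(vec2 0 1) F 0 = 0).
rewrite F0 in tu tv.
split=> //.
- by rewrite DDX.
- rewrite [LHS](frame_decomp Mo oe) (tu : qform c o (partial_u F 0) = 0) scale0r add0r sum3.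
  rewrite (DX i0) (DX i1) (DX i2) U1 U2 !scale0r !addr0 XE0.
  by [].
- rewrite [LHS](frame_decomp Mo oe) (tv : qform c o (partial_v (partial_v F) 0) = 0).
  by rewrite scale0r add0r sum3 (DDX i1) V1 scale0r addr0.
Qed.

End AdaptedFrames.

(** * Gram-Schmidt *)

Section GramSchmidt.
Context {R : realType}.
Variables (c : R) (o : 'rV[R]_4).
Hypothesis Mo : space_form c o.

(** Three homogeneous linear equations in R^4 have a nonzero solution. *)
Lemma orthogonal_tangent (x y : 'rV[R]_4) : exists w,
  [/\ w != 0, tangent_space c o w, metric c w x = 0 & metric c w y = 0].
Proof.
pose A : 'M[R]_(4, 3) := \matrix_(i, j)
  triple (qform c (delta_mx 0 i) o) (metric c (delta_mx 0 i) x)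
    (metric c (delta_mx 0 i) y) j.
have AE (w : 'rV[R]_4) : w *m A = 0 ->
    [/\ tangent_space c o w, metric c w x = 0 & metric c w y = 0].
  move=> wA; have wj j : \sum_i w 0 i * A i j = 0.
    by have /rowP /(_ j) := wA; rewrite !mxE.
  split.
  - rewrite tangentE qformC {1}(row_sum_delta w) qform_suml -[RHS](wj i0).
    by apply: eq_bigr => i _; rewrite qformZl mxE tripleE.
  - rewrite {1}(row_sum_delta w) metric_suml -[RHS](wj i1).
    by apply: eq_bigr => i _; rewrite metricZl mxE tripleE.
  - rewrite {1}(row_sum_delta w) metric_suml -[RHS](wj i2).
    by apply: eq_bigr => i _; rewrite metricZl mxE tripleE.
apply: contrapT => H.
have : row_free A.
  apply: inj_row_free => w wA; apply: contrapT => /eqP w0; apply: H.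
  by have [w1 w2 w3] := AE w wA; exists w.
by rewrite /row_free => /eqP rA; have := rank_leq_col A; rewrite rA.
Qed.

Lemma adapted_frame_exists (fu fvv : 'rV[R]_4) :
  tangent_space c o fu -> tangent_space c o fvv ->
  (forall s t : R, s *: fu + t *: fvv = 0 -> s = 0 /\ t = 0) ->
  exists2 e, orthoframe c o e & adapted e fu fvv.
Proof.
move=> tu tv free.
have fu0 : fu != 0.
  apply/eqP => u0; have [] := free 1 0; first by rewrite u0 scaler0 scale0r addr0.
  by move/eqP; rewrite oner_eq0.
have [r r0] := normalize_tangent Mo tu fu0.
set x := r *: fu => -[ox x1].
pose v := fvv - metric c fvv x *: x.
have ov : tangent_space c o v.
  rewrite tangentE qformC qformBl qformZl !(qformC c _ o).
  by rewrite (tv : qform c o fvv = 0) (ox : qform c o x = 0) mulr0 subrr.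
have v0 : v != 0.
  apply/eqP => v0; have [|_ /eqP] := free (- (metric c fvv x * r)) 1.
    by rewrite scaleNr -scalerA scale1r addrC.
  by rewrite oner_eq0.
have vx : metric c v x = 0 by rewrite metricBl metricZl x1 mulr1 subrr.
have [s s0] := normalize_tangent Mo ov v0.
set z := s *: v => -[oz z1].
have zx : metric c z x = 0 by rewrite metricZl vx mulr0.
have [y' [y'0 oy' y'x y'z]] := orthogonal_tangent x z.
have [t t0] := normalize_tangent Mo oy' y'0.
set y := t *: y' => -[oy y1].
have yx : metric c y x = 0 by rewrite metricZl y'x mulr0.
have yz : metric c y z = 0 by rewrite metricZl y'z mulr0.
exists (triple x y z).
  split; first by apply: forall_ord3; rewrite tripleE.
  apply: forall_ord3; apply: forall_ord3; rewrite !tripleE !i3E//.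
  - by rewrite metricC.
  - by rewrite metricC.
  - by rewrite metricC.
exists r^-1, (metric c fvv x), s^-1; split; rewrite ?invr_eq0// !tripleE.
- by rewrite /x scalerA mulVf// scale1r.
- by rewrite /z scalerA mulVf// scale1r /v addrC subrK.
Qed.

End GramSchmidt.

(** * Lifting symmetries of the standard cross cap *)

Section CrossCapLift.
Context {R : realType}.
Notation plane := 'rV[R]_2.
Notation space := 'rV[R]_3.

Lemma derive_nonneg (V : normedModType R) (h : V -> R) (k : V) :
  differentiable h 0 -> h 0 = 0 -> (\forall z \near (0 : V), 0 <= h z) ->
  0 <= 'D_k h 0.
Proof.
move=> dh h0 hge; rewrite leNgt; apply/negP => Dn.
have e0 : 0 < - 'D_k h 0 / 2 by rewrite divr_gt0// oppr_gt0.
have [d1 d10 H1] := line_eps k dh h0 e0; have [d2 d20 H2] := near_line k hge.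
pose t := Num.min d1 d2 / 2.
have t0 : 0 < t by rewrite divr_gt0// lt_min d10.
have : t < Num.min d1 d2 by rewrite ltr_pdivrMr// ltr_pMr ?ltr1n// lt_min d10.
rewrite lt_min => /andP[t1 t2]; have := H1 t t0 t1; have := H2 t t0 t2.
have := nmulr_llt0 t Dn; rewrite t0; set m := 'D_k h 0; set X := h _.
by rewrite ler_norml => ? ? /andP[? ?]; lra.
Qed.

Lemma derive_min (V : normedModType R) (h : V -> R) (k : V) :
  differentiable h 0 -> h 0 = 0 -> (\forall z \near (0 : V), 0 <= h z) ->
  'D_k h 0 = 0.
Proof.
move=> dh h0 hge; apply/le_anti; rewrite derive_nonneg// andbT.
have := derive_nonneg (- k) dh h0 hge.
by rewrite !deriveE// linearN oppr_ge0.
Qed.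

(** The complement of the axis [u = 0] is dense. *)
Lemma near_off_axis (D : plane -> R) :
  (\forall z \near (0 : plane), smooth_near z D) ->
  (\forall z \near (0 : plane), (z : plane) 0 0 != 0 -> D z = 0) ->
  \forall z \near (0 : plane), D z = 0.
Proof.
move=> cD /near_join D0; apply: filterS2 cD D0 => z /smooth_near_continuous cz Dz.
apply/eqP; apply: contraT => Dz0.
have [z0|z0] := eqVneq (z 0 0) 0; last by rewrite (nbhs_singleton Dz)// eqxx in Dz0.
have : \forall y \near z, D y != 0.
  exact: cz _ (open_nbhs_nbhs (conj (@open_neq _ 0) Dz0)).
move=> N; have /nbhs_ballP[d /= d0 H] : \forall y \near z, D y != 0 /\ (y 0 0 != 0 -> D y = 0).
  by apply: filterS2 N Dz.
have [] := H (z + d / 2 *: vec2 1 0).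
  rewrite -ball_normE /ball_/= opprD addrA subrr sub0r normrN normrZ.
  have v1 : `|vec2 1 0 : plane| <= 1 by apply: vec2_norm_le; rewrite ?normr1// normr0.
  rewrite gtr0_norm ?divr_gt0// (le_lt_trans (ler_wpM2l _ v1)) ?divr_ge0 ?(ltW d0)// mulr1.
  by rewrite ltr_pdivrMr// ltr_pMr// ltr1n.
move=> Dn /(_ _) De; rewrite De ?eqxx// in Dn.
by rewrite !mxE/= z0 add0r mulr1 gt_eqF// divr_gt0.
Qed.

Lemma vec3_0 (x y z : R) : vec3 x y z 0 0 = x. Proof. by rewrite mxE. Qed.
Lemma vec3_1 (x y z : R) : vec3 x y z 0 1 = y. Proof. by rewrite mxE. Qed.
Lemma vec3_2 (x y z : R) : vec3 x y z 0 (lift ord0 (lift ord0 ord0)) = z.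
Proof. by rewrite mxE. Qed.
Notation j2 := (lift ord0 (lift ord0 ord0) : 'I_3).

Lemma row3P (x y : space) : x 0 0 = y 0 0 -> x 0 1 = y 0 1 -> x 0 j2 = y 0 j2 -> x = y.
Proof.
move=> h0 h1 h2; apply/rowP => -[[|[|[|//]]] i3].
- by rewrite (_ : Ordinal i3 = 0)//; apply: val_inj.
- by rewrite (_ : Ordinal i3 = 1)//; apply: val_inj.
- by rewrite (_ : Ordinal i3 = j2)//; apply: val_inj.
Qed.

Notation F0 := (@standard_cross_cap R).

Lemma cross_cap_u z : F0 z 0 0 = z 0 0. Proof. exact: vec3_0. Qed.
Lemma cross_cap_uv z : F0 z 0 1 = z 0 0 * z 0 1. Proof. exact: vec3_1. Qed.
Lemma cross_cap_vv z : F0 z 0 j2 = z 0 1 * z 0 1.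
Proof. by rewrite vec3_2 expr2. Qed.

Lemma cross_cap_smooth z : smooth_near z F0.
Proof.
apply/smooth_near_rowP => i.
have c0 := smooth_near_coord 0 z; have c1 := smooth_near_coord 1 z.
case: i => -[|[|[|//]]] i3.
- by apply: smooth_near_eq c0 => y; rewrite /standard_cross_cap mxE.
- by apply: smooth_near_eq (smooth_nearM c0 c1) => y; rewrite /standard_cross_cap mxE.
- by apply: smooth_near_eq (smooth_nearX 2 c1) => y; rewrite /standard_cross_cap mxE.
Qed.

Lemma derive_cross_cap (z k : plane) :
  'D_k F0 z = vec3 (k 0 0) (z 0 0 * k 0 1 + z 0 1 * k 0 0) (2 * (z 0 1 * k 0 1)).
Proof.
have dF := smooth_near_differentiable (cross_cap_smooth z).
have d0 := smooth_near_differentiable (smooth_near_coord 0 z).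
have d1 := smooth_near_differentiable (smooth_near_coord 1 z).
apply: row3P; rewrite derive_row// /standard_cross_cap.
- by under eq_fun do rewrite vec3_0; rewrite derive_coord vec3_0.
- under eq_fun do rewrite vec3_1.
  by rewrite (derive_mul _ d0 d1) !derive_coord vec3_1.
- under eq_fun do rewrite vec3_2 expr2.
  by rewrite (derive_mul _ d1 d1) !derive_coord vec3_2; ring.
Qed.

Lemma cross_cap0 : F0 0 = 0.
Proof. by apply: row3P; rewrite !mxE/= ?mulr0 ?expr0n. Qed.

Variable tau : space -> space.
Hypotheses (stau : smooth_near 0 tau) (tau0 : tau 0 = 0)
  (tautau : \forall y \near (0 : space), tau (tau y) = y)
  (tauF : \forall z \near (0 : plane), exists z', tau (F0 z) = F0 z').

Let G i (z : plane) : R := tau (F0 z) 0 i.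

Lemma sG i : smooth_near 0 (G i).
Proof.
have sti : smooth_near (F0 0) (fun y => tau y 0 i).
  by rewrite cross_cap0; move/smooth_near_rowP: stau.
exact: (@smooth_near_comp _ _ _ (fun y => tau y 0 i) F0 0 sti (cross_cap_smooth 0)).
Qed.

Lemma G0 i : G i 0 = 0. Proof. by rewrite /G cross_cap0 tau0 mxE. Qed.

(** The equation of the cross cap, together with the sign condition that cuts off
    its handle. *)
Lemma umbrella : \forall z \near (0 : plane),
  0 <= G j2 z /\ G 1 z ^+ 2 = G 0 z ^+ 2 * G j2 z.
Proof.
apply: filterS tauF => z [z' E]; rewrite /G E /standard_cross_cap !mxE/=.
by rewrite sqr_ge0 exprMn.
Qed.

Lemma derive_G i (k : plane) : 'D_k (G i) 0 = 'D_(k 0 0 *: delta_mx 0 0) (fun y => tau y 0 i) 0.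
Proof.
have sti : smooth_near (F0 0) (fun y => tau y 0 i).
  by rewrite cross_cap0; move/smooth_near_rowP: stau.
have dti := smooth_near_differentiable sti.
have dF := smooth_near_differentiable (cross_cap_smooth 0).
rewrite /G (@derive_comp_at _ _ _ (fun y => tau y 0 i) F0 0 k dF dti) cross_cap0.
congr ('D_(_) _ _); rewrite derive_cross_cap.
by apply: row3P; rewrite !mxE/=; ring.
Qed.

(** [G j2] is nonnegative, so it has a minimum at 0; the equation then makes [G 1]
    negligible against [u]. *)
Lemma tangent_line_preserved : partial_u (G j2) 0 = 0 /\ partial_u (G 1) 0 = 0.
Proof.
have d i := smooth_near_differentiable (sG i).
split.
  by apply: derive_min => //; [exact: G0|apply: filterS umbrella => z []].
apply: derive_small; [exact: d|exact: G0|] => e e0.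
have [d1 d10 H1] := line_bound (vec2 1 0) (d 0) (G0 0).
set K := `|_| + 1 in H1; have K0 : 0 < K by rewrite ltr_wpDl.
have eK : 0 < (e / K) ^+ 2 by rewrite exprn_gt0// divr_gt0.
have N : \forall z \near (0 : plane), `|G j2 z| <= (e / K) ^+ 2.
  have : \forall z \near (0 : plane), `|G j2 0 - G j2 z| <= (e / K) ^+ 2.
    exact: (cvgr_dist_le _ _ (smooth_near_continuous (sG j2))).
  by apply: filterS => z; rewrite G0 sub0r normrN.
have [d2 d20 H2] := near_line (vec2 1 0) N.
have [d3 d30 H3] := near_line (vec2 1 0) umbrella.
exists (Num.min d1 (Num.min d2 d3)) => [|t t0]; first by rewrite !lt_min d10 d20.
rewrite !lt_min => /and3P[t1 t2 t3].
have [_ E] := H3 t t0 t3; rewrite expr1.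
rewrite -(@ler_sqr _ `|_|) ?nnegrE// ?mulr_ge0 ?(ltW e0) ?(ltW t0)//.
rewrite -normrX E normrM normrX.
have -> : (e * t) ^+ 2 = (K * t) ^+ 2 * (e / K) ^+ 2 by field; rewrite gt_eqF.
apply: ler_pM => //; last exact: H2.
by rewrite ler_sqr ?nnegrE ?mulr_ge0 ?(ltW K0) ?(ltW t0)// H1.
Qed.

(** The derivative of an involution is an involution, and this one preserves the
    tangent line. *)
Lemma lambda_neq0 : partial_u (G 0) 0 != 0.
Proof.
have [u2 u1] := tangent_line_preserved.
have dtau := smooth_near_differentiable stau.
have D i : partial_u (G i) 0 = 'D_(delta_mx 0 0) (fun y => tau y 0 i) 0.
  by rewrite /partial_u derive_G vec2_u scale1r.
set l := partial_u (G 0) 0.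
have Dtau : 'D_(delta_mx 0 0) tau 0 = l *: delta_mx 0 0.
  apply: row3P; rewrite (derive_row _ _ dtau) -D ?u1 ?u2 !mxE/= ?mulr0//.
  by rewrite mulr1.
have st0 : smooth_near (tau 0) (fun y => tau y 0 0).
  by rewrite tau0; move/smooth_near_rowP: stau.
have dt0 := smooth_near_differentiable st0.
have E : \forall y \near (0 : space), tau (tau y) 0 0 = y 0 0.
  by apply: filterS tautau => y ->.
have := near_eq_derive (delta_mx 0 0) E.
rewrite (@derive_comp_at _ _ _ (fun y => tau y 0 0) tau 0 _ dtau dt0).
rewrite derive_coord mxE/= Dtau tau0 in dt0 *.
rewrite deriveE// linearZ/= -deriveE// -D -/l => ll.
by apply/eqP => l0; move/eqP: ll; rewrite l0 scale0r eq_sym oner_eq0.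
Qed.

(** The double points of the cross cap go to points of the axis. Indeed the
    equation [H] of the preimage vanishes on two transversal sheets there, hence
    is critical, whereas [x^2 z - y^2] is critical only on the axis. *)
Lemma double_points : \forall z \near (0 : plane), (z : plane) 0 0 = 0 -> G 0 z = 0 /\ G 1 z = 0.
Proof.
pose sigma (y : space) := y 0 j2 * (y 0 0 * y 0 0) - y 0 1 * y 0 1.
have ssig y : smooth_near y sigma.
  have c i := smooth_near_coord i y.
  by apply: smooth_nearB; [apply: smooth_nearM => //|]; exact: smooth_nearM.
pose H y := sigma (tau y).
pose good (y : space) := smooth_near y tau /\ (\forall x \near y, tau (tau x) = x).
have N1 : \forall y \near (0 : space), good y.
  by apply: filterS2 (smooth_near_near stau) (near_join tautau).
have N2 : \forall y \near (0 : space), good (tau y).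
  exact: (near_image stau tau0 N1).
have N3 : \forall z \near (0 : plane), good (F0 z) /\ good (tau (F0 z)).
  have N12 : \forall y \near (0 : space), good y /\ good (tau y) by apply: filterS2 N1 N2.
  exact: (near_image (cross_cap_smooth 0) cross_cap0 N12).
have N4 : \forall z \near (0 : plane), \forall y \near z, H (F0 y) = 0.
  apply: near_join; apply: filterS umbrella => z [_ E].
  by rewrite /H /sigma -!expr2 -/(G j2 z) -/(G 0 z) -/(G 1 z) E mulrC subrr.
have : \forall z \near (0 : plane), (good (F0 z) /\ good (tau (F0 z))) /\
    \forall y \near z, H (F0 y) = 0 by apply: filterS2 N3 N4.
move=> /nbhs_ballP[r /= r0 P].
have {}P z : `|z| < r -> (good (F0 z) /\ good (tau (F0 z))) /\
    \forall y \near z, H (F0 y) = 0 by move=> zr; apply: P; rewrite ball0E.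
apply/nbhs_ballP; exists r => // z; rewrite ball0E => zr z0.
have [[[stq ttq] [stt ttt]] Hz] := P z zr.
(* The two sheets through [F0 z] come from [z] and [- z]. *)
have [v0|v0] := eqVneq (z 0 1) 0.
  have -> : z = 0 by apply: row2P; rewrite ?z0 ?v0 mxE.
  by rewrite !G0.
have zrN : `|- z| < r by rewrite normrN.
have [_ Hz'] := P _ zrN.
set q := F0 z in stq ttq stt ttt *.
have qN : F0 (- z) = q.
  by apply: row3P; rewrite /q /standard_cross_cap !mxE/= ?z0; ring.
have sH : smooth_near q H.
  exact: (@smooth_near_comp _ _ _ sigma tau q (ssig _) stq).
have dH := smooth_near_differentiable sH.
have sheet (y k : plane) : F0 y = q -> (\forall x \near y, H (F0 x) = 0) -> 'D_('D_k F0 y) H q = 0.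
  move=> yq Hy; have dF := smooth_near_differentiable (cross_cap_smooth y).
  have := near_eq_derive k Hy; rewrite (@derive_comp_at _ _ _ H F0)// ?yq// => ->.
  exact: derive_cst.
have A1 := sheet z (vec2 1 0) erefl Hz.
have A2 := sheet (- z) (vec2 1 0) qN Hz'.
have A3 := sheet z (vec2 0 1) erefl Hz.
have crit w : 'D_w H q = 0.
  have -> : w = 1 *: ((w 0 0 / 2 + w 0 1 / (2 * z 0 1)) *: 'D_(vec2 1 0) F0 z +
      (w 0 0 / 2 - w 0 1 / (2 * z 0 1)) *: 'D_(vec2 1 0) F0 (- z)) +
      (w 0 j2 / (2 * z 0 1)) *: 'D_(vec2 0 1) F0 z.
    apply: row3P; rewrite !derive_cross_cap !mxE/= ?z0; field; exact: v0.
  rewrite (derive_linear _ _ _ _ dH) (derive_linear _ _ _ _ dH) A1 A2 A3.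
  by rewrite [X in 1 *: X + _](_ : _ = 0) ?scaler0 ?addr0// !scaler0 addr0.
have ttq0 : tau (tau q) = q := nbhs_singleton ttq.
have E : \forall x \near tau q, H (tau x) = sigma x.
  by apply: filterS ttt => x; rewrite /H => ->.
have Dsig w : 'D_w sigma (tau q) = 0.
  rewrite -(near_eq_derive w E) (@derive_comp_at _ _ _ H tau).
  - by rewrite ttq0 crit.
  - exact: smooth_near_differentiable.
  - by rewrite ttq0.
have c i := smooth_near_differentiable (smooth_near_coord i (tau q)).
have c00 := differentiableM (c 0) (c 0).
have Dsigma w : 'D_w sigma (tau q) =
  tau q 0 j2 * (tau q 0 0 * w 0 0 + tau q 0 0 * w 0 0) + tau q 0 0 * tau q 0 0 * w 0 j2
  - (tau q 0 1 * w 0 1 + tau q 0 1 * w 0 1).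
  have scc := smooth_nearM (smooth_near_coord 0 (tau q)) (smooth_near_coord 0 (tau q)).
  have sc1 := smooth_nearM (smooth_near_coord 1 (tau q)) (smooth_near_coord 1 (tau q)).
  have sc2 := smooth_nearM (smooth_near_coord j2 (tau q)) scc.
  rewrite (derive_sub _ sc2 sc1) (derive_mul _ (c j2) c00).
  by rewrite (derive_mul _ (c 0) (c 0)) (derive_mul _ (c 1) (c 1)) !derive_coord.
have two (x : R) : x + x = 0 -> x = 0.
  by move=> /eqP; rewrite -mulr2n -mulr_natr mulf_eq0 pnatr_eq0 orbF => /eqP.
split.
- have := Dsig (delta_mx 0 j2); rewrite Dsigma !mxE/= !mulr0 !addr0 mulr0 add0r subr0 mulr1.
  by move=> /eqP; rewrite mulf_eq0 orbb => /eqP.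
- have := Dsig (delta_mx 0 1); rewrite Dsigma !mxE/= !mulr0 !addr0 mulr0 !add0r mulr1.
  by move=> /eqP; rewrite oppr_eq0 => /eqP /two.
Qed.

Lemma quotient_sqr (u a b g : R) : u != 0 -> a != 0 ->
  (u * b) ^+ 2 = (u * a) ^+ 2 * g -> b / a * (b / a) - g = 0.
Proof.
move=> u0 a0 E; have -> : g = (u * b) ^+ 2 / (u * a) ^+ 2.
  by rewrite E mulrAC divff ?mul1r// expf_neq0// mulf_neq0.
by field; rewrite u0 a0.
Qed.

(** The lift of [tau] to the plane is [(u h1, h2 / h1)], where [u h1] and [u h2]
    are the first two coordinates of [tau] on the cross cap. *)
Lemma cross_cap_lift : exists phi : plane -> plane,
  [/\ smooth_near 0 phi, phi 0 = 0,
      \forall z \near (0 : plane), F0 (phi z) = tau (F0 z) &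
      \forall z \near (0 : plane), phi (phi z) = z].
Proof.
have ax (P : plane -> Prop) : (\forall z \near (0 : plane), (z : plane) 0 0 = 0 -> P z) ->
    \forall v \near (0 : R), P (vec2 0 v).
  move=> /nbhs_ballP[r /= r0 H]; apply/nbhs_ballP; exists r => // v; rewrite ball0E => vr.
  apply: H; last exact: vec2_u.
  rewrite ball0E (@le_lt_trans _ _ `|v|)//.
  by apply: vec2_norm_le => //; rewrite normr0.
have [|h1 [sh1 h1E h10]] := hadamard (sG 0).
  by apply: (ax (fun z => G 0 z = 0)); apply: filterS double_points => z H /H[].
have [|h2 [sh2 h2E h20]] := hadamard (sG 1).
  by apply: (ax (fun z => G 1 z = 0)); apply: filterS double_points => z H /H[].
have l0 := lambda_neq0; have [_ u1] := tangent_line_preserved.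
rewrite -h10 in l0; rewrite u1 in h20.
have sq := smooth_nearM sh2 (smooth_nearV l0 sh1).
have sc := smooth_nearM (smooth_near_coord 0 (0 : plane)) sh1.
pose phi (z : plane) := vec2 (z 0 0 * h1 z) (h2 z / h1 z).
have sphi : smooth_near 0 phi.
  apply/smooth_near_rowP; apply: forall_ord2.
    by apply: smooth_near_eq sc => z; rewrite vec2_u.
  by apply: smooth_near_eq sq => z; rewrite vec2_v.
have phi0 : phi 0 = 0.
  by apply: row2P; rewrite vec2E mxE ?mul0r// h20 mul0r.
have h1n : \forall z \near (0 : plane), h1 z != 0.
  exact: (smooth_near_continuous sh1) _ (open_nbhs_nbhs (conj (@open_neq _ 0) l0)).
have third : \forall z \near (0 : plane), (h2 z / h1 z) * (h2 z / h1 z) - G j2 z = 0.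
  apply: near_off_axis.
    exact: smooth_near_near (smooth_nearB (smooth_nearM sq sq) (sG j2)).
  have N : \forall z \near (0 : plane), G 0 z = z 0 0 * h1 z /\ G 1 z = z 0 0 * h2 z.
    by apply: filterS2 h1E h2E.
  apply: filterS3 umbrella N h1n => z [_ E] [E0 E1] h1z z0.
  by rewrite E0 E1 in E; exact: (quotient_sqr z0 h1z E).
have lift : \forall z \near (0 : plane), F0 (phi z) = tau (F0 z).
  have N : \forall z \near (0 : plane), G 0 z = z 0 0 * h1 z /\ G 1 z = z 0 0 * h2 z.
    by apply: filterS2 h1E h2E.
  apply: filterS3 third N h1n => z /eqP; rewrite subr_eq0 => /eqP E2 [E0 E1] h1z.
  apply: row3P.
  - by rewrite cross_cap_u /phi vec2_u -E0.
  - rewrite cross_cap_uv /phi vec2_u vec2_v -[RHS]/(G 1 z) E1.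
    by rewrite -mulrA (mulrC (h1 z)) divfK.
  - by rewrite cross_cap_vv /phi vec2_v E2.
exists phi; split=> //.
have F0n : \forall z \near (0 : plane), F0 (phi (phi z)) = F0 z.
  have N1 : \forall z \near (0 : plane), F0 (phi (phi z)) = tau (F0 (phi z)).
    exact: (near_image sphi phi0 lift).
  have N2 : \forall z \near (0 : plane), tau (tau (F0 z)) = F0 z.
    exact: (near_image (cross_cap_smooth 0) cross_cap0 tautau).
  by apply: filterS3 N1 lift N2 => z -> ->.
have sphi' : smooth_near (phi 0) phi by rewrite phi0.
have spp : smooth_near 0 (fun z => phi (phi z)) by exact: smooth_near_comp_row.
(* The cross cap is injective off the axis [u = 0]. *)
have coord i : (\forall z \near (0 : plane), (z : plane) 0 0 != 0 -> phi (phi z) 0 i - z 0 i = 0) ->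
    \forall z \near (0 : plane), phi (phi z) 0 i - z 0 i = 0.
  apply: near_off_axis; apply: smooth_near_near; apply: smooth_nearB.
    by move/smooth_near_rowP: spp.
  exact: smooth_near_coord.
have C0 : \forall z \near (0 : plane), phi (phi z) 0 0 - z 0 0 = 0.
  by apply: filterS F0n => z /rowP /(_ 0); rewrite !cross_cap_u => ->; rewrite subrr.
have C1 : \forall z \near (0 : plane), phi (phi z) 0 1 - z 0 1 = 0.
  apply: coord; apply: filterS2 F0n C0 => z /rowP /(_ 1); rewrite !cross_cap_uv => E /eqP.
  by rewrite subr_eq0 => /eqP E0 z0; rewrite E0 in E; rewrite (mulfI z0 E) subrr.
apply: filterS2 C0 C1 => z /eqP; rewrite subr_eq0 => /eqP E0 /eqP.
by rewrite subr_eq0 => /eqP E1; exact: row2P.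
Qed.

End CrossCapLift.

(** * Involutions of a neighborhood *)

Section Involutions.
Context {R : realType}.
Notation plane := 'rV[R]_2.

Lemma ball_connected (p : plane) (r : R) : 0 < r -> connected (ball p r).
Proof.
move=> r0.
have -> : ball p r = \bigcup_(x in ball p r)
    ((fun t : R => p + t *: (x - p)) @` `[0, 1]%classic).
  apply/seteqP; split=> [x xr|y [x xr [t]]].
    exists x => //; exists 1; first by rewrite /= in_itv/= lexx ler01.
    by rewrite scale1r addrC subrK.
  rewrite /= in_itv/= => /andP[t0 t1] <-; move: xr; rewrite -!ball_normE /ball_/=.
  rewrite opprD addrA subrr sub0r normrN normrZ ger0_norm// distrC => xr.
  by rewrite (le_lt_trans _ xr)// ler_piMl.
apply: bigcup_connected.
  exists p => x _; exists 0; first by rewrite /= in_itv/= lexx ler01.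
  by rewrite scale0r addr0.
move=> x _; apply: connected_continuous_connected; first exact: segment_connected.
apply: continuous_subspaceT => t.
have st : smooth_near t (fun t : R => p + t *: (x - p)).
  apply: smooth_nearD; first exact: smooth_near_cst.
  exact: (smooth_near_scale _ (smooth_near_id t)).
exact: (smooth_near_continuous st).
Qed.

(** A germ of an involution fixing [p] becomes an involution of the connected
    neighborhood [B `|` phi @` B] for a small ball [B]. *)
Lemma germ_involution (U : set plane) (f : plane -> 'rV[R]_4) (p : plane) T phi :
  open U -> U p -> smooth_near p phi -> phi p = p ->
  (\forall q \near p, phi (phi q) = q) ->
  (\forall q \near p, f (phi q) = T (f q)) -> lifts_to_involution U f p T.
Proof.
move=> oU Up sphi phip inv lift.
have N1 : \forall q \near p, smooth_near q phi /\ U q.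
  by apply: filterS2 (smooth_near_near sphi) (open_nbhs_nbhs (conj oU Up)).
have : \forall q \near p, [/\ smooth_near q phi /\ U q, phi (phi q) = q & f (phi q) = T (f q)].
  by apply: filterS3 N1 inv lift => q; split.
move=> /nbhs_ballP[d /= d0 dP].
pose D := ball p d; have oD : open D by exact: ball_open.
have Dp : D p by exact: ballxx.
have N2 : \forall q \near p, D q /\ D (phi q).
  have ND : \forall q \near p, D q by exact: open_nbhs_nbhs.
  by apply: filterS2 ND (near_image sphi phip ND).
have /nbhs_ballP[s /= s0 sP] := N2.
pose B := ball p s; have oB : open B by exact: ball_open.
have BD : B `<=` D by move=> q /sP[].
have phiBE : phi @` B = D `&` (phi @^-1` B).
  apply/seteqP; split=> [q [y By <-]|q [Dq Bq]].
    have [Dy Dphi] := sP _ By; split=> //=.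
    by have [_ -> _] := dP _ Dy.
  by exists (phi q) => //; have [_ -> _] := dP _ Dq.
have ophiB : open (phi @` B).
  rewrite phiBE openE => q [Dq Bq]; rewrite /interior.
  have [[sq _] _ _] := dP _ Dq.
  apply: filterI; first exact: open_nbhs_nbhs.
  exact: (near_image sq erefl (open_nbhs_nbhs (conj oB Bq))).
have WD : B `|` phi @` B `<=` D.
  by move=> q [/BD//|]; rewrite phiBE => -[].
exists (B `|` phi @` B), phi; split.
- split.
  + exact: openU.
  + apply: connectedU.
    * exists p; split; first exact: ballxx.
      by exists p => //; exact: ballxx.
    * exact: ball_connected.
    * apply: connected_continuous_connected; first exact: ball_connected.
      apply: continuous_in_subspaceT => q; rewrite inE => Bq.
      by have [[sq _] _ _] := dP _ (BD _ Bq); exact: (smooth_near_continuous sq).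
  + by left; exact: ballxx.
  + by move=> q /WD Dq; have [[_ Uq] _ _] := dP _ Dq.
- by apply: near_smooth_on => q /WD Dq; have [[sq _] _ _] := dP _ Dq.
- exact: phip.
- move=> q Wq; have [_ E _] := dP _ (WD _ Wq); split=> //.
  case: Wq => [Bq|[y By yq]]; first by right; exists q.
  by left; rewrite -yq; have [_ -> _] := dP _ (BD _ By).
- by move=> q /WD Dq; have [_ _ ->] := dP _ Dq.
Qed.

Lemma chart_involution (U : set plane) (f : plane -> 'rV[R]_4) (p : plane) T
    (h k phi : plane -> plane) :
  open U -> U p -> plane_chart h k p -> smooth_near 0 phi -> phi 0 = 0 ->
  (\forall z \near (0 : plane), phi (phi z) = z) ->
  (\forall z \near (0 : plane), f (h (phi z)) = T (f (h z))) ->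
  lifts_to_involution U f p T.
Proof.
move=> oU Up ch sphi phi0 inv lift.
have [[sh h0] [sk k0] _ _] := ch; have [kh hk] := plane_chart_near ch.
have sphik : smooth_near p (fun q => phi (k q)).
  by apply: smooth_near_comp_row => //; rewrite k0.
have phik0 : phi (k p) = 0 by rewrite k0.
apply: (@germ_involution U f p T (fun q => h (phi (k q)))) => //.
- by apply: smooth_near_comp_row => //; rewrite phik0.
- by rewrite phik0.
- have N1 : \forall q \near p, k (h (phi (k q))) = phi (k q) by exact: (near_image sphik phik0 kh).
  have N2 : \forall q \near p, phi (phi (k q)) = k q by exact: (near_image sk k0 inv).
  by apply: filterS3 N1 N2 hk => q -> -> ->.
- have N := near_image sk k0 lift.
  by apply: filterS2 N hk => q -> ->.
Qed.

Lemma involution_invariant (U : set plane) (f : plane -> 'rV[R]_4) (p : plane) T :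
  lifts_to_involution U f p T -> image_germ_invariant U f p T.
Proof.
move=> [W [phi [[oW _ Wp _] sphi phip _ lift]]] U' pU' U'U.
have sp : smooth_near p phi by exact: smooth_on_near oW Wp sphi.
exists [set q | W q /\ U' q /\ U' (phi q)]; split.
- have N : \forall q \near p, U' (phi q) by exact: (near_image sp phip pU').
  have NW : \forall q \near p, W q by exact: open_nbhs_nbhs.
  by apply: filterS3 NW pU' N.
- by move=> q [_ []].
- by move=> _ [_ [q [Wq [_ U'q]] <-] <-]; exists (phi q) => //; rewrite lift.
Qed.

End Involutions.

Section ReflectionSmooth.
Context {R : realType}.

Lemma qform_is_linear (c : R) o : linear (qform c o).
Proof. by move=> a x y; rewrite qformC -[y]scale1r qform_lin !(qformC c _ o) mul1r scale1r. Qed.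

HB.instance Definition _ (c : R) o :=
  GRing.isLinear.Build R 'rV[R]_4 R _ (qform c o) (@qform_is_linear c o).

Lemma frame_reflection_smooth (c : R) o e d x :
  smooth_near x (frame_reflection c o e d).
Proof.
apply: smooth_nearD; first exact: (smooth_near_scale o (linear_row_smooth (qform c o) x).1).
apply: smooth_near_sum => i; apply: (smooth_near_scale (e i)).
apply: smooth_nearM; first exact: smooth_near_cst.
exact: (linear_row_smooth (frame_coord c o e i) x).1.
Qed.

End ReflectionSmooth.

(** * Cross caps with a symmetry *)

Section SymmetricCrossCaps.
Context {R : realType}.
Variables (c : R) (U : set 'rV[R]_2) (f : 'rV[R]_2 -> 'rV[R]_4) (p : 'rV[R]_2).
Hypotheses (openU : open U) (Up : U p) (f_smooth : smooth_on U f)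
  (f_maps : forall z, U z -> space_form c (f z)).
Notation plane := 'rV[R]_2.
Notation F0 := (@standard_cross_cap R).

Let Mo : space_form c (f p) := f_maps Up.
Let f_near : smooth_near p f := smooth_on_near openU Up f_smooth.

Lemma f_maps_near : \forall q \near p, space_form c (f q).
Proof. by apply: (near_open openU Up) => q; exact: f_maps. Qed.

Section Chart.
Variables (h k : plane -> plane) (ch : plane_chart h k p).

Let h0 : h 0 = p. Proof. by case: ch => -[]. Qed.
Let sh : smooth_near 0 h. Proof. by case: ch => -[]. Qed.

Lemma chart_map_smooth : smooth_near 0 (f \o h).
Proof. by apply: smooth_near_comp_row => //; rewrite h0. Qed.

Lemma chart_map_space_form : \forall z \near (0 : plane), space_form c ((f \o h) z).
Proof. exact: (near_image sh h0 f_maps_near). Qed.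

End Chart.

Variables (xi kx : plane -> plane) (ch_xi : plane_chart xi kx p).
Hypothesis xi_fv : partial_v (f \o xi) 0 = 0.
Let F := f \o xi.
Let F00 : F 0 = f p. Proof. by rewrite /F/=; case: ch_xi => -[_ ->]. Qed.
Let sF : smooth_near 0 F := chart_map_smooth ch_xi.
Let MF := chart_map_space_form ch_xi.

Variables (xi0 k0 : plane -> plane) (Psi : 'rV[R]_3 -> 'rV[R]_4) (K : 'rV[R]_4 -> 'rV[R]_3).
Hypotheses (ch_xi0 : plane_chart xi0 k0 p) (ch_Psi : @chart R 2 3 (space_form c) Psi K (f p))
  (fPsi : \forall z \near (0 : plane), f (xi0 z) = Psi (F0 z)).

Let sPsi : smooth_near 0 Psi. Proof. by case: ch_Psi => -[]. Qed.
Let Psi0 : Psi 0 = f p. Proof. by case: ch_Psi => -[]. Qed.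
Let sK : smooth_near (f p) K. Proof. by case: ch_Psi => _ []. Qed.
Let K0 : K (f p) = 0. Proof. by case: ch_Psi => _ []. Qed.

Lemma KPsi : \forall y \near (0 : 'rV[R]_3), space_form c (Psi y) /\ K (Psi y) = y.
Proof. by case: ch_Psi. Qed.

Lemma PsiK : \forall x \near f p, space_form c x -> Psi (K x) = x.
Proof. by case: ch_Psi. Qed.

Lemma KPsiF0 : \forall z \near (0 : plane), K (f (xi0 z)) = F0 z.
Proof.
have N := near_image (cross_cap_smooth 0) cross_cap0 KPsi.
by apply: filterS2 N fPsi => z [_ E] ->.
Qed.

Lemma cross_cap_adapted : exists2 e, orthoframe c (f p) e &
  adapted e (partial_u F 0) (partial_v (partial_v F) 0).
Proof.
have [sg g0 xig [g' [sg' gg']]] := change_of_charts ch_xi ch_xi0.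
have [tu tv] := jets_tangent (vec2 1 0) sF MF (xi_fv : 'D_(vec2 0 1) F 0 = 0).
rewrite F00 in tu tv.
apply: adapted_frame_exists => //.
have sKF : smooth_near (F 0) K by rewrite F00.
apply: (@cross_cap_jets _ F (fun z => k0 (xi z)) g' K) => //.
have N := near_image sg g0 KPsiF0.
by apply: filterS2 N xig => z <- ->.
Qed.

Section Symmetry.
Variables (j : mirror) (T : 'rV[R]_4 -> 'rV[R]_4).
Hypothesis T_j : cross_cap_symmetry c f p xi j T.

(** On the space form the symmetry is the restriction of a smooth involution of
    R^4, so it induces a smooth involution of R^3 in the chart that brings the
    map to the standard cross cap. *)
Lemma invariant_involution :
  image_germ_invariant U f p T -> lifts_to_involution U f p T.
Proof.
move=> inv; have [e oe ad] := cross_cap_adapted.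
have TL := symmetry_reflection Mo oe ad T_j.
set L := frame_reflection c (f p) e (mirror_sign j) in TL.
have LL x : L (L x) = x by apply: frame_reflectionK => // i; exact: mirror_signM.
have ML x : space_form c x -> space_form c (L x).
  by move=> Mx; rewrite -TL//; case: T_j => -[[Tf _ _] _] _ _; exact: Tf.
have Lo : L (f p) = f p.
  rewrite -TL//; case: T_j => _ fixT _; apply: fixT.
  exists 0; last exact: exp_map0.
  by have := mirror_tangent_fixed oe 0 ad (mirror_sign2 j); rewrite scale0r.
have sL x : smooth_near x L by exact: frame_reflection_smooth.
pose tau y := K (L (Psi y)).
have sLPsi : smooth_near 0 (fun y => L (Psi y)) by exact: smooth_near_comp_row.
have LPsi0 : L (Psi 0) = f p by rewrite Psi0.
have stau : smooth_near 0 tau by apply: smooth_near_comp_row => //; rewrite LPsi0.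
have tau0 : tau 0 = 0 by rewrite /tau LPsi0.
have Psitau : \forall y \near (0 : 'rV[R]_3), Psi (tau y) = L (Psi y).
  have N := near_image sLPsi LPsi0 PsiK.
  by apply: filterS2 N KPsi => y H [My _]; apply: H; exact: ML.
have tautau : \forall y \near (0 : 'rV[R]_3), tau (tau y) = y.
  by apply: filterS2 Psitau KPsi => y E [_ KE]; rewrite {1}/tau E LL.
have sxi0 : smooth_near 0 xi0 by case: ch_xi0 => -[].
have xi00 : xi0 0 = p by case: ch_xi0 => -[].
have sk0 : smooth_near p k0 by case: ch_xi0 => _ [].
have k00 : k0 p = 0 by case: ch_xi0 => _ [].
have [_ xik] := plane_chart_near ch_xi0.
have nU : \forall q \near p, U q by exact: open_nbhs_nbhs.
have TF0 : \forall z \near (0 : plane), tau (F0 z) = K (T (f (xi0 z))).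
  have N := near_image sxi0 xi00 nU.
  by apply: filterS2 N fPsi => z Uz E; rewrite /tau -E TL//; exact: f_maps.
have tauF : \forall z \near (0 : plane), exists z', tau (F0 z) = F0 z'.
  (* On [U'] the map is given by the standard cross cap. *)
  pose U' := [set q | [/\ U q, xi0 (k0 q) = q & K (f (xi0 (k0 q))) = F0 (k0 q)]].
  have pU' : nbhs p U'.
    have N := near_image sk0 k00 KPsiF0.
    by apply: filterS3 nU xik N => q q1 q2 q3; split.
  have [V [pV _ TV]] := inv U' pU' (fun q => fun '(And3 Uq _ _) => Uq).
  have N : \forall z \near (0 : plane), V (xi0 z) by exact: (near_image sxi0 xi00 pV).
  apply: filterS2 TF0 N => z -> Vz.
  have [q [_ kq KE] qE] : (f @` U') (T (f (xi0 z))).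
    by apply: TV; exists (f (xi0 z)) => //; exists (xi0 z).
  by exists (k0 q); rewrite -qE -KE kq.
have [phi [sphi phi0 lift inv2]] := cross_cap_lift stau tau0 tautau tauF.
apply: (chart_involution openU Up ch_xi0 sphi phi0 inv2).
have N1 := near_image sphi phi0 fPsi.
have N2 := near_image (cross_cap_smooth 0) cross_cap0 Psitau.
have N3 : \forall z \near (0 : plane), Psi (F0 (phi z)) = L (Psi (F0 z)).
  by apply: filterS2 lift N2 => z ->.
have N4 : \forall z \near (0 : plane), L (f (xi0 z)) = T (f (xi0 z)).
  by apply: filterS (near_image sxi0 xi00 nU) => z Uz; rewrite TL//; exact: f_maps.
by apply: filterS2 (filterS2 _ (fun z a b => conj a b) N1 N3) (filterS2 _ (fun z a b => conj a b) fPsi N4) => z [-> ->] [-> ->].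
Qed.

Section Characteristic.
Variables (a : plane -> R) (b : R -> R) (psi k : plane -> plane) (e : 'I_3 -> 'rV[R]_4).
Hypotheses (sa : smooth_near 0 a) (sb : smooth_near 0 b)
  (b0 : b 0 = 0) (b1 : 'D_1 b 0 = 0) (b2 : 'D_1 ('D_1 b) 0 = 0)
  (a0 : a 0 = 0) (au : partial_u a 0 = 0) (av : partial_v a 0 = 0)
  (avv : 0 < partial_v (partial_v a) 0)
  (oe : orthoframe c (f p) e) (ch_psi : plane_chart psi k p)
  (fpsi : \forall z \near (0 : plane),
     f (psi z) = exp_map c (f p) (\sum_i normal_form a b z i *: e i)).

Let sgn : 'I_3 -> R := mirror_sign j.

Lemma symmetry_normal_form : \forall z \near (0 : plane),
  T (f (psi z)) = exp_map c (f p) (\sum_i (sgn i * normal_form a b z i) *: e i).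
Proof.
have [sg g0 psig [g' [sg' gg']]] := change_of_charts ch_xi ch_psi.
have FE : \forall z \near (0 : plane),
    F z = exp_map c (f p) (\sum_i normal_form a b (k (xi z)) i *: e i).
  by apply: filterS2 (near_image sg g0 fpsi) psig => z <- ->.
have ad := characteristic_adapted Mo oe sa sb b0 b1 b2 a0 au av avv sg g0 sg' gg' sF MF FE xi_fv.
have TL := symmetry_reflection Mo oe ad T_j.
have spsi : smooth_near 0 psi by case: ch_psi => -[].
have psi0 : psi 0 = p by case: ch_psi => -[].
apply: filterS2 (near_image spsi psi0 f_maps_near) fpsi => z Mz E.
by rewrite TL// E reflection_exp//; exact: mirror_signM.
Qed.

Lemma sgn2 : sgn i2 = 1. Proof. exact: mirror_sign2. Qed.

Lemma sgn_symmetry (z : plane) :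
  let u := z 0 0 in let v := z 0 1 in
  match j with
  | principal_plane => a (vec2 u (- v)) = a (vec2 u v) /\ b v = - b (- v)
  | normal_plane => a (vec2 u v) = a (vec2 (- u) (- v)) /\ b v = b (- v)
  | normal_line => a (vec2 (- u) v) = a (vec2 u v) /\ b v = 0
  end <->
  a (vec2 (sgn i0 * u) (sgn i0 * sgn i1 * v)) = a z /\ b (sgn i0 * sgn i1 * v) = sgn i1 * b v.
Proof.
move=> u v; rewrite -[in a z](vec2_eta z) -/u -/v /sgn.
have half (x : R) : x = - x -> x = 0.
  by move=> /eqP; rewrite -subr_eq0 opprK -mulr2n -mulr_natr mulf_eq0 pnatr_eq0 orbF => /eqP.
case: (j); rewrite /= !tripleE ?(mulNr, mulrN, mul1r, opprK).
- by split=> -[-> E]; split=> //; rewrite E ?opprK.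
- by split=> -[-> E]; split.
- split=> -[-> E]; split=> //; first by rewrite E oppr0.
  exact: half.
Qed.

(** As the exponential map is injective near 0, the normal form intertwines the
    involution, read in the chart [psi], with the diagonal matrix of [T]; then
    [second_coordinate_rigid] applies. *)
Lemma involution_symmetry :
  lifts_to_involution U f p T -> characteristic_symmetry j a b.
Proof.
move=> [W [phi [[oW _ Wp _] sphi phip _ lift]]].
have {}sphi : smooth_near p phi by exact: smooth_on_near oW Wp sphi.
have [[spsi psi0] [sk k00] _ _] := ch_psi; have [kpsi psik] := plane_chart_near ch_psi.
have spp : smooth_near 0 (fun z => phi (psi z)).
  by apply: smooth_near_comp_row => //; rewrite psi0.
have pp0 : phi (psi 0) = p by rewrite psi0.
pose w z := k (phi (psi z)).
have sw : smooth_near 0 w by apply: smooth_near_comp_row => //; rewrite pp0.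
have w0 : w 0 = 0 by rewrite /w pp0.
have nW : \forall q \near p, W q by exact: open_nbhs_nbhs.
pose X z i := normal_form a b (w z) i.
pose Y z i := sgn i * normal_form a b z i.
have E : \forall z \near (0 : plane),
    exp_map c (f p) (\sum_i X z i *: e i) = exp_map c (f p) (\sum_i Y z i *: e i).
  have N1 := near_image sw w0 fpsi; have N2 := near_image spp pp0 psik.
  have N3 := near_image spsi psi0 nW.
  have N : \forall z \near (0 : plane), f (psi (w z)) = T (f (psi z)).
    by apply: filterS2 N2 N3 => z E Wz; rewrite /w E lift.
  by apply: filterS3 N1 N symmetry_normal_form => z <- -> ->.
have sid : smooth_near (0 : plane) id by exact: smooth_near_id.
have id0 : id (0 : plane) = 0 by [].
have nf0 i : normal_form a b 0 i = 0.
  by move: i; apply: forall_ord3; rewrite /normal_form tripleE ?mxE// mul0r add0r.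
have [d d0 inj] := exp_map_frame_inj Mo oe.
have XY : \forall z \near (0 : plane), forall i, X z i = Y z i.
  have NX : \forall z \near (0 : plane), mnorm c (\sum_i X z i *: e i) < d.
    apply: (mnorm_frame_small oe) => // i; first exact: normal_form_smooth.
    by rewrite /X w0.
  have NY : \forall z \near (0 : plane), mnorm c (\sum_i Y z i *: e i) < d.
    apply: (mnorm_frame_small oe) => // i; last by rewrite /Y nf0 mulr0.
    apply: smooth_nearM; first exact: smooth_near_cst.
    exact: (@normal_form_smooth _ a b id).
  by apply: filterS3 NX NY E => z; exact: inj.
have w_u : \forall z \near (0 : plane), w z 0 0 = sgn i0 * (z : plane) 0 0.
  by apply: filterS XY => z /(_ i0); rewrite /X /Y /normal_form !tripleE.
have w_a : \forall z \near (0 : plane), a (w z) = a z.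
  by apply: filterS XY => z /(_ i2); rewrite /X /Y sgn2 mul1r /normal_form !tripleE.
have eqn : \forall z \near (0 : plane), sgn i0 * (z : plane) 0 0 * w z 0 1 + b (w z 0 1) =
    sgn i1 * (z 0 0 * z 0 1 + b (z 0 1)).
  apply: filterS2 XY w_u => z /(_ i1) + wu.
  by rewrite /X /Y /normal_form !tripleE wu.
have sw1 : smooth_near 0 (fun z => w z 0 1) by move/smooth_near_rowP: sw.
have w10 : w 0 0 1 = 0 by rewrite w0 mxE.
have R1 := second_coordinate_rigid (mirror_signM j i0) (mirror_signM j i1)
  sw1 w10 sb b1 b2 eqn.
apply: filterS3 R1 w_u w_a => z [wv bv] wu wa.
apply/sgn_symmetry; split=> //.
by rewrite -wv -wu vec2_eta.
Qed.

Lemma symmetry_involution :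
  characteristic_symmetry j a b -> lifts_to_involution U f p T.
Proof.
move=> sym; pose w (z : plane) := vec2 (sgn i0 * z 0 0) (sgn i0 * sgn i1 * z 0 1).
have s00 : sgn i0 * sgn i0 = 1 by exact: mirror_signM.
have s11 : sgn i1 * sgn i1 = 1 by exact: mirror_signM.
have sw : smooth_near 0 w.
  apply/smooth_near_rowP; apply: forall_ord2.
    have := smooth_nearM (smooth_near_cst (sgn i0) 0) (smooth_near_coord 0 (0 : plane)).
    by apply: smooth_near_eq => z; rewrite vec2_u.
  have := smooth_nearM (smooth_near_cst (sgn i0 * sgn i1) 0) (smooth_near_coord 1 (0 : plane)).
  by apply: smooth_near_eq => z; rewrite vec2_v.
have w0 : w 0 = 0 by apply: row2P; rewrite vec2E !mxE mulr0.
have ww z : w (w z) = z.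
  apply: row2P; rewrite !vec2E mulrA ?s00 ?mul1r//.
  by rewrite mulrACA s00 s11 !mul1r.
apply: (chart_involution openU Up ch_psi sw w0); first by apply: filterS sym => z _; exact: ww.
have N : \forall z \near (0 : plane), forall i, normal_form a b (w z) i = sgn i * normal_form a b z i.
  apply: filterS sym => z /sgn_symmetry[Ea Eb]; apply: forall_ord3; rewrite /normal_form !tripleE.
  - by rewrite vec2_u.
  - rewrite !vec2E Eb mulrDr; congr (_ + _).
    by rewrite -[RHS]mul1r -s00; ring.
  - by rewrite sgn2 mul1r.
have N1 := near_image sw w0 fpsi.
apply: filterS3 N N1 symmetry_normal_form => z E -> ->.
by congr exp_map; apply: eq_bigr => i _; rewrite E.
Qed.

End Characteristic.
End Symmetry.
End SymmetricCrossCaps.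

Section CharacteristicData.
Context {R : realType}.

Lemma characteristic_data (c : R) eps (f : 'rV[R]_2 -> 'rV[R]_4) p
    (a : 'rV[R]_2 -> R) (b : R -> R) :
  characteristic_functions c eps f p a b ->
  [/\ 'D_1 b 0 = 0, 'D_1 ('D_1 b) 0 = 0 &
  exists psi k e, [/\ orthoframe c (f p) e, plane_chart psi k p &
    \forall z \near (0 : 'rV[R]_2),
      f (psi z) = exp_map c (f p) (\sum_i normal_form a b z i *: e i)]].
Proof.
move=> [_ _ [_ b1 b2] _ [e1 [e2 [e3 [N [psi [[[t1 [t2 t3]] [n1 n2 n3] [m12 m13 m23] _] cpsi _ fE]]]]]]].
have DE : derive1 b = 'D_1 b by apply/funext => x; rewrite derive1E.
have DE2 : derive1 (derive1 b) 0 = 'D_1 ('D_1 b) 0 by rewrite derive1E DE.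
split; [by rewrite -derive1E|by rewrite -DE2|].
have [k ck] := local_coordinates_chart cpsi.
exists psi, k, (triple e1 e2 e3); split; [|exact: ck|].
  split; first by apply: forall_ord3; rewrite tripleE.
  have m21 := etrans (metricC c e2 e1) m12; have m31 := etrans (metricC c e3 e1) m13.
  have m32 := etrans (metricC c e3 e2) m23.
  apply: forall_ord3; apply: forall_ord3; rewrite !tripleE !i3E
    ?(n1, n2, n3) ?(m12, m13, m23) ?(m21, m31, m32); reflexivity.
apply: filterS fE => z zE; rewrite zE; congr (exp_map _ _ _).
by rewrite sum3 /normal_form !tripleE.
Qed.

End CharacteristicData.

Theorem propositionD (R : realType) (c : R) (eps : bool)
    (U : set 'rV[R]_2) (f : 'rV[R]_2 -> 'rV[R]_4) (p : 'rV[R]_2)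
    (openU : open U) (Up : U p)
    (f_smooth : smooth_on U f) (f_maps : forall z, U z -> space_form c (f z))
    (f_cross_cap : cross_cap c f p)
    (N : set 'rV[R]_2) (xi : 'rV[R]_2 -> 'rV[R]_2)
    (xi_coord : local_coordinates N setT xi p)
    (xi_fv : partial_v (f \o xi) 0 = 0)
    (j : mirror) (T : 'rV[R]_4 -> 'rV[R]_4)
    (T_j : cross_cap_symmetry c f p xi j T) :
  (image_germ_invariant U f p T <-> lifts_to_involution U f p T) /\
  (forall (a : 'rV[R]_2 -> R) (b : R -> R),
    characteristic_functions c eps f p a b ->
    (image_germ_invariant U f p T <-> characteristic_symmetry j a b)).
Proof.
have [kx ch_xi] := local_coordinates_chart xi_coord.
have [N0 [xi0 [N' [Psi [cxi0 cPsi fPsi]]]]] := f_cross_cap.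
have [k0 ch_xi0] := local_coordinates_chart cxi0.
have [K ch_Psi] := local_coordinates_chart cPsi.
have i_ii := @invariant_involution R c U f p openU Up f_smooth f_maps xi kx ch_xi
  xi_fv xi0 k0 Psi K ch_xi0 ch_Psi fPsi j T T_j.
split; first by split; [exact: i_ii|exact: involution_invariant].
move=> a b char; have [b1 b2 [psi [k [e [oe ch_psi fpsi]]]]] := characteristic_data char.
have [sa sb [b0 _ _] [a0 au av avv] _] := char.
split=> [/i_ii|].
  exact: (involution_symmetry openU Up f_smooth f_maps ch_xi xi_fv T_j sa sb
    b0 b1 b2 a0 au av avv oe ch_psi fpsi).
move=> sym; apply: involution_invariant.
exact: (symmetry_involution openU Up f_smooth f_maps ch_xi xi_fv T_j sa sb
  b0 b1 b2 a0 au av avv oe ch_psi fpsi sym).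
Qed.
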